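(* For $n\ge 0$ let $P_n(y)=\frac{1}{2^n n!}\frac{d^n}{dy^n}\big((y^2-1)^n\big)$ be the $n$-th Legendre polynomial, and let \[ \tilde F(y,z)=\sum_{n=0}^\infty \binom{2n}{n} P_n(y)^2 z^n . \] For $u,x$ define \[ I_{\pm}(u,x)=\frac{1}{\pi}\int_0^1 \frac{1-uv\pm v\sqrt{2u^2-2u}}{\sqrt{v(1-v)\big((1-v)(1-u^2v)(1+uv)^2+x\,v(1-uv)^2\big)}}\,dv , \] and put \[ w=\sqrt{(1+4z)^2-16y^2z}+4y\sqrt{-z}. \] Then for all real $y,z$ with $|z|<R_y$, where $R_y=\frac14\min\big(|y+\sqrt{y^2-1}|,|y-\sqrt{y^2-1}|\big)^2$, \[ \tilde F(y,z)=w\,I_+(4z,w^2)\,I_-(4z,w^2). \] Here $\sqrt{(1+4z)^2-16y^2z}$ and the square root in the denominator of the integrand denote the branches with positive real part (which are $1+O(z)$, resp. $1+O(z^{1/2})$), while the signs chosen for $\sqrt{-z}$ and for $\sqrt{2u^2-2u}$ are arbitrary (they do not affect the identity).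
   Context: $R_y$ is the radius of convergence of $\tilde F(y,\cdot)$ for fixed $y$. The argument $u$ of $I_\pm$ is set to $4z$ and the argument $x$ to $w^2$. *)

(* Defs.v *)
From Stdlib Require Import Factorial Reals Lra Psatz.
From Coquelicot Require Import Coquelicot.
Open Scope R_scope.

Definition legendre (n : nat) (y : R) : R :=
  / (2 ^ n * INR (fact n)) * Derive_n (fun t => (t ^ 2 - 1) ^ n) n y.

(* [C] alone is Coquelicot's type of complex numbers. *)
Definition Ftilde_coef (y : R) (n : nat) : R :=
  Binomial.C (2 * n) n * legendre n y ^ 2.

Definition Ftilde (y z : R) : R := PSeries (Ftilde_coef y) z.

(* Principal square root; the lemmas below characterise it as the root with
   positive real part whenever there is one, i.e. off the half-line
   (-oo, 0]. *)
Definition Csqrt (a : C) : C :=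
  (sqrt ((Cmod a + Re a) / 2),
   (if Rle_dec 0 (Im a) then 1 else -1) * sqrt ((Cmod a - Re a) / 2)).

Lemma Cmod_sqr_ReIm (a : C) : Cmod a * Cmod a = Re a * Re a + Im a * Im a.
Proof.
unfold Cmod, Re, Im; rewrite sqrt_sqrt; [ring | nra].
Qed.

Lemma Csqrt_sqr (a : C) : (Csqrt a * Csqrt a)%C = a.
Proof.
pose proof (Cmod_sqr_ReIm a) as Hm; pose proof (Cmod_ge_0 a) as H0.
assert (Hp : 0 <= (Cmod a + Re a) / 2) by nra.
assert (Hq : 0 <= (Cmod a - Re a) / 2) by nra.
pose proof (sqrt_sqrt _ Hp) as Sp; pose proof (sqrt_sqrt _ Hq) as Sq.
assert (Hpq : sqrt ((Cmod a + Re a) / 2) * sqrt ((Cmod a - Re a) / 2)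
              = Rabs (Im a) / 2).
{ rewrite <- sqrt_mult by assumption.
  replace ((Cmod a + Re a) / 2 * ((Cmod a - Re a) / 2))
    with (Rsqr (Im a / 2)) by (unfold Rsqr; nra).
  rewrite sqrt_Rsqr_abs; unfold Rdiv.
  rewrite Rabs_mult, (Rabs_pos_eq (/ 2)); lra. }
rewrite (surjective_pairing a) at 3.
change (fst a) with (Re a); change (snd a) with (Im a).
unfold Csqrt, Cmult; simpl.
destruct (Rle_dec 0 (Im a)) as [H | H]; f_equal; try nra.
- rewrite Rabs_pos_eq in Hpq by lra; nra.
- rewrite Rabs_left in Hpq by lra; nra.
Qed.

Lemma Csqrt_unique (a b : C) : 0 < Re b -> (b * b)%C = a -> Csqrt a = b.
Proof.
intros Hb <-; destruct b as [p q]; simpl in Hb.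
unfold Csqrt; rewrite Cmod_mult, Cmod_sqr_ReIm; simpl.
replace ((p * p + q * q + (p * p - q * q)) / 2) with (Rsqr p)
  by (unfold Rsqr; field).
replace ((p * p + q * q - (p * p - q * q)) / 2) with (Rsqr q)
  by (unfold Rsqr; field).
rewrite sqrt_Rsqr, sqrt_Rsqr_abs by lra.
f_equal; destruct (Rle_dec 0 (p * q + q * p)) as [H | H].
- rewrite Rabs_pos_eq; nra.
- rewrite Rabs_left; nra.
Qed.

(* [r] stands for a signed square root of 2u^2 - 2u: with [r] a fixed root,
   [Ipm r] is I_+ and [Ipm (- r)] is I_-. *)
Definition Ipm_integrand (r u x : C) (v : R) : C :=
  ((1 - u * v + v * r) /
   Csqrt (v * (1 - v) *
          ((1 - v) * (1 - u ^ 2 * v) * (1 + u * v) ^ 2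
           + x * v * (1 - u * v) ^ 2)))%C.

(* The integrand is singular at both end points, so the integral is the
   improper one. *)
Definition Ipm_cv (r u x : C) : Prop :=
  ex_RInt_gen (V := C_R_NormedModule)
    (Ipm_integrand r u x) (at_right 0) (at_left 1).

Definition Ipm (r u x : C) : C :=
  (/ PI * RInt_gen (V := C_R_CompleteNormedModule)
            (Ipm_integrand r u x) (at_right 0) (at_left 1))%C.

(* [s] stands for a square root of -z. *)
Definition wval (y z : R) (s : C) : C :=
  (Csqrt ((1 + 4 * z) ^ 2 - 16 * y ^ 2 * z) + 4 * y * s)%C.

Definition Ry (y : R) : R :=
  / 4 * Rmin (Cmod (y + Csqrt (y ^ 2 - 1))) (Cmod (y - Csqrt (y ^ 2 - 1))) ^ 2.

(* Main.v *)
(* Put u = 4z, s^2 = -z, r^2 = 2u^2 - 2u and p = sqrt ((1+u)^2 - 4uy^2), so that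
   w = p + 4ys.  As functions of y, sqrt w I_+ and a second integral over the
   same quartic form a solution of a 2 x 2 first-order system (the reduction of
   the derivatives modulo exact differentials is given by explicit certificates),
   and so do sqrt w I_- and its companion, with -r for r.  The four products solve
   a 4 x 4 system, and the recurrences of the Legendre polynomials show that the
   same system is satisfied by the series together with three companion series.
   At y = 1 the system has a regular singularity with nilpotent residue, so
   differentiable solutions are determined by two of their values there.  At y = 1
   the series is (1 - u)^(-1/2), and the quartic becomes the square of a
   quadratic, which makes the integrals elementary.  Negative y are reduced to
   positive ones by (y, s) -> (-y, -s). *)

Require Import Defs.
From Stdlib Require Import Factorial Reals Lra Lia List.
From Coquelicot Require Import Coquelicot.
Open Scope R_scope.

(** * Legendre polynomials *)

(** The comparison is made along y at fixed z because at y = 1 both sides have explicit values. On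
    the side of the integrals the obstacle is the branch of the root: the radicand is complex and
    offers no evident continuous root. Up to v(1 - v) and (1+u)^2 it factors as (p + 4ys) [Gp], and
    both factors have positive real part because |Re (4ys)| < p. Principal roots of the factors can
    then be differentiated freely, and their product is the root required by the theorem. The
    substitution v = (1 - cos t)/2 removes the singularities at the end points, so that
    differentiation under the integral takes place on a compact interval with jointly continuous
    integrands. The products are normalised by p, s and r in order that the coefficients of their
    system become rational in u and y, like those of the series; this division is why z = 0 is
    treated apart. On the side of the series, writing R_y = 1/(4 rho^2) shows that one z is
    admissible for all |y| <= (rho + 1/rho)/2, and rho can be increased slightly so that both 1 and
    the given |y| are interior points. *)

Definition smooth (f : R -> R) := forall n x, ex_derive_n f n x.

Lemma smooth_ex_derive f n x : smooth f -> ex_derive (Derive_n f n) x.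
Proof. intros H; exact (H (S n) x). Qed.

Lemma Derive_n_id_mult f n x : smooth f ->
  Derive_n (fun t => t * f t) n x
    = x * Derive_n f n x + INR n * Derive_n f (pred n) x.
Proof.
intros Hf; revert x; induction n as [| n IH]; intros x.
- simpl; ring.
- simpl Derive_n; rewrite (Derive_ext _ _ _ IH).
  assert (H1 := smooth_ex_derive f n x Hf).
  assert (H2 := smooth_ex_derive f (pred n) x Hf).
  apply is_derive_unique; auto_derive; [tauto |].
  rewrite S_INR; destruct n as [| n]; [simpl; ring |].
  change (Derive_n f (S (S n)) x) with (Derive (Derive_n f (S n)) x).
  change (pred (S n)) with n.
  change (Derive_n f (S n) x) with (Derive (Derive_n f n) x).
  change (fun x0 => Derive_n f (S n) x0) with (Derive_n f (S n)).
  change (fun x0 => Derive_n f n x0) with (Derive_n f n).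
  ring.
Qed.

Lemma smooth_id_mult f : smooth f -> smooth (fun t => t * f t).
Proof.
intros Hf [| n] x; [exact I | simpl].
apply ex_derive_ext
  with (fun x => x * Derive_n f n x + INR n * Derive_n f (pred n) x).
- intros t; symmetry; now apply Derive_n_id_mult.
- assert (H1 := smooth_ex_derive f n x Hf).
  assert (H2 := smooth_ex_derive f (pred n) x Hf).
  auto_derive; tauto.
Qed.

Lemma smooth_minus f g : smooth f -> smooth g -> smooth (fun t => f t - g t).
Proof.
intros Hf Hg [| n] x; [exact I | simpl].
apply ex_derive_ext with (fun x => Derive_n f n x - Derive_n g n x).
- intros t; symmetry; apply Derive_n_minus;
    apply filter_forall; intros y k _; [apply Hf | apply Hg].
- assert (H1 := smooth_ex_derive f n x Hf).
  assert (H2 := smooth_ex_derive g n x Hg).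
  auto_derive; tauto.
Qed.

Lemma pow_S_rodrigues n t :
  (t ^ 2 - 1) ^ S n = t * (t * (t ^ 2 - 1) ^ n) - (t ^ 2 - 1) ^ n.
Proof. simpl; ring. Qed.

Lemma smooth_ext f g : (forall t, f t = g t) -> smooth f -> smooth g.
Proof. intros E Hf n x; apply ex_derive_n_ext with f; auto. Qed.

Lemma smooth_rodrigues n : smooth (fun t => (t ^ 2 - 1) ^ n).
Proof.
induction n as [| n IH].
- intros [| k] x; [exact I | simpl].
  apply ex_derive_ext with (fun _ => match k with O => 1 | _ => 0 end).
  + intros t; destruct k; [reflexivity |].
    symmetry; exact (Derive_n_const k 1 t).
  + apply ex_derive_const.
- apply smooth_ext with (2 := smooth_minus _ _
    (smooth_id_mult _ (smooth_id_mult _ IH)) IH).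
  intros t; symmetry; apply pow_S_rodrigues.
Qed.

(* The pair (P_n, P_n') satisfies a first-order recurrence. *)
Fixpoint leg_pair (n : nat) (y : R) : R * R :=
  match n with
  | O => (1, 0)
  | S m => let (p, d) := leg_pair m y in
           (y * p + (y ^ 2 - 1) / INR (S m) * d, INR (S m) * p + y * d)
  end.

Definition leg n y := fst (leg_pair n y).
Definition dleg n y := snd (leg_pair n y).

Lemma leg_S n y : leg (S n) y = y * leg n y + (y ^ 2 - 1) / INR (S n) * dleg n y.
Proof. unfold leg, dleg; simpl leg_pair; now destruct (leg_pair n y). Qed.

Lemma dleg_S n y : dleg (S n) y = INR (S n) * leg n y + y * dleg n y.
Proof. unfold leg, dleg; simpl leg_pair; now destruct (leg_pair n y). Qed.

(** The recurrence closes only on pairs, so Rodrigues' formula for P_n and its derivative are proved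
    together. *)
Lemma legendre_leg_pair n y :
  legendre n y = leg n y /\
  / (2 ^ n * INR (fact n)) * Derive_n (fun t => (t ^ 2 - 1) ^ n) (S n) y
    = dleg n y.
Proof.
revert y; induction n as [| n IH]; intros y.
- unfold legendre, leg, dleg; simpl; split; [field |].
  rewrite Derive_const; ring.
- destruct (IH y) as [Hp Hd]; unfold legendre in *.
  rewrite leg_S, dleg_S, <- Hp, <- Hd; clear IH Hp Hd.
  set (f := fun t => (t ^ 2 - 1) ^ n).
  assert (Sf : smooth f) by apply smooth_rodrigues.
  assert (Sg := smooth_id_mult f Sf).
  set (F := fun t => (t ^ 2 - 1) ^ S n).
  assert (EF : forall t, F t = t * (t * f t) - f t)
    by (intros t; apply pow_S_rodrigues).
  (* The (n+1)-st derivative of F = (t^2 - 1)^(n+1) is computed twice, from F' = 2 (n+1) t f and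
     from F = t (t f) - f. Both contain the derivative of f of order n - 1; twice the second minus
     the first eliminates it. *)
  assert (D1 : forall k x, Derive_n F (S k) x
      = 2 * INR (S n) * Derive_n (fun t => t * f t) k x).
  { intros k x; replace (S k) with (k + 1)%nat by lia.
    rewrite <- Derive_n_comp, <- Derive_n_scal_l; apply Derive_n_ext.
    intros t; simpl Derive_n; apply is_derive_unique; unfold F, f.
    auto_derive; [exact I |].
    change (1 * ((1 + 1) * (t * 1)) * (INR (S n) * (t * (t * 1) + - (1)) ^ n)
            = 2 * INR (S n) * (t * (t ^ 2 - 1) ^ n)).
    replace (t * (t * 1) + - (1)) with (t ^ 2 - 1) by ring; ring. }
  assert (D2 : Derive_n F (S n) y
      = Derive_n (fun t => t * (t * f t)) (S n) y - Derive_n f (S n) y).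
  { rewrite (Derive_n_ext _ _ _ _ EF); apply Derive_n_minus;
      apply filter_forall; intros x k _; [apply smooth_id_mult, Sg | apply Sf]. }
  rewrite (Derive_n_id_mult (fun t => t * f t)), !Derive_n_id_mult in D2
    by assumption.
  assert (D3 := D1 n y); rewrite Derive_n_id_mult in D3 by assumption.
  simpl pred in D2.
  assert (D4 := D1 (S n) y); rewrite Derive_n_id_mult in D4 by assumption.
  simpl pred in D4.
  assert (Hn : INR (S n) <> 0) by (apply not_0_INR; lia).
  assert (Hf : INR (fact n) <> 0) by apply INR_fact_neq_0.
  assert (H2 : 2 ^ n <> 0) by (apply pow_nonzero; lra).
  rewrite fact_simpl, mult_INR; simpl (2 ^ S n).
  fold F f; split.
  + apply (Rmult_eq_reg_l (2 * 2 ^ n * (INR (S n) * INR (fact n))));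
      [| repeat apply Rmult_integral_contrapositive_currified; trivial; lra].
    transitivity (Derive_n F (S n) y); [field; tauto |].
    transitivity (2 * (INR (S n) * (y * Derive_n f n y)
                    + (y ^ 2 - 1) * Derive_n f (S n) y)); [| field; tauto].
    rewrite S_INR in *; nra.
  + rewrite D4, S_INR in *; field; tauto.
Qed.

Lemma legendre_leg n y : legendre n y = leg n y.
Proof. apply legendre_leg_pair. Qed.

(** P_n'' and P_n''' come from differentiating the recurrence of [dleg]: this involves no division
    by y^2 - 1, and growth bounds follow directly by induction. *)
Fixpoint d2leg (n : nat) (y : R) : R :=
  match n with
  | O => 0
  | S m => INR (S (S m)) * dleg m y + y * d2leg m y
  end.

Fixpoint d3leg (n : nat) (y : R) : R :=
  match n with
  | O => 0
  | S m => INR (S (S (S m))) * d2leg m y + y * d3leg m y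
  end.

Lemma d2leg_S n (y : R) : d2leg (S n) y = INR (S (S n)) * dleg n y + y * d2leg n y.
Proof. reflexivity. Qed.

Lemma d3leg_S n (y : R) :
  d3leg (S n) y = INR (S (S (S n))) * d2leg n y + y * d3leg n y.
Proof. reflexivity. Qed.

Lemma INR_S_pos n : 0 < INR (S n).
Proof. apply lt_0_INR; lia. Qed.

Lemma legendre_ode n (y : R) :
  (1 - y ^ 2) * d2leg n y
    = 2 * y * dleg n y - INR n * (INR n + 1) * leg n y.
Proof.
induction n as [| n IH]; [unfold dleg; simpl; ring |].
rewrite d2leg_S, leg_S, dleg_S.
assert (Hn := INR_S_pos n).
transitivity ((1 - y ^ 2) * INR (S (S n)) * dleg n y
              + y * ((1 - y ^ 2) * d2leg n y)); [ring |].
rewrite IH; rewrite !S_INR in *; field; lra.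
Qed.

Lemma is_derive_recurrence (a y df dg : R) (f g : R -> R) :
  is_derive f y df -> is_derive g y dg ->
  is_derive (fun t => a * f t + t * g t) y (a * df + g y + y * dg).
Proof.
intros Hf Hg; auto_derive; [repeat split; eexists; eassumption |].
change (fun x => f x) with f; change (fun x => g x) with g.
rewrite (is_derive_unique _ _ _ Hf), (is_derive_unique _ _ _ Hg); ring.
Qed.

(** Differentiating the recurrence of [leg] brings in (y^2 - 1) P_n''; Legendre's equation converts
    the result into the recurrence of [dleg]. *)
Lemma is_derive_leg_dleg n (y : R) :
  is_derive (leg n) y (dleg n y) /\ is_derive (dleg n) y (d2leg n y).
Proof.
revert y; induction n as [| n IH]; intros y.
- split; [apply is_derive_ext with (fun _ => 1) | apply is_derive_ext with (fun _ => 0)];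
    try reflexivity; apply is_derive_Reals, derivable_pt_lim_const.
- destruct (IH y) as [H1 H2]; assert (Hn := INR_S_pos n); split.
  + apply is_derive_ext with (1 := fun t => eq_sym (leg_S n t)).
    rewrite dleg_S, S_INR in *; set (N := INR n) in *.
    auto_derive; [repeat split; eexists; eassumption |].
    change (fun x => leg n x) with (leg n).
    change (fun x => dleg n x) with (dleg n).
    rewrite (is_derive_unique _ _ _ H1), (is_derive_unique _ _ _ H2).
    assert (E := legendre_ode n y).
    apply Rminus_diag_uniq.
    transitivity (- ((1 - y ^ 2) * d2leg n y
      - (2 * y * dleg n y - N * (N + 1) * leg n y)) / (N + 1));
      [field; lra | unfold N at 1; rewrite E; fold N; field; lra].
  + apply is_derive_ext with (1 := fun t => eq_sym (dleg_S n t)).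
    replace (d2leg (S n) y) with (INR (S n) * dleg n y + dleg n y + y * d2leg n y)
      by (rewrite d2leg_S, (S_INR (S n)); ring).
    now apply is_derive_recurrence.
Qed.

Lemma is_derive_leg n (y : R) : is_derive (leg n) y (dleg n y).
Proof. apply is_derive_leg_dleg. Qed.

Lemma is_derive_dleg n (y : R) : is_derive (dleg n) y (d2leg n y).
Proof. apply is_derive_leg_dleg. Qed.

Lemma is_derive_d2leg n (y : R) : is_derive (d2leg n) y (d3leg n y).
Proof.
induction n as [| n IH].
- apply is_derive_ext with (fun _ => 0); [reflexivity |].
  apply is_derive_Reals, derivable_pt_lim_const.
- replace (d3leg (S n) y)
    with (INR (S (S n)) * d2leg n y + d2leg n y + y * d3leg n y)
    by (rewrite d3leg_S, (S_INR (S (S n))); ring).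
  apply is_derive_recurrence with (f := dleg n) (g := d2leg n);
    [apply is_derive_dleg | exact IH].
Qed.

Lemma leg_opp n (y : R) :
  leg n (- y) = (-1) ^ n * leg n y /\ dleg n (- y) = - (-1) ^ n * dleg n y.
Proof.
induction n as [| n [H1 H2]]; [unfold leg, dleg; simpl; split; ring |].
rewrite !leg_S, !dleg_S, H1, H2; simpl ((-1) ^ S n).
assert (Hn := INR_S_pos n); split; field; lra.
Qed.

Lemma leg_1 n : leg n 1 = 1.
Proof.
induction n as [| n IH]; [reflexivity |].
rewrite leg_S, IH; assert (Hn := INR_S_pos n); field; lra.
Qed.

(* For |y| <= 1, (P_n, sqrt (1 - y^2) P_n' / n) is obtained from the previous
   pair by a rotation, up to shrinking the second coordinate. *)
Lemma leg_energy n (y : R) : Rabs y <= 1 ->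
  leg n y ^ 2 + (1 - y ^ 2) * (dleg n y / INR (S n)) ^ 2 <= 1.
Proof.
intros Hy.
assert (Hq : 0 <= 1 - y ^ 2) by (destruct (Rabs_le_between y 1); nra).
induction n as [| n IH].
- unfold leg, dleg; simpl; lra.
- apply Rle_trans with (2 := IH); rewrite leg_S, dleg_S.
  assert (Hn := INR_S_pos n).
  set (p := leg n y) in *; set (d := dleg n y) in *.
  apply Rle_trans with ((y * p + (y ^ 2 - 1) / INR (S n) * d) ^ 2
    + (1 - y ^ 2) * ((INR (S n) * p + y * d) / INR (S n)) ^ 2);
    [| right; field; lra].
  apply Rplus_le_compat_l, Rmult_le_compat_l; [exact Hq |].
  set (e := INR (S n) * p + y * d).
  unfold Rdiv; rewrite !Rpow_mult_distr.
  apply Rmult_le_compat_l; [nra |].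
  apply pow_incr; split; [left; apply Rinv_0_lt_compat, INR_S_pos |].
  apply Rinv_le_contravar; [lra |]; rewrite (S_INR (S n)); lra.
Qed.

(** Beyond 1 the rotation becomes hyperbolic: up to shrinking the second coordinate, the sum of the
    pair (P_n, e P_n' / n) is multiplied by y + e at each step. *)
Lemma leg_ge_1_bound n (y e : R) : 1 <= y -> 0 <= e -> e * e = y ^ 2 - 1 ->
  0 <= leg n y /\ 0 <= dleg n y
  /\ leg n y + e * (dleg n y / INR (S n)) <= (y + e) ^ n.
Proof.
intros Hy He E; induction n as [| n (H1 & H2 & H3)].
- unfold leg, dleg; simpl; lra.
- rewrite leg_S, dleg_S; assert (Hn := INR_S_pos n).
  set (p := leg n y) in *; set (d := dleg n y) in *.
  assert (Hd : 0 <= INR (S n) * p + y * d) by nra.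
  assert (Hi : 0 < / INR (S n)) by now apply Rinv_0_lt_compat.
  repeat split; [| exact Hd |].
  + apply Rplus_le_le_0_compat; [nra |].
    apply Rmult_le_pos; [| exact H2].
    apply Rmult_le_pos; [nra | lra].
  + simpl pow; apply Rle_trans with ((y + e) * (p + e * (d / INR (S n))));
      [| apply Rmult_le_compat_l; lra].
    apply Rle_trans with (y * p + (y ^ 2 - 1) / INR (S n) * d
       + e * ((INR (S n) * p + y * d) / INR (S n)));
      [| rewrite <- E; right; field; lra].
    apply Rplus_le_compat_l, Rmult_le_compat_l; [exact He |].
    apply Rmult_le_compat_l; [exact Hd |].
    apply Rinv_le_contravar; [lra |]; rewrite (S_INR (S n)); lra.
Qed.

Lemma leg_abs_even n (y : R) : Rabs (leg n (Rabs y)) = Rabs (leg n y).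
Proof.
unfold Rabs at 2; destruct (Rcase_abs y); [| reflexivity].
rewrite (proj1 (leg_opp n y)), Rabs_mult, pow_1_abs; ring.
Qed.

Lemma joukowski_le_self rho : 1 <= rho -> (rho + / rho) / 2 <= rho.
Proof.
intros H; assert (/ rho <= 1) by (rewrite <- Rinv_1; apply Rinv_le_contravar; lra).
lra.
Qed.

(** The condition on y says that y lies inside the ellipse with semi-axis (rho + 1/rho)/2, which for
    |y| >= 1 means |y| + sqrt (y^2 - 1) <= rho. *)
Lemma leg_bound rho n (y : R) : 1 <= rho -> Rabs y <= (rho + / rho) / 2 ->
  Rabs (leg n y) <= rho ^ n.
Proof.
intros Hr Hy; destruct (Rle_lt_dec (Rabs y) 1) as [H1 | H1].
- apply Rle_trans with 1; [| apply pow_R1_Rle; exact Hr].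
  assert (H := leg_energy n y H1).
  assert (Hq : 0 <= 1 - y ^ 2) by (destruct (Rabs_le_between y 1); nra).
  apply Rabs_le; split; assert (0 <= (dleg n y / INR (S n)) ^ 2) by nra; nra.
- rewrite <- leg_abs_even; set (a := Rabs y) in *.
  assert (Ha : 0 <= a ^ 2 - 1) by nra.
  destruct (leg_ge_1_bound n a (sqrt (a ^ 2 - 1))) as (P1 & P2 & P3);
    [lra | apply sqrt_pos | apply sqrt_sqrt, Ha |].
  rewrite Rabs_pos_eq by exact P1.
  apply Rle_trans with (leg n a + sqrt (a ^ 2 - 1) * (dleg n a / INR (S n))).
  { assert (0 <= sqrt (a ^ 2 - 1) * (dleg n a / INR (S n))); [| lra].
    apply Rmult_le_pos; [apply sqrt_pos |].
    apply Rmult_le_pos; [exact P2 | left; apply Rinv_0_lt_compat, INR_S_pos]. }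
  apply Rle_trans with (1 := P3), pow_incr; split.
  { assert (0 <= sqrt (a ^ 2 - 1)) by apply sqrt_pos; lra. }
  assert (Hi : / rho <= 1) by (rewrite <- Rinv_1; apply Rinv_le_contravar; lra).
  assert (Hs : sqrt (a ^ 2 - 1) <= (rho - / rho) / 2).
  { rewrite <- (sqrt_Rsqr ((rho - / rho) / 2)) by lra.
    apply sqrt_le_1_alt; unfold Rsqr.
    assert (rho * / rho = 1) by (field; lra); nra. }
  lra.
Qed.

Lemma dleg_bounds rho n (y : R) : 1 <= rho -> Rabs y <= (rho + / rho) / 2 ->
  Rabs (dleg n y) <= INR n ^ 2 * rho ^ n
  /\ Rabs (d2leg n y) <= INR n ^ 4 * rho ^ n
  /\ Rabs (d3leg n y) <= INR n ^ 6 * rho ^ n.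
Proof.
intros Hr Hy; assert (Hy' : Rabs y <= rho)
  by (apply Rle_trans with (1 := Hy), joukowski_le_self, Hr).
induction n as [| n (H1 & H2 & H3)].
- unfold dleg; simpl; rewrite !Rabs_R0; lra.
- assert (Hp := leg_bound rho n y Hr Hy).
  assert (Hn := pos_INR n); assert (Hrn := pow_R1_Rle rho n Hr).
  rewrite dleg_S, d2leg_S, d3leg_S; simpl (rho ^ S n).
  rewrite !S_INR; set (N := INR n) in *; set (P := rho ^ n) in *.
  (* One step of any of the three recurrences. The factor rho comes from |y| <= rho in the second
     term and from 1 <= rho in the first. *)
  assert (G : forall a b x X m k, 0 <= a -> Rabs b <= m * P -> Rabs x <= k * P ->
     0 <= m -> 0 <= k -> a * m + k <= X -> Rabs (a * b + y * x) <= X * (rho * P)).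
  { intros a b x X m k Ha Hb Hx Hm Hk HX.
    apply Rle_trans with (1 := Rabs_triang _ _); rewrite !Rabs_mult.
    rewrite (Rabs_pos_eq a) by exact Ha.
    assert (Rabs y * Rabs x <= rho * (k * P))
      by (apply Rmult_le_compat; auto using Rabs_pos).
    assert (a * Rabs b <= a * (m * P)) by (apply Rmult_le_compat_l; auto).
    assert (a * (m * P) <= rho * (a * (m * P)))
      by (assert (0 <= a * (m * P)) by (repeat apply Rmult_le_pos; lra); nra).
    assert ((a * m + k) * (rho * P) <= X * (rho * P))
      by (apply Rmult_le_compat_r; nra).
    nra. }
  assert (0 <= N ^ 2) by nra; assert (0 <= N ^ 3) by (apply pow_le; lra).
  assert (0 <= N ^ 4) by (apply pow_le; lra).
  assert (0 <= N ^ 5) by (apply pow_le; lra).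
  repeat split.
  + apply G with 1 (N ^ 2); lra || nra.
  + apply G with (N ^ 2) (N ^ 4); lra || nra.
  + apply G with (N ^ 4) (N ^ 6); try lra; try nra.
Qed.

(** * The series and the system it satisfies *)

Lemma ex_series_pow_geom k x : 0 <= x < 1 ->
  ex_series (fun n => (INR n + 1) ^ k * x ^ n).
Proof.
intros [[H0 | H0] H1].
- apply ex_series_ext with (fun n => Rabs ((INR n + 1) ^ k * x ^ n)).
  { intros n; apply Rabs_pos_eq; assert (Hn := pos_INR n).
    apply Rmult_le_pos; apply pow_le; lra. }
  apply ex_series_DAlembert with x; [exact H1 | |].
  { intros n; assert (Hn := pos_INR n).
    apply Rmult_integral_contrapositive_currified; apply pow_nonzero; lra. }
  apply is_lim_seq_ext with (fun n => (1 + / (INR n + 1)) ^ k * x).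
  { intros n; assert (Hn := pos_INR n).
    assert (E : ((INR (S n) + 1) ^ k * x ^ S n) / ((INR n + 1) ^ k * x ^ n)
      = ((INR (S n) + 1) / (INR n + 1)) ^ k * x).
    { unfold Rdiv; rewrite Rpow_mult_distr, pow_inv; simpl (x ^ S n).
      field; split; apply pow_nonzero; lra. }
    rewrite E, Rabs_pos_eq, S_INR; [f_equal; f_equal; field; lra |].
    apply Rmult_le_pos; [apply pow_le | lra].
    apply Rmult_le_pos; [| left; apply Rinv_0_lt_compat; lra].
    rewrite S_INR; lra. }
  replace x with (1 ^ k * x) at 1 by (rewrite pow1; ring).
  apply is_lim_seq_scal_r with (lu := Finite (1 ^ k)).
  assert (L : is_lim_seq (fun n => 1 + / (INR n + 1)) 1).
  { replace 1 with (1 + 0) at 1 by ring.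
    apply is_lim_seq_plus'; [apply is_lim_seq_const |].
    apply is_lim_seq_ext with (fun n => / INR (S n)).
    { intros n; now rewrite S_INR. }
    apply (is_lim_seq_incr_1 (fun n => / INR n)), (is_lim_seq_inv _ _ is_lim_seq_INR).
    discriminate. }
  induction k as [| k IH]; simpl; [apply is_lim_seq_const |].
  apply is_lim_seq_mult'; assumption.
(* The ratio test requires nonzero terms, so x = 0 is summed by hand. *)
- subst x; apply ex_series_incr_1.
  apply ex_series_ext with (fun _ => 0).
  { intros n; simpl; ring. }
  exists 0; apply is_series_Reals; intros eps He; exists 0%nat; intros n _.
  unfold R_dist; rewrite Rminus_0_r, sum_eq_R0 by reflexivity.
  rewrite Rabs_R0; exact He.
Qed.

(** * Termwise differentiation of series of functions *)

Lemma ex_series_dominated (f K : nat -> R) :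
  (forall n, Rabs (f n) <= K n) -> ex_series K -> ex_series f.
Proof. intros H; apply (ex_series_le f K), H. Qed.

Lemma taylor2_bound (f g h : R -> R) a b K y t :
  (forall t, a < t < b ->
     is_derive f t (g t) /\ is_derive g t (h t) /\ Rabs (h t) <= K) ->
  a < y < b -> a < t < b -> Rabs (f t - f y - (t - y) * g y) <= K * (t - y) ^ 2.
Proof.
intros H Hy Ht.
assert (In : forall v, Rmin y t <= v <= Rmax y t -> a < v < b).
{ unfold Rmin, Rmax; intros v; destruct (Rle_dec y t); lra. }
assert (Cg : forall p q v, a < p < b -> a < q < b ->
  Rmin p q <= v <= Rmax p q -> a < v < b).
{ unfold Rmin, Rmax; intros p q v; destruct (Rle_dec p q); lra. }
destruct (MVT_gen f y t g) as (c & Hc & E1).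
- intros v Hv; apply H, In; lra.
- intros v Hv; apply continuity_pt_filterlim, (ex_derive_continuous f).
  exists (g v); apply H, In, Hv.
- destruct (MVT_gen g y c h) as (d & Hd & E2).
  + intros v Hv; apply H, (Cg y c); [assumption | now apply In | lra].
  + intros v Hv; apply continuity_pt_filterlim, (ex_derive_continuous g).
    exists (h v); apply H, (Cg y c); [assumption | now apply In | lra].
  + replace (f t - f y - (t - y) * g y) with (h d * ((c - y) * (t - y))) by nra.
    rewrite Rabs_mult.
    assert (Hdab : a < d < b) by (apply (Cg y c); auto).
    apply Rmult_le_compat; try apply Rabs_pos; [now apply H |].
    apply Rabs_le; unfold Rmin, Rmax in Hc; destruct (Rle_dec y t); split; nra.
Qed.

(** A summable bound on the second derivatives makes the first-order Taylor remainders of the terms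
    add up to O(t^2), so pointwise convergence of the series of f and g suffices. *)
Lemma is_derive_Series (f g h : nat -> R -> R) (K : nat -> R) a b y :
  a < y < b ->
  (forall n t, a < t < b ->
     is_derive (f n) t (g n t) /\ is_derive (g n) t (h n t)
     /\ Rabs (h n t) <= K n) ->
  ex_series K ->
  (forall t, a < t < b -> ex_series (fun n => f n t)) ->
  ex_series (fun n => g n y) ->
  is_derive (fun t => Series (fun n => f n t)) y (Series (fun n => g n y)).
Proof.
intros Hy H HK Hf Hg; apply is_derive_Reals; intros eps He.
set (M := Series K).
assert (HM : 0 <= M).
{ apply Rle_trans with (Series (fun n => Rabs (h n y))).
  - apply Rle_trans with (Rabs (Series (fun n => h n y))); [apply Rabs_pos |].
    apply Series_Rabs, (ex_series_dominated _ K); [| exact HK].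
    intros n; rewrite Rabs_Rabsolu; now apply H.
  - apply Series_le; [| exact HK].
    intros n; split; [apply Rabs_pos | now apply H]. }
(* M + 1 is used as divisor because M may vanish. *)
assert (Hd : 0 < Rmin (Rmin (y - a) (b - y)) (eps / (M + 1))).
{ repeat apply Rmin_pos; try lra; apply Rdiv_lt_0_compat; lra. }
exists (mkposreal _ Hd); intros t Ht0 Ht; simpl in Ht.
assert (H1 := Rlt_le_trans _ _ _ Ht (Rmin_l _ _)).
assert (H2 := Rlt_le_trans _ _ _ Ht (Rmin_r _ _)).
assert (H3 := Rlt_le_trans _ _ _ H1 (Rmin_l _ _)).
assert (H4 := Rlt_le_trans _ _ _ H1 (Rmin_r _ _)).
assert (Hyt : a < y + t < b).
{ destruct (Rabs_lt_between t (y - a)) as [B1 _].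
  destruct (Rabs_lt_between t (b - y)) as [B2 _].
  specialize (B1 H3); specialize (B2 H4); lra. }
assert (E : Rabs (Series (fun n => f n (y + t)) - Series (fun n => f n y)
                  - t * Series (fun n => g n y)) <= M * t ^ 2).
{ rewrite <- Series_minus by auto.
  rewrite <- (Series_scal_l t (fun n => g n y)).
  rewrite <- Series_minus;
    [| apply (ex_series_minus (V := R_NormedModule)); auto
     | apply (ex_series_scal_l (V := R_NormedModule) t); auto].
  assert (B : forall n, Rabs (f n (y + t) - f n y - t * g n y) <= K n * t ^ 2).
  { intros n; assert (T := taylor2_bound (f n) (g n) (h n) a b (K n) y (y + t)
      (H n) Hy Hyt).
    now replace (y + t - y) with t in T by ring. }
  assert (ES : ex_series (fun n => K n * t ^ 2)) by now apply ex_series_scal_r.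
  unfold M; rewrite <- (Series_scal_r (t ^ 2) K).
  apply Rle_trans with (2 := Series_le _ _ (fun n => conj (Rabs_pos _) (B n)) ES).
  apply Series_Rabs, ex_series_dominated with (2 := ES).
  intros n; rewrite Rabs_Rabsolu; apply B. }
apply Rle_lt_trans with (M * Rabs t).
- replace ((Series (fun n => f n (y + t)) - Series (fun n => f n y)) / t
           - Series (fun n => g n y))
    with ((Series (fun n => f n (y + t)) - Series (fun n => f n y)
           - t * Series (fun n => g n y)) / t) by (field; exact Ht0).
  unfold Rdiv; rewrite Rabs_mult, Rabs_inv.
  apply Rmult_le_reg_r with (Rabs t); [now apply Rabs_pos_lt |].
  rewrite Rmult_assoc, Rinv_l, Rmult_1_r by now apply Rabs_no_R0.
  apply Rle_trans with (1 := E); right.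
  rewrite Rmult_assoc, <- Rabs_mult, (Rabs_pos_eq (t * t)) by nra; ring.
- apply Rle_lt_trans with (M * (eps / (M + 1))).
  + apply Rmult_le_compat_l; [exact HM | lra].
  + apply Rmult_lt_reg_r with (M + 1); [lra |].
    unfold Rdiv; field_simplify; [nra | lra].
Qed.

(** * Generating series of products of Legendre polynomials *)

Definition cz (z : R) (n : nat) : R := Binomial.C (2 * n) n * z ^ n.

Lemma cz_S z n : INR (S n) * cz z (S n) = z * (4 * INR n + 2) * cz z n.
Proof.
unfold cz, Binomial.C.
replace (2 * S n - S n)%nat with (S n) by lia.
replace (2 * n - n)%nat with n by lia.
replace (2 * S n)%nat with (S (S (2 * n))) by lia.
rewrite !fact_simpl, !mult_INR; simpl (z ^ S n).
replace (INR (S (S (2 * n)))) with (2 * INR (S n))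
  by (rewrite !S_INR, mult_INR; simpl; ring).
replace (INR (S (2 * n))) with (2 * INR n + 1)
  by (rewrite S_INR, mult_INR; simpl; ring).
assert (Hn := INR_S_pos n); assert (Hf := INR_fact_neq_0 n).
field; split; [exact Hf | lra].
Qed.

Lemma cz_bound z n : Rabs (cz z n) <= (4 * Rabs z) ^ n.
Proof.
induction n as [| n IH].
- unfold cz, Binomial.C; simpl; rewrite Rabs_pos_eq; lra.
- assert (Hn := INR_S_pos n).
  apply Rmult_le_reg_l with (INR (S n)); [exact Hn |].
  rewrite <- (Rabs_pos_eq (INR (S n))) at 1 by lra.
  rewrite <- Rabs_mult, cz_S, !Rabs_mult; simpl pow.
  assert (Hp := pos_INR n); rewrite (Rabs_pos_eq (4 * INR n + 2)) by lra.
  assert (Hz := Rabs_pos z).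
  apply Rle_trans with (Rabs z * (4 * INR n + 2) * (4 * Rabs z) ^ n).
  { apply Rmult_le_compat_l; [nra | exact IH]. }
  rewrite S_INR; assert (0 <= Rabs z * (4 * Rabs z) ^ n)
    by (apply Rmult_le_pos; [lra | apply pow_le; lra]).
  nra.
Qed.

(** The weight n^k corresponds to k applications of z d/dz. *)
Definition al z k y := Series (fun n => cz z n * INR n ^ k * leg n y ^ 2).
Definition be z k y := Series (fun n => cz z n * INR n ^ k * (leg n y * dleg n y)).
Definition ga z k y := Series (fun n => cz z n * INR n ^ k * dleg n y ^ 2).
Definition de z k y := Series (fun n => cz z n * INR n ^ k * (leg n y * d2leg n y)).

(* The range of y is the interval on which P_n^2 grows at most like
   rho^(2n). *)
Definition in_range z rho y :=
  1 <= rho /\ Rabs y <= (rho + / rho) / 2 /\ 4 * Rabs z * rho ^ 2 < 1.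

(** The majorant [K] does not contain y, so a single one serves a whole interval, as termwise
    differentiation demands. *)
Lemma in_range_ex_series z rho y k j M (t : nat -> R) :
  in_range z rho y -> 0 <= M ->
  (forall n, Rabs (t n) <= M * (INR n ^ j * (rho ^ n * rho ^ n))) ->
  let K := fun n => M * ((INR n + 1) ^ (k + j) * (4 * Rabs z * rho ^ 2) ^ n) in
  (forall n, Rabs (cz z n * INR n ^ k * t n) <= K n) /\ ex_series K.
Proof.
intros (Hr & _ & Hx) HM Ht K; split.
- intros n; unfold K; rewrite !Rabs_mult.
  assert (Hn := pos_INR n); rewrite (Rabs_pos_eq (INR n ^ k)) by now apply pow_le.
  assert (Hz := Rabs_pos z).
  apply Rle_trans with ((4 * Rabs z) ^ n * (INR n + 1) ^ k
     * (M * ((INR n + 1) ^ j * (rho ^ n * rho ^ n)))).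
  + assert (B : forall m, INR n ^ m <= (INR n + 1) ^ m)
      by (intros m; apply pow_incr; lra).
    assert (P : forall m, 0 <= INR n ^ m) by (intros m; now apply pow_le).
    assert (R0 : 0 <= rho ^ n) by (apply pow_le; lra).
    repeat apply Rmult_le_compat; auto using Rabs_pos, cz_bound.
    { apply Rmult_le_pos; auto using Rabs_pos. }
    apply Rle_trans with (1 := Ht n), Rmult_le_compat_l; [exact HM |].
    apply Rmult_le_compat_r; [nra | apply B].
  + right; rewrite pow_add, !Rpow_mult_distr, <- pow_mult.
    replace (2 * n)%nat with (n + n)%nat by lia; rewrite pow_add; ring.
- apply (ex_series_scal_l (V := R_NormedModule) M), ex_series_pow_geom.
  assert (Hz := Rabs_pos z); split; [nra | exact Hx].
Qed.

Lemma leg_product_bounds z rho y n : in_range z rho y ->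
  let R2 := rho ^ n * rho ^ n in
  Rabs (leg n y ^ 2) <= 1 * (INR n ^ 0 * R2)
  /\ Rabs (leg n y * dleg n y) <= 1 * (INR n ^ 2 * R2)
  /\ Rabs (dleg n y ^ 2) <= 1 * (INR n ^ 4 * R2)
  /\ Rabs (leg n y * d2leg n y) <= 1 * (INR n ^ 4 * R2)
  /\ Rabs (dleg n y * d2leg n y) <= 1 * (INR n ^ 6 * R2)
  /\ Rabs (leg n y * d3leg n y) <= 1 * (INR n ^ 6 * R2).
Proof.
intros (Hr & Hy & _) R2.
assert (H0 := leg_bound rho n y Hr Hy).
destruct (dleg_bounds rho n y Hr Hy) as (H1 & H2 & H3).
assert (Hn := pos_INR n).
assert (G : forall a b m k, Rabs a <= INR n ^ m * rho ^ n ->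
  Rabs b <= INR n ^ k * rho ^ n -> Rabs (a * b) <= 1 * (INR n ^ (m + k) * R2)).
{ intros a b m k Ha Hb; rewrite Rabs_mult, Rmult_1_l, pow_add; unfold R2.
  apply Rle_trans with ((INR n ^ m * rho ^ n) * (INR n ^ k * rho ^ n));
    [apply Rmult_le_compat; auto using Rabs_pos | right; ring]. }
assert (H0' : Rabs (leg n y) <= INR n ^ 0 * rho ^ n) by (rewrite pow_O; lra).
repeat split.
- replace (leg n y ^ 2) with (leg n y * leg n y) by ring; exact (G _ _ _ _ H0' H0').
- exact (G _ _ _ _ H0' H1).
- replace (dleg n y ^ 2) with (dleg n y * dleg n y) by ring; exact (G _ _ _ _ H1 H1).
- exact (G _ _ _ _ H0' H2).
- exact (G _ _ _ _ H1 H2).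
- exact (G _ _ _ _ H0' H3).
Qed.

Lemma ex_series_al z rho y k : in_range z rho y ->
  ex_series (fun n => cz z n * INR n ^ k * leg n y ^ 2).
Proof.
intros H; destruct (in_range_ex_series z rho y k 0 1 (fun n => leg n y ^ 2) H)
  as [B S]; [lra | intros n; apply (leg_product_bounds z rho y n H) |].
exact (ex_series_dominated _ _ B S).
Qed.

Lemma ex_series_be z rho y k : in_range z rho y ->
  ex_series (fun n => cz z n * INR n ^ k * (leg n y * dleg n y)).
Proof.
intros H; destruct (in_range_ex_series z rho y k 2 1 (fun n => leg n y * dleg n y) H)
  as [B S]; [lra | intros n; apply (leg_product_bounds z rho y n H) |].
exact (ex_series_dominated _ _ B S).
Qed.

Lemma ex_series_ga z rho y k : in_range z rho y ->
  ex_series (fun n => cz z n * INR n ^ k * dleg n y ^ 2).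
Proof.
intros H; destruct (in_range_ex_series z rho y k 4 1 (fun n => dleg n y ^ 2) H)
  as [B S]; [lra | intros n; apply (leg_product_bounds z rho y n H) |].
exact (ex_series_dominated _ _ B S).
Qed.

Lemma ex_series_de z rho y k : in_range z rho y ->
  ex_series (fun n => cz z n * INR n ^ k * (leg n y * d2leg n y)).
Proof.
intros H; destruct (in_range_ex_series z rho y k 4 1 (fun n => leg n y * d2leg n y) H)
  as [B S]; [lra | intros n; apply (leg_product_bounds z rho y n H) |].
exact (ex_series_dominated _ _ B S).
Qed.

Lemma in_range_between z rho y t :
  in_range z rho y -> - ((rho + / rho) / 2) < t < (rho + / rho) / 2 ->
  in_range z rho t.
Proof. intros (H1 & _ & H3) Ht; repeat split; trivial; apply Rabs_le; lra. Qed.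

Lemma is_derive_al z rho y k : in_range z rho y -> Rabs y < (rho + / rho) / 2 ->
  is_derive (al z k) y (2 * be z k y).
Proof.
intros H Hy; set (Y := (rho + / rho) / 2) in *.
assert (Hyab : - Y < y < Y) by (apply Rabs_lt_between; exact Hy).
set (h := fun n t => 2 * (dleg n t ^ 2 + leg n t * d2leg n t)).
unfold be; rewrite <- Series_scal_l.
(* The null sequence gives access to the summability of the majorant. Exponent and factor 4 fit [h]
   = 2 (P'^2 + P P''), whose two products are each bounded by n^4 rho^(2n). *)
destruct (in_range_ex_series z rho y k 4 4 (fun _ => 0) H) as [_ S];
  [lra | intros n; rewrite Rabs_R0; destruct H as [H _];
         repeat apply Rmult_le_pos; try apply pow_le; try apply pos_INR; lra |].
apply (is_derive_Series (fun n t => cz z n * INR n ^ k * leg n t ^ 2)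
  (fun n t => 2 * (cz z n * INR n ^ k * (leg n t * dleg n t)))
  (fun n t => cz z n * INR n ^ k * h n t) _ (- Y) Y y Hyab) with (2 := S).
- intros n t Ht; assert (Hr := in_range_between z rho y t H Ht).
  assert (D0 := is_derive_leg n t); assert (D1 := is_derive_dleg n t).
  cbv beta; split; [| split].
  + auto_derive; [repeat split; eexists; eassumption |].
    change (fun x => leg n x) with (leg n).
    rewrite (is_derive_unique _ _ _ D0); ring.
  + unfold h; auto_derive; [repeat split; eexists; eassumption |].
    change (fun x => leg n x) with (leg n); change (fun x => dleg n x) with (dleg n).
    rewrite (is_derive_unique _ _ _ D0), (is_derive_unique _ _ _ D1); ring.
  + apply (in_range_ex_series z rho t k 4 4 (fun n => h n t) Hr); [lra |].
    intros m; destruct (leg_product_bounds z rho t m Hr) as (_ & _ & B1 & B2 & _).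
    unfold h; rewrite Rabs_mult, (Rabs_pos_eq 2) by lra.
    assert (B3 := Rabs_triang (dleg m t ^ 2) (leg m t * d2leg m t)); lra.
- intros t Ht; apply (ex_series_al z rho), (in_range_between z rho y t H Ht).
- apply (ex_series_scal_l (V := R_NormedModule) 2), (ex_series_be z rho), H.
Qed.

Lemma is_derive_be z rho y k : in_range z rho y -> Rabs y < (rho + / rho) / 2 ->
  is_derive (be z k) y (ga z k y + de z k y).
Proof.
intros H Hy; set (Y := (rho + / rho) / 2) in *.
assert (Hyab : - Y < y < Y) by (apply Rabs_lt_between; exact Hy).
set (h := fun n t => 3 * (dleg n t * d2leg n t) + leg n t * d3leg n t).
unfold ga, de; rewrite <- Series_plus
  by (apply (ex_series_ga z rho) || apply (ex_series_de z rho); exact H).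
(* Here [h] = 3 P' P'' + P P''', four products bounded by n^6 rho^(2n) each. *)
destruct (in_range_ex_series z rho y k 6 4 (fun _ => 0) H) as [_ S];
  [lra | intros n; rewrite Rabs_R0; destruct H as [H _];
         repeat apply Rmult_le_pos; try apply pow_le; try apply pos_INR; lra |].
apply (is_derive_Series (fun n t => cz z n * INR n ^ k * (leg n t * dleg n t))
  (fun n t => cz z n * INR n ^ k * dleg n t ^ 2
              + cz z n * INR n ^ k * (leg n t * d2leg n t))
  (fun n t => cz z n * INR n ^ k * h n t) _ (- Y) Y y Hyab) with (2 := S).
- intros n t Ht; assert (Hr := in_range_between z rho y t H Ht).
  assert (D0 := is_derive_leg n t); assert (D1 := is_derive_dleg n t).
  assert (D2 := is_derive_d2leg n t).
  cbv beta; split; [| split].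
  + auto_derive; [repeat split; eexists; eassumption |].
    change (fun x => leg n x) with (leg n); change (fun x => dleg n x) with (dleg n).
    rewrite (is_derive_unique _ _ _ D0), (is_derive_unique _ _ _ D1); ring.
  + unfold h; auto_derive; [repeat split; eexists; eassumption |].
    change (fun x => leg n x) with (leg n); change (fun x => dleg n x) with (dleg n).
    change (fun x => d2leg n x) with (d2leg n).
    rewrite (is_derive_unique _ _ _ D0), (is_derive_unique _ _ _ D1),
      (is_derive_unique _ _ _ D2); ring.
  + apply (in_range_ex_series z rho t k 6 4 (fun n => h n t) Hr); [lra |].
    intros m; destruct (leg_product_bounds z rho t m Hr)
      as (_ & _ & _ & _ & B1 & B2).
    assert (B3 := Rabs_triang (3 * (dleg m t * d2leg m t)) (leg m t * d3leg m t)).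
    rewrite (Rabs_mult 3), (Rabs_pos_eq 3) in B3 by lra.
    unfold h; lra.
- intros t Ht; apply (ex_series_be z rho), (in_range_between z rho y t H Ht).
- apply (ex_series_plus (V := R_NormedModule));
    [apply (ex_series_ga z rho) | apply (ex_series_de z rho)]; exact H.
Qed.

Lemma is_series_lin (a b : R) (f g : nat -> R) (lf lg : R) :
  is_series f lf -> is_series g lg ->
  is_series (fun n => a * f n + b * g n) (a * lf + b * lg).
Proof.
intros Hf Hg; apply (is_series_plus (V := R_NormedModule));
  now apply (is_series_scal_l (V := R_NormedModule)).
Qed.

Arguments is_series_lin a b {f g lf lg} _ _.

Lemma is_series_telescope (g : nat -> R) :
  is_lim_seq g 0 -> is_series (fun n => g (S n) - g n) (- g 0%nat).
Proof.
intros Hg; cut (is_lim_seq (sum_n (fun n => g (S n) - g n)) (- g 0%nat)); [exact (fun L => L) |].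
apply is_lim_seq_ext with (u := fun n => g (S n) - g 0%nat).
- induction n as [| n IH]; [now rewrite sum_O |].
  rewrite sum_Sn, <- IH; unfold plus; simpl; ring.
- replace (Finite (- g 0%nat)) with (Finite (0 - g 0%nat)) by (f_equal; ring).
  apply is_lim_seq_minus'; [now apply is_lim_seq_incr_1 in Hg | apply is_lim_seq_const].
Qed.

Lemma is_lim_seq_lin (a b : R) (f g : nat -> R) :
  is_lim_seq f 0 -> is_lim_seq g 0 -> is_lim_seq (fun n => a * f n + b * g n) 0.
Proof.
intros Hf Hg; replace (Finite 0) with (Finite (a * 0 + b * 0)) by (f_equal; ring).
apply is_lim_seq_plus'; now apply (is_lim_seq_scal_l _ _ (Finite 0)).
Qed.

Arguments is_lim_seq_lin a b {f g} _ _.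

(** * Linear relations between the generating series *)

Section Relations.

Variables (z rho y : R).
Hypothesis H : in_range z rho y.

Let u := 4 * z.
Let q := 1 - y ^ 2.
Let ta k n := cz z n * INR n ^ k * leg n y ^ 2.
Let tb k n := cz z n * INR n ^ k * (leg n y * dleg n y).
Let tg k n := cz z n * INR n ^ k * dleg n y ^ 2.

Lemma is_series_ta k : is_series (ta k) (al z k y).
Proof. now apply Series_correct, (ex_series_al z rho). Qed.

Lemma is_series_tb k : is_series (tb k) (be z k y).
Proof. now apply Series_correct, (ex_series_be z rho). Qed.

Lemma is_series_tg k : is_series (tg k) (ga z k y).
Proof. now apply Series_correct, (ex_series_ga z rho). Qed.

Lemma is_lim_ta k : is_lim_seq (ta k) 0.
Proof. now apply ex_series_lim_0, (ex_series_al z rho). Qed.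

Lemma is_lim_tb k : is_lim_seq (tb k) 0.
Proof. now apply ex_series_lim_0, (ex_series_be z rho). Qed.

Lemma is_lim_tg k : is_lim_seq (tg k) 0.
Proof. now apply ex_series_lim_0, (ex_series_ga z rho). Qed.

Lemma leg_S_mult n : INR (S n) * leg (S n) y = INR (S n) * y * leg n y - q * dleg n y.
Proof. rewrite leg_S; assert (Hn := INR_S_pos n); unfold q; field; lra. Qed.

Lemma leg_back n :
  INR (S n) * y * leg (S n) y + q * dleg (S n) y = INR (S n) * leg n y.
Proof.
replace (INR (S n) * y * leg (S n) y) with (y * (INR (S n) * leg (S n) y)) by ring.
rewrite leg_S_mult, dleg_S; unfold q; ring.
Qed.

(** Two evaluations of the sum of n c_n z^n P_(n-1) P_n', where c_n is the central binomial
    coefficient: [leg_back] eliminates the index n - 1 in favour of n, and after a shift [cz_S] and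
    [dleg_S] eliminate n + 1. Their difference telescopes, with initial term 0. *)
Lemma relation_a :
  z * (4 * al z 2 y + 6 * al z 1 y + 2 * al z 0 y + y * (4 * be z 1 y + 2 * be z 0 y))
    = y * be z 1 y + q * ga z 0 y.
Proof.
apply Rminus_diag_uniq.
assert (S1 := is_series_telescope (fun n => y * tb 1 n + q * tg 0 n)
  (is_lim_seq_lin y q (is_lim_tb 1) (is_lim_tg 0))).
assert (S2 := is_series_lin 1 1 
  (is_series_lin z z 
    (is_series_lin 4 1 (is_series_ta 2) (is_series_lin 6 2 (is_series_ta 1) (is_series_ta 0)))
    (is_series_lin (4 * y) (2 * y) (is_series_tb 1) (is_series_tb 0)))
  (is_series_lin (- y) (- q) (is_series_tb 1) (is_series_tg 0))).
apply is_series_unique in S1.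
rewrite (Series_ext _ (fun n => 1 * (z * (4 * ta 2 n + 1 * (6 * ta 1 n + 2 * ta 0 n))
   + z * (4 * y * tb 1 n + 2 * y * tb 0 n)) + 1 * (- y * tb 1 n + - q * tg 0 n))) in S1.
- rewrite (is_series_unique _ _ S2) in S1.
  replace (y * tb 1 0%nat + q * tg 0 0%nat) with 0 in S1
    by (unfold tb, tg, dleg; simpl; ring).
  lra.
- intros n; unfold ta, tb, tg.
  transitivity (INR (S n) * cz z (S n) * (leg n y * dleg (S n) y)
    - (y * (cz z n * INR n ^ 1 * (leg n y * dleg n y))
        + q * (cz z n * INR n ^ 0 * dleg n y ^ 2))).
  + f_equal; transitivity (cz z (S n) * dleg (S n) y
      * (INR (S n) * y * leg (S n) y + q * dleg (S n) y)); [ring |].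
    rewrite leg_back; ring.
  + rewrite cz_S, dleg_S, S_INR; ring.
Qed.

(** The same double evaluation for the sum of n^2 c_n z^n P_(n-1) P_n, with [leg_S_mult] after the
    shift. *)
Lemma relation_b :
  z * (y * (4 * al z 2 y + 6 * al z 1 y + 2 * al z 0 y) - q * (4 * be z 1 y + 2 * be z 0 y))
    = y * al z 2 y + q * be z 1 y.
Proof.
apply Rminus_diag_uniq.
assert (S1 := is_series_telescope (fun n => y * ta 2 n + q * tb 1 n)
  (is_lim_seq_lin y q (is_lim_ta 2) (is_lim_tb 1))).
assert (S2 := is_series_lin 1 1 
  (is_series_lin (z * y) (- z * q) 
    (is_series_lin 4 1 (is_series_ta 2) (is_series_lin 6 2 (is_series_ta 1) (is_series_ta 0)))
    (is_series_lin 4 2 (is_series_tb 1) (is_series_tb 0)))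
  (is_series_lin (- y) (- q) (is_series_ta 2) (is_series_tb 1))).
apply is_series_unique in S1.
rewrite (Series_ext _ (fun n => 1 * (z * y * (4 * ta 2 n + 1 * (6 * ta 1 n + 2 * ta 0 n))
   + - z * q * (4 * tb 1 n + 2 * tb 0 n)) + 1 * (- y * ta 2 n + - q * tb 1 n))) in S1.
- rewrite (is_series_unique _ _ S2) in S1.
  replace (y * ta 2 0%nat + q * tb 1 0%nat) with 0 in S1
    by (unfold ta, tb, dleg; simpl; ring).
  lra.
- intros n; unfold ta, tb, tg.
  transitivity (INR (S n) * cz z (S n) * (leg n y * (INR (S n) * leg (S n) y))
    - (y * (cz z n * INR n ^ 2 * leg n y ^ 2) + q * (cz z n * INR n ^ 1 * (leg n y * dleg n y)))).
  + f_equal; transitivity (cz z (S n) * (INR (S n) * leg (S n) y)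
      * (INR (S n) * y * leg (S n) y + q * dleg (S n) y)); [ring |].
    rewrite leg_back; ring.
  + rewrite cz_S, leg_S_mult, S_INR; ring.
Qed.

(* The coefficients of the telescoped quadratic form are the ones for which
   the sums of weight three and the term n P_n'^2 cancel. *)
Lemma relation_c :
  ((1 + u) ^ 2 - 4 * u * y ^ 2) * be z 2 y
    = u / 4 * (y * (10 * al z 2 y + 8 * al z 1 y + 2 * al z 0 y)
               + (2 * y ^ 2 - 1 - u) * (6 * be z 1 y + 2 * be z 0 y))
      - u / 2 * q * y * ga z 0 y.
Proof.
apply Rminus_diag_uniq.
assert (S1 := is_series_telescope
  (fun n => 1 * (u * y * ta 3 n + (1 + u - 2 * u * y ^ 2) * tb 2 n) + (- u * q * y) * tg 1 n)
  (is_lim_seq_lin 1 _ (is_lim_seq_lin _ _ (is_lim_ta 3) (is_lim_tb 2)) (is_lim_tg 1))).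
assert (S2 := is_series_lin 1 1 
  (is_series_lin (u / 4 * y) (u / 4 * (2 * y ^ 2 - 1 - u)) 
    (is_series_lin 10 1 (is_series_ta 2) (is_series_lin 8 2 (is_series_ta 1) (is_series_ta 0)))
    (is_series_lin 6 2 (is_series_tb 1) (is_series_tb 0)))
  (is_series_lin (- (u / 2 * q * y)) (- ((1 + u) ^ 2
      - 4 * u * y ^ 2)) (is_series_tg 0) (is_series_tb 2))).
apply is_series_unique in S1.
rewrite (Series_ext _ (fun n => 1 * (u / 4 * y * (10 * ta 2 n + 1 * (8 * ta 1 n + 2 * ta 0 n))
   + u / 4 * (2 * y ^ 2 - 1 - u) * (6 * tb 1 n + 2 * tb 0 n))
   + 1 * (- (u / 2 * q * y) * tg 0 n + - ((1 + u) ^ 2 - 4 * u * y ^ 2) * tb 2 n))) in S1.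
- rewrite (is_series_unique _ _ S2) in S1.
  match type of S1 with _ = - ?e => replace e with 0 in S1
    by (unfold ta, tb, tg, dleg; simpl; ring) end.
  lra.
- intros n; unfold ta, tb, tg.
  set (w := fun m => u * y * (INR m * leg m y) ^ 2
    + (1 + u - 2 * u * y ^ 2) * (INR m * leg m y) * dleg m y - u * q * y * dleg m y ^ 2).
  transitivity (INR (S n) * cz z (S n) * w (S n) - INR n * cz z n * w n); [unfold w; ring |].
  unfold w; rewrite cz_S, leg_S_mult, dleg_S, S_INR; unfold q, u; field.
Qed.

(** Legendre's equation multiplied by P_n and summed; it removes P_n'' from the derivative of
    [be]. *)
Lemma relation_d :
  q * de z 0 y = 2 * y * be z 0 y - al z 2 y - al z 1 y.
Proof.
assert (S1 := Series_correct _ (ex_series_de z rho y 0 H)).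
assert (S2 := is_series_lin q 0 S1 (is_series_ta 0)).
assert (S3 := is_series_lin 1 (- 1) 
  (is_series_lin (2 * y) (- 1) (is_series_tb 0) (is_series_ta 2)) (is_series_ta 1)).
apply is_series_unique in S2; apply is_series_unique in S3.
unfold de; rewrite (Series_ext _ (fun n => q * (cz z n * INR n ^ 0 * (leg n y * d2leg n y))
    + 0 * ta 0 n)) in S3.
- rewrite S2 in S3; lra.
- intros n; unfold ta, tb.
  assert (E := legendre_ode n y); fold q in E.
  transitivity (cz z n * leg n y * (q * d2leg n y)); [rewrite E; ring | ring].
Qed.

End Relations.

(* First-order system equivalent to the fourth-order differential equation in
   y: H is the generating function and the primed letters stand for
   derivatives. *)
Definition sys (u y H A E K dH dA dE dK : R) : Prop :=
  (1 + u) * (1 - y ^ 2) * dH = (1 + u) * y * H - (1 - u) * y * A - 2 * E /\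
  (1 - y ^ 2) * (((1 + u) ^ 2 - 4 * u * y ^ 2) * dA - 4 * u * y * A)
    = - 2 * E + y * (H - K) / 2 /\
  8 * (1 - y ^ 2) * dE = - 2 * (1 - u) * A + (1 + 2 * u) * H + K /\
  (1 + u) * (1 - y ^ 2) * dK
    = - (1 + u) * y * K + (1 - u) * y * A - 2 * (1 + 2 * u) * E.

(* FE and FK solve the first and third equations of [sys] for E and K, the
   derivatives having been eliminated by the relations above. *)
Definition FA z y := 2 * al z 1 y + al z 0 y.
Definition FE z y :=
  let u := 4 * z in
  u * y * al z 0 y - (1 - u) * y * al z 1 y - (1 + u) * (1 - y ^ 2) * be z 0 y.
Definition FK z y :=
  let u := 4 * z in
  (8 * (1 - u) * ((1 + u) ^ 2 - 4 * u * y ^ 2) * al z 2 y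
   + (4 * (1 + u) * (1 - 3 * u ^ 2) - 16 * u * (1 - 2 * u) * y ^ 2) * al z 1 y
   + (4 * u * (1 - u) * (1 + u - 2 * y ^ 2) + (1 + u) * (1 - 4 * u)) * al z 0 y
   + 16 * u * (1 - y ^ 2) * y * be z 0 y) / (1 + u).

(** [FA] is (2 z d/dz + 1) applied to the series. The first equation holds identically by the choice
    of [FE]; each of the others, written as a difference, is a combination of the relations a to d,
    displayed with its multipliers. *)
Lemma F_system z rho y : in_range z rho y -> Rabs y < (rho + / rho) / 2 ->
  1 + 4 * z <> 0 ->
  exists dH dA dE dK,
    is_derive (al z 0) y dH /\ is_derive (FA z) y dA /\
    is_derive (FE z) y dE /\ is_derive (FK z) y dK /\
    sys (4 * z) y (al z 0 y) (FA z y) (FE z y) (FK z y) dH dA dE dK.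
Proof.
intros H Hy Hu.
assert (D0 := is_derive_al z rho y 0 H Hy); assert (D1 := is_derive_al z rho y 1 H Hy).
assert (D2 := is_derive_al z rho y 2 H Hy); assert (D3 := is_derive_be z rho y 0 H Hy).
assert (Ra := relation_a z rho y H); assert (Rb := relation_b z rho y H).
assert (Rc := relation_c z rho y H); assert (Rd := relation_d z rho y H).
set (u := 4 * z) in *; set (q := 1 - y ^ 2) in *.
eexists; eexists; eexists; eexists.
split; [exact D0 |]; split; [| split; [| split]].
- unfold FA; auto_derive; [repeat split; eexists; eassumption |].
  change (fun x => al z 0 x) with (al z 0); change (fun x => al z 1 x) with (al z 1).
  rewrite (is_derive_unique _ _ _ D0), (is_derive_unique _ _ _ D1); reflexivity.
- unfold FE; auto_derive; [repeat split; eexists; eassumption |].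
  change (fun x => al z 0 x) with (al z 0); change (fun x => al z 1 x) with (al z 1).
  change (fun x => be z 0 x) with (be z 0).
  rewrite (is_derive_unique _ _ _ D0), (is_derive_unique _ _ _ D1),
    (is_derive_unique _ _ _ D3); reflexivity.
- unfold FK; auto_derive; [repeat split; eexists; eassumption |].
  change (fun x => al z 0 x) with (al z 0); change (fun x => al z 1 x) with (al z 1).
  change (fun x => al z 2 x) with (al z 2); change (fun x => be z 0 x) with (be z 0).
  rewrite (is_derive_unique _ _ _ D0), (is_derive_unique _ _ _ D1),
    (is_derive_unique _ _ _ D2), (is_derive_unique _ _ _ D3); reflexivity.
- fold u; unfold FE, FK, FA; fold u; fold q.
  set (a0 := al z 0 y) in *; set (a1 := al z 1 y) in *; set (a2 := al z 2 y) in *.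
  set (b0 := be z 0 y) in *; set (b1 := be z 1 y) in *; set (b2 := be z 2 y) in *.
  set (g0 := ga z 0 y) in *; set (d0 := de z 0 y) in *.
  replace z with (u / 4) in Ra, Rb by (unfold u; field).
  clearbody a0 a1 a2 b0 b1 b2 g0 d0 u; clear D0 D1 D2 D3 H Hy.
  split; [| split; [| split]].
  + unfold q; ring.
  + apply Rmult_eq_reg_l with (1 + u); [| exact Hu].
    apply Rminus_diag_uniq.
    transitivity (4 * ((1 + u) ^ 2 - 4 * u * y ^ 2) *
        - (u / 4 * (y * (4 * a2 + 6 * a1 + 2 * a0) - q * (4 * b1 + 2 * b0)) - (y * a2 + q * b1)));
      [unfold q; field; exact Hu | rewrite Rb; ring].
  + apply Rminus_diag_uniq.
    transitivity (- 8 * (1 + u) * q * (q * d0 - (2 * y * b0 - a2 - a1))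
        + 8 * (1 + u) * q * (u / 4 * (4 * a2 + 6 * a1 + 2 * a0 + y * (4 * b1 + 2 * b0))
        - (y * b1 + q * g0)) + 8 * (1 - u) ^ 2 * y / (1 + u)
        * (u / 4 * (y * (4 * a2 + 6 * a1 + 2 * a0) - q * (4 * b1 + 2 * b0)) - (y * a2 + q * b1)));
      [unfold q; field; exact Hu | rewrite Ra, Rb, Rd; ring].
  + apply Rminus_diag_uniq.
    transitivity (16 * (1 - u) * q * (((1 + u) ^ 2 - 4 * u * y ^ 2) * b2
        - (u / 4 * (y * (10 * a2 + 8 * a1 + 2 * a0) + (2 * y ^ 2 - 1 - u) * (6 * b1 + 2 * b0))
        - u / 2 * q * y * g0)) + 16 * u * q * y * (q * d0 - (2 * y * b0 - a2 - a1))
        - 8 * u * (1 + u) * q * y * (u / 4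
        * (4 * a2 + 6 * a1 + 2 * a0 + y * (4 * b1 + 2 * b0)) - (y * b1 + q * g0))
        - 8 * (u * (1 + u) * y ^ 2 + 1 - 3 * u)
        * (u / 4 * (y * (4 * a2 + 6 * a1 + 2 * a0) - q * (4 * b1 + 2 * b0)) - (y * a2 + q * b1)));
      [unfold q; field; exact Hu | rewrite Ra, Rb, Rc, Rd; ring].
Qed.

(** * Values of the series at y = 1 *)

Lemma al_1 z k : al z k 1 = Series (fun n => cz z n * INR n ^ k).
Proof. apply Series_ext; intros n; rewrite leg_1; ring. Qed.

Lemma in_range_1 z : 4 * Rabs z < 1 -> in_range z 1 1.
Proof. intros H; unfold in_range; rewrite Rinv_1, Rabs_R1; lra. Qed.

(** The second initial value at y = 1, obtained by telescoping n c_n z^n with c_n the central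
    binomial coefficient; it reflects that 2 z d/dz + 1 maps (1 - 4z)^(-1/2) to (1 - 4z)^(-3/2). *)
Lemma FA_1 z : 4 * Rabs z < 1 -> (1 - 4 * z) * FA z 1 = al z 0 1.
Proof.
intros Hz; assert (H := in_range_1 z Hz).
assert (S1 := is_series_telescope _ (is_lim_ta z 1 1 H 1)).
assert (S2 := is_series_lin (4 * z - 1) (2 * z)
  (is_series_ta z 1 1 H 1) (is_series_ta z 1 1 H 0)).
apply is_series_unique in S1; apply is_series_unique in S2.
rewrite (Series_ext _ (fun n => (4 * z - 1) * (cz z n * INR n ^ 1 * leg n 1 ^ 2)
  + 2 * z * (cz z n * INR n ^ 0 * leg n 1 ^ 2))), S2 in S1.
- simpl (INR 0 ^ 1) in S1; unfold FA; simpl in S1; lra.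
- intros n; rewrite !leg_1.
  transitivity (INR (S n) * cz z (S n) - INR n * cz z n); [ring |].
  rewrite cz_S; ring.
Qed.

Lemma CV_radius_central z : 4 * Rabs z < 1 ->
  Rbar_lt (Rabs z) (CV_radius (fun n => Binomial.C (2 * n) n)).
Proof.
intros Hz; assert (H0 := Rabs_pos z).
(* A point strictly between |z| and 1/4, at which the terms still tend to 0. *)
set (w := (Rabs z + / 4) / 2).
apply Rbar_lt_le_trans with (Finite w); [simpl; unfold w; lra |].
apply Rbar_not_lt_le; intros Hlt.
rewrite <- (Rabs_pos_eq w) in Hlt by (unfold w; lra).
apply (CV_disk_outside _ w Hlt), ex_series_lim_0.
apply ex_series_dominated with (fun n => (4 * Rabs w) ^ n).
- intros n; apply (cz_bound w n).
- apply ex_series_geom; rewrite Rabs_pos_eq by (assert (P := Rabs_pos w); lra).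
  rewrite Rabs_pos_eq; unfold w; lra.
Qed.

(* The binomial series (1 - 4 z)^(-1/2), from its differential equation. *)
Lemma al_0_1 z : 4 * Rabs z < 1 -> al z 0 1 * sqrt (1 - 4 * z) = 1.
Proof.
intros Hz; set (a := fun n => Binomial.C (2 * n) n).
assert (E : forall t, al t 0 1 = PSeries a t).
{ intros t; rewrite al_1; apply Series_ext; intros n; unfold cz, a; ring. }
rewrite E.
assert (Hab : forall t, Rmin 0 z <= t <= Rmax 0 z -> 4 * Rabs t < 1).
{ intros t Ht; apply Rle_lt_trans with (2 := Hz).
  apply Rmult_le_compat_l; [lra |]; revert Ht.
  unfold Rmin, Rmax, Rabs; destruct (Rle_dec 0 z), (Rcase_abs t), (Rcase_abs z); lra. }
assert (D : forall t, 4 * Rabs t < 1 ->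
  is_derive (fun t => PSeries a t * sqrt (1 - 4 * t)) t 0).
{ intros t Ht.
  assert (P : 0 < 1 - 4 * t) by (assert (B := Rle_abs t); lra).
  assert (RC := CV_radius_central t Ht); fold a in RC.
  assert (DP := is_derive_PSeries a t RC).
  set (f' := PSeries (PS_derive a) t) in *.
  assert (F : (1 - 4 * t) * f' = 2 * PSeries a t).
  { assert (S1 : is_series (fun n => cz t n * INR n) (t * f')).
    { apply is_series_ext with (fun n => PS_incr_1 (PS_derive a) n * t ^ n).
      - intros [| n]; [unfold PS_incr_1, zero; simpl; ring |].
        change (INR (S n) * a (S n) * (t * t ^ n) = a (S n) * (t * t ^ n) * INR (S n)).
        ring.
      - apply (is_pseries_R (PS_incr_1 (PS_derive a)) t), (is_pseries_incr_1 (PS_derive a) t f').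
        apply PSeries_correct, CV_radius_inside; now rewrite CV_radius_derive. }
    assert (S0 : is_series (fun n => cz t n) (PSeries a t)).
    { apply (is_pseries_R a t), PSeries_correct, CV_radius_inside, RC. }
    assert (S2 := is_series_lin 4 2 S1 S0).
    assert (S3 : is_series (fun n => 4 * (cz t n * INR n) + 2 * cz t n) f').
    { apply is_series_ext with (fun n => PS_derive a n * t ^ n).
      - intros n; change (@eq R (INR (S n) * a (S n) * t ^ n)
          (4 * (cz t n * INR n) + 2 * cz t n)).
        assert (C := cz_S 1 n); unfold cz in C; rewrite !pow1 in C.
        transitivity (INR (S n) * (Binomial.C (2 * S n) (S n) * 1) * t ^ n);
          [unfold a; ring | rewrite C; unfold cz; ring].
      - apply (is_pseries_R (PS_derive a) t), PSeries_correct, CV_radius_inside;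
          now rewrite CV_radius_derive. }
    apply is_series_unique in S2; apply is_series_unique in S3; lra. }
  auto_derive.
  - repeat split; [eexists; exact DP | lra].
  - change (fun x => PSeries a x) with (PSeries a).
    rewrite (is_derive_unique _ _ _ DP).
    replace (1 + - (4 * t)) with (1 - 4 * t) by ring.
    assert (Q := sqrt_lt_R0 _ P); assert (Q2 := sqrt_sqrt _ (Rlt_le _ _ P)).
    apply Rmult_eq_reg_r with (sqrt (1 - 4 * t)); [| lra].
    transitivity (f' * (sqrt (1 - 4 * t) * sqrt (1 - 4 * t)) - 2 * PSeries a t);
      [field; lra | rewrite Q2; lra]. }
destruct (MVT_gen (fun t => PSeries a t * sqrt (1 - 4 * t)) 0 z (fun _ => 0))
  as (c & _ & Hc).
- intros t Ht; apply D, Hab; lra.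
- intros t Ht; apply continuity_pt_filterlim,
    (ex_derive_continuous (fun t => PSeries a t * sqrt (1 - 4 * t))).
  exists 0; apply D, Hab, Ht.
- rewrite PSeries_0 in Hc; unfold a at 2, Binomial.C in Hc; simpl in Hc.
  replace (1 - 4 * 0) with 1 in Hc by ring; rewrite sqrt_1 in Hc; lra.
Qed.

Lemma ex_pseries_Ftilde z rho y : in_range z rho y -> ex_pseries (Ftilde_coef y) z.
Proof.
intros H; exists (al z 0 y); apply (is_pseries_R (Ftilde_coef y) z).
apply is_series_ext with (2 := is_series_ta z rho y H 0).
intros n; unfold cz, Ftilde_coef; rewrite legendre_leg.
simpl (INR n ^ 0); rewrite Rmult_1_r.
change (@eq R (Binomial.C (2 * n) n * z ^ n * leg n y ^ 2)
              (Binomial.C (2 * n) n * leg n y ^ 2 * z ^ n)); ring.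
Qed.

Lemma Ftilde_al z y : Ftilde y z = al z 0 y.
Proof.
apply Series_ext; intros n; unfold cz, Ftilde_coef; rewrite legendre_leg; ring.
Qed.

(** * Uniqueness *)

(** Integration of K exp (lam s) estimated in two ways: the first gains 1/lam, which yields a
    contraction for large lam; the second gains t, which cancels a pole 1/t at the next stage. *)
Lemma growth_bound (f f' : R -> R) T K lam t : 0 < lam -> 0 <= K ->
  (forall s, 0 <= s <= T -> is_derive f s (f' s)) -> f 0 = 0 ->
  (forall s, 0 < s <= T -> Rabs (f' s) <= K * exp (lam * s)) ->
  0 <= t <= T ->
  Rabs (f t) <= K / lam * exp (lam * t) /\ Rabs (f t) <= K * t * exp (lam * t).
Proof.
intros Hl HK Hf H0 Hb [[Ht | Ht] HT].
- assert (Aux : forall s, 0 < s < t -> Rabs (f' s) <= K * exp (lam * t)).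
  { intros s Hs; apply Rle_trans with (1 := Hb s ltac:(lra)).
    apply Rmult_le_compat_l; [exact HK | left; apply exp_increasing; nra]. }
  split.
  + assert (D : forall e, e = 1 \/ e = - 1 ->
      forall s, 0 <= s <= t -> derivable_pt_lim (fun s => K / lam * exp (lam * s) + e * f s) s
        (K * exp (lam * s) + e * f' s)).
    { intros e _ s Hs; apply is_derive_Reals.
      assert (Ds := Hf s ltac:(lra)).
      auto_derive; [repeat split; eexists; exact Ds |].
      change (fun x => f x) with f; rewrite (is_derive_unique _ _ _ Ds); field; lra. }
    assert (G : forall e, e = 1 \/ e = - 1 -> - (e * f t) <= K / lam * exp (lam * t)).
    { intros e He.
      destruct (MVT_cor2 _ _ 0 t Ht (D e He)) as (c & E & Hc).
      rewrite H0, Rmult_0_r, exp_0 in E.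
      assert (B := Hb c ltac:(lra)); apply Rabs_le_between in B.
      assert (0 <= K / lam) by (apply Rdiv_le_0_compat; lra).
      assert (0 <= (K * exp (lam * c) + e * f' c) * (t - 0))
        by (apply Rmult_le_pos; [destruct He; subst e |]; lra).
      lra. }
    apply Rabs_le; assert (G1 := G 1 (or_introl eq_refl));
      assert (G2 := G (- 1) (or_intror eq_refl)); lra.
  + destruct (MVT_cor2 f f' 0 t Ht) as (c & E & Hc).
    { intros s Hs; apply is_derive_Reals, Hf; lra. }
    replace (f t) with (f' c * t) by lra.
    rewrite Rabs_mult, (Rabs_pos_eq t) by lra.
    assert (B := Aux c Hc); nra.
- subst t; rewrite H0, Rabs_R0, Rmult_0_r, exp_0; split.
  + apply Rmult_le_pos; [apply Rdiv_le_0_compat |]; lra.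
  + lra.
Qed.

(* Uniqueness for a linear system with a first-order pole at [0] whose residue
   is nilpotent: [tau] feeds [x], and both feed [h] and [a], through [1/t]. *)
Lemma singular_gronwall (T C : R) (H A X Y H' A' X' Y' : R -> R) :
  0 <= T -> 0 <= C ->
  (forall t, 0 <= t <= T -> is_derive H t (H' t) /\ is_derive A t (A' t)
     /\ is_derive X t (X' t) /\ is_derive Y t (Y' t)) ->
  H 0 = 0 -> A 0 = 0 -> X 0 = 0 -> Y 0 = 0 ->
  let n t := Rabs (H t) + Rabs (A t) + Rabs (X t) + Rabs (Y t) in
  (forall t, 0 < t <= T ->
     Rabs (Y' t) <= C * n t /\
     Rabs (X' t) <= C * (Rabs (Y t) / t + n t) /\
     Rabs (H' t) <= C * (Rabs (X t) / t + n t) /\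
     Rabs (A' t) <= C * ((Rabs (X t) + Rabs (Y t)) / t + n t)) ->
  forall t, 0 <= t <= T -> H t = 0.
Proof.
intros HT HC D H0 A0 X0 Y0 n B.
(* Each constant comes from inserting the previous bounds into the next estimate: Y first, then X
   through Y/t, then H and A through X/t and Y/t. Nilpotency of the residue is what makes this order
   possible. *)
set (KX := C * (C + 1)).
set (KH := C * (KX + 1)).
set (KA := C * (KX + C + 1)).
set (M := C + KX + KH + KA).
assert (PX : 0 <= KX) by (unfold KX; nra).
assert (PH : 0 <= KH) by (unfold KH; nra).
assert (PA : 0 <= KA) by (unfold KA; nra).
set (lam := 2 * M + 1).
assert (Hlam : 0 < lam) by (unfold lam, M; lra).
(* In the norm weighted by exp (lam t) the integral equation contracts by M/lam, and [lam] = 2 M + 1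
   makes this at most 1/2. Iteration from any bound forces n = 0. *)
assert (Step : forall mu, 0 <= mu ->
  (forall t, 0 <= t <= T -> n t <= mu * exp (lam * t)) ->
  (forall t, 0 <= t <= T -> n t <= mu / 2 * exp (lam * t))).
{ intros mu Hmu Hn t Ht.
  assert (P : forall s, 0 < exp (lam * s)) by (intros s; apply exp_pos).
  assert (BY : forall s, 0 <= s <= T ->
    Rabs (Y s) <= C * mu / lam * exp (lam * s) /\ Rabs (Y s) <= C * mu * s * exp (lam * s)).
  { intros s Hs; apply (growth_bound Y Y' T); trivial; try nra.
    - intros r Hr; apply D, Hr.
    - intros r Hr; destruct (B r Hr) as (B1 & _).
      apply Rle_trans with (1 := B1); rewrite Rmult_assoc.
      apply Rmult_le_compat_l, Hn; lra. }
  assert (Q : forall K f r, 0 < r -> Rabs f <= K * mu * r * exp (lam * r) ->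
    Rabs f / r <= K * mu * exp (lam * r)).
  { intros K f r Hr Hf; apply Rmult_le_reg_r with r; [exact Hr |].
    unfold Rdiv; rewrite Rmult_assoc, Rinv_l, Rmult_1_r by lra; lra. }
  assert (BX : forall s, 0 <= s <= T ->
    Rabs (X s) <= KX * mu / lam * exp (lam * s) /\ Rabs (X s) <= KX * mu * s * exp (lam * s)).
  { intros s Hs; apply (growth_bound X X' T); trivial; try nra.
    - intros r Hr; apply D, Hr.
    - intros r Hr; destruct (B r Hr) as (_ & B1 & _).
      apply Rle_trans with (1 := B1); unfold KX.
      assert (QY := Q C (Y r) r (proj1 Hr) (proj2 (BY r ltac:(lra)))).
      assert (Hr' := Hn r ltac:(lra)).
      replace (C * (C + 1) * mu * exp (lam * r))
        with (C * (C * mu * exp (lam * r) + mu * exp (lam * r))) by ring.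
      apply Rmult_le_compat_l; lra. }
  assert (BH : Rabs (H t) <= KH * mu / lam * exp (lam * t)).
  { apply (growth_bound H H' T); trivial; try nra.
    - intros r Hr; apply D, Hr.
    - intros r Hr; destruct (B r Hr) as (_ & _ & B1 & _).
      apply Rle_trans with (1 := B1); unfold KH.
      assert (QX := Q KX (X r) r (proj1 Hr) (proj2 (BX r ltac:(lra)))).
      assert (Hr' := Hn r ltac:(lra)).
      replace (C * (KX + 1) * mu * exp (lam * r))
        with (C * (KX * mu * exp (lam * r) + mu * exp (lam * r))) by ring.
      apply Rmult_le_compat_l; lra. }
  assert (BA : Rabs (A t) <= KA * mu / lam * exp (lam * t)).
  { apply (growth_bound A A' T); trivial; try nra.
    - intros r Hr; apply D, Hr.
    - intros r Hr; destruct (B r Hr) as (_ & _ & _ & B1).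
      apply Rle_trans with (1 := B1); unfold KA.
      assert (QX := Q KX (X r) r (proj1 Hr) (proj2 (BX r ltac:(lra)))).
      assert (QY := Q C (Y r) r (proj1 Hr) (proj2 (BY r ltac:(lra)))).
      assert (Hr' := Hn r ltac:(lra)).
      replace (C * (KX + C + 1) * mu * exp (lam * r))
        with (C * (KX * mu * exp (lam * r) + C * mu * exp (lam * r)
            + mu * exp (lam * r))) by ring.
      unfold Rdiv in *; rewrite Rmult_plus_distr_r.
      apply Rmult_le_compat_l; lra. }
  destruct (BX t Ht) as [BX' _]; destruct (BY t Ht) as [BY' _].
  unfold n; apply Rle_trans with (M * mu / lam * exp (lam * t)).
  - unfold M; unfold Rdiv in *; lra.
  - apply Rmult_le_compat_r; [left; apply P |].
    apply Rmult_le_reg_r with lam; [exact Hlam |].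
    unfold Rdiv; rewrite Rmult_assoc, Rinv_l, Rmult_1_r by lra.
    assert (M * mu <= mu * / 2 * lam); [| lra].
    unfold lam; nra. }
(* The iteration starts from the maximum of the continuous function n on [0, T]. *)
assert (Bd : exists mu, 0 <= mu /\ forall t, 0 <= t <= T -> n t <= mu).
{ assert (Cn : forall t, 0 <= t <= T -> continuity_pt n t).
  { intros t Ht; destruct (D t Ht) as (D1 & D2 & D3 & D4).
    apply continuity_pt_filterlim.
    assert (Cabs : forall f f', is_derive f t f' -> continuous (fun s => Rabs (f s)) t).
    { intros f f' Df; apply (continuous_comp f Rabs).
      - apply (ex_derive_continuous f); now exists f'.
      - apply continuity_pt_filterlim, Rcontinuity_abs. }
    apply (continuous_plus (V := R_NormedModule)
      (fun t => Rabs (H t) + Rabs (A t) + Rabs (X t)) (fun t => Rabs (Y t)));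
    [apply (continuous_plus (V := R_NormedModule)
       (fun t => Rabs (H t) + Rabs (A t)) (fun t => Rabs (X t)));
     [apply (continuous_plus (V := R_NormedModule)
        (fun t => Rabs (H t)) (fun t => Rabs (A t))) |] |];
      [apply (Cabs _ _ D1) | apply (Cabs _ _ D2) | apply (Cabs _ _ D3) | apply (Cabs _ _ D4)]. }
  destruct (continuity_ab_maj n 0 T HT Cn) as (m & Hm & Hm').
  exists (n m); split; [| exact Hm].
    unfold n; assert (Pa := Rabs_pos (H m)); assert (Pb := Rabs_pos (A m));
      assert (Pc := Rabs_pos (X m)); assert (Pd := Rabs_pos (Y m)); lra. }
destruct Bd as (mu & Hmu & Hn0).
assert (It : forall k t, 0 <= t <= T -> n t <= mu * (/ 2) ^ k * exp (lam * t)).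
{ induction k as [| k IH]; intros t Ht.
  - simpl; rewrite Rmult_1_r; apply Rle_trans with (1 := Hn0 t Ht).
    assert (1 <= exp (lam * t)) by (rewrite <- exp_0; destruct (Rle_lt_or_eq_dec 0 (lam * t));
      [apply Rmult_le_pos; lra | left; now apply exp_increasing | right; congruence]).
    nra.
  - replace (mu * (/ 2) ^ S k) with (mu * (/ 2) ^ k / 2) by (simpl; field).
    apply Step; [| exact IH | exact Ht].
    apply Rmult_le_pos; [exact Hmu | apply pow_le; lra]. }
intros t Ht.
assert (L : is_lim_seq (fun k => mu * (/ 2) ^ k * exp (lam * t)) 0).
{ replace (Finite 0) with (Finite (mu * 0 * exp (lam * t))) by (f_equal; ring).
  apply (is_lim_seq_scal_r _ _ (Finite (mu * 0))), (is_lim_seq_scal_l _ _ (Finite 0)).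
  apply is_lim_seq_geom; rewrite Rabs_pos_eq; lra. }
assert (N0 : n t <= 0).
{ apply (is_lim_seq_le (fun _ => n t) _ (n t) 0 (fun k => It k t Ht)
    (is_lim_seq_const _) L). }
unfold n in N0; assert (Pa := Rabs_pos (H t)); assert (Pb := Rabs_pos (A t));
  assert (Pc := Rabs_pos (X t)); assert (Pd := Rabs_pos (Y t)).
apply Rabs_eq_0; lra.
Qed.

(** * Triangular form of the system near y = 1 *)

Lemma lin_bound a b c d B h k x y :
  Rabs a <= B -> Rabs b <= B -> Rabs c <= B -> Rabs d <= B ->
  Rabs (a * h + b * k + c * x + d * y) <= B * (Rabs h + Rabs k + Rabs x + Rabs y).
Proof.
intros Ha Hb Hc Hd.
assert (G : forall p v, Rabs p <= B -> Rabs (p * v) <= B * Rabs v).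
{ intros p v Hp; rewrite Rabs_mult; apply Rmult_le_compat_r; [apply Rabs_pos | exact Hp]. }
apply Rle_trans with (Rabs (a * h) + Rabs (b * k) + Rabs (c * x) + Rabs (d * y)).
- assert (T1 := Rabs_triang (a * h + b * k + c * x) (d * y)).
  assert (T2 := Rabs_triang (a * h + b * k) (c * x)).
  assert (T3 := Rabs_triang (a * h) (b * k)); lra.
- assert (G1 := G a h Ha); assert (G2 := G b k Hb); assert (G3 := G c x Hc);
    assert (G4 := G d y Hd); lra.
Qed.

Lemma continuity_bounded (f : R -> R) b : 0 <= b -> continuity f ->
  exists B, 0 <= B /\ forall y, 0 <= y <= b -> Rabs (f y) <= B.
Proof.
intros Hb Hf.
destruct (continuity_ab_maj (fun y => Rabs (f y)) 0 b Hb) as (m & Hm & _).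
- intros c _; apply (continuity_pt_comp f Rabs); [apply Hf | apply Rcontinuity_abs].
- exists (Rabs (f m)); split; [apply Rabs_pos | exact Hm].
Qed.

(** Coordinates in which the residue at y = 1 is strictly triangular: T' is regular, X' has a pole
    only through T, H' only through X, and A' through X and T. X is the right side of the first
    equation of [sys]. *)
Definition comb_X u y H A E : R := (1 + u) * y * H - (1 - u) * y * A - 2 * E.
Definition comb_T u y H A E K : R :=
  2 * ((1 + u) ^ 2 - 4 * u * y ^ 2) * A - (1 + u) * (1 - 2 * u) * H
  - 8 * u * y * E - (1 + u) * K.

(** Regular parts are written as linear forms in H, A, X and T, with zero coefficients where needed,
    in the shape that [lin_bound] expects. *)
Lemma sys_triangular u y H A E K dH dA dE dK :
  1 + u <> 0 -> 1 - y ^ 2 <> 0 -> (1 + u) ^ 2 - 4 * u * y ^ 2 <> 0 ->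
  sys u y H A E K dH dA dE dK ->
  let q := 1 - y ^ 2 in
  let p2 := (1 + u) ^ 2 - 4 * u * y ^ 2 in
  let X := comb_X u y H A E in
  let T := comb_T u y H A E K in
  dH = X / ((1 + u) * q) /\
  dA = ((y * T / 2 + (1 - u) * X) / ((1 + u) * q)
        + (- 2 * u * y * H + 2 * u * y * A + 2 * u / (1 + u) * X + 0 * T)) / p2 /\
  (1 + u) * H + (1 + u) * y * dH - (1 - u) * A - (1 - u) * y * dA - 2 * dE
    = (- (1 - u) * T / (4 * q)
       + ((4 * u * (1 + u) * q + (1 - u) / 2 - u * (1 + 2 * u)
           + (1 + u) * (1 - 2 * u) / 2 + 2 * u * (1 + u) * y ^ 2) * H
          + (- p2 - 2 * u * (1 - u) * y ^ 2) * A + 2 * u * y * X + / 2 * T)) / p2 /\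
  - 16 * u * y * A + 2 * p2 * dA - (1 + u) * (1 - 2 * u) * dH
    - 8 * u * E - 8 * u * y * dE - (1 + u) * dK
    = - 4 * u * (1 + u) * y * H + - 4 * u * (1 + u) * y * A + 4 * u * X + 0 * T.
Proof.
intros Hu Hq Hp (E1 & E2 & E3 & E4) q p2 X T.
assert (D1 : dH = ((1 + u) * y * H - (1 - u) * y * A - 2 * E) / ((1 + u) * (1 - y ^ 2))).
{ apply Rmult_eq_reg_l with ((1 + u) * (1 - y ^ 2));
    [rewrite E1; field; tauto | now apply Rmult_integral_contrapositive_currified]. }
assert (D2 : dA = ((- 2 * E + y * (H - K) / 2) / (1 - y ^ 2) + 4 * u * y * A)
                  / ((1 + u) ^ 2 - 4 * u * y ^ 2)).
{ apply Rmult_eq_reg_l with ((1 - y ^ 2) * ((1 + u) ^ 2 - 4 * u * y ^ 2));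
    [| now apply Rmult_integral_contrapositive_currified].
  transitivity (- 2 * E + y * (H - K) / 2 + (1 - y ^ 2) * (4 * u * y * A));
    [rewrite <- E2; ring | field; tauto]. }
assert (D3 : dE = (- 2 * (1 - u) * A + (1 + 2 * u) * H + K) / (8 * (1 - y ^ 2))).
{ apply Rmult_eq_reg_l with (8 * (1 - y ^ 2)); [rewrite E3; field; tauto | lra]. }
assert (D4 : dK = (- (1 + u) * y * K + (1 - u) * y * A - 2 * (1 + 2 * u) * E)
                  / ((1 + u) * (1 - y ^ 2))).
{ apply Rmult_eq_reg_l with ((1 + u) * (1 - y ^ 2));
    [rewrite E4; field; tauto | now apply Rmult_integral_contrapositive_currified]. }
clear E1 E2 E3 E4.
subst dH dA dE dK; unfold X, T, comb_X, comb_T, q, p2 in *.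
repeat split; field; tauto.
Qed.

Lemma sys_unique u y1 (H A E K : R -> R) : -1 < u < 1 -> 0 <= y1 ->
  (forall y, Rmin 1 y1 <= y <= Rmax 1 y1 ->
     0 < (1 + u) ^ 2 - 4 * u * y ^ 2 /\
     exists dH dA dE dK,
       is_derive H y dH /\ is_derive A y dA /\ is_derive E y dE /\ is_derive K y dK /\
       sys u y (H y) (A y) (E y) (K y) dH dA dE dK) ->
  H 1 = 0 -> A 1 = 0 -> H y1 = 0.
Proof.
intros Hu Hy1 S H1 A1.
assert (S' : forall y, Rmin 1 y1 <= y <= Rmax 1 y1 ->
   0 < (1 + u) ^ 2 - 4 * u * y ^ 2 /\
   is_derive H y (Derive H y) /\ is_derive A y (Derive A y) /\
   is_derive E y (Derive E y) /\ is_derive K y (Derive K y) /\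
   sys u y (H y) (A y) (E y) (K y) (Derive H y) (Derive A y) (Derive E y) (Derive K y)).
{ intros y Hy; destruct (S y Hy) as (Hp & dH & dA & dE & dK & D1 & D2 & D3 & D4 & D5).
  rewrite (is_derive_unique _ _ _ D1), (is_derive_unique _ _ _ D2),
    (is_derive_unique _ _ _ D3), (is_derive_unique _ _ _ D4); tauto. }
clear S.
(* At y = 1 the derivatives in the first and third equations carry the factor 1 - y^2 = 0, so these
   equations become linear constraints determining E and K from H and A. *)
assert (E1 : E 1 = 0 /\ K 1 = 0).
{ destruct (S' 1) as (_ & _ & _ & _ & _ & Q1 & _ & Q3 & _).
  - unfold Rmin, Rmax; destruct (Rle_dec 1 y1); lra.
  - rewrite H1, A1 in Q1, Q3; lra. }
destruct E1 as [E1 K1].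
(* The segment from 1 to [y1], whichever side it lies on, is parametrised as 1 + e t with 0 <= t <=
   T. *)
set (e := if Rle_dec 1 y1 then 1 else - 1).
set (T := Rabs (y1 - 1)).
assert (He : e * e = 1) by (unfold e; destruct (Rle_dec 1 y1); ring).
assert (HeT : 1 + e * T = y1).
{ unfold e, T, Rabs; destruct (Rle_dec 1 y1), (Rcase_abs (y1 - 1)); lra. }
assert (HT : 0 <= T) by apply Rabs_pos.
assert (Seg : forall t, 0 <= t <= T -> Rmin 1 y1 <= 1 + e * t <= Rmax 1 y1 /\ 0 <= 1 + e * t).
{ intros t Ht; rewrite <- HeT; unfold e, Rmin, Rmax; destruct (Rle_dec 1 y1);
    destruct (Rle_dec 1 _); try lra; unfold e in HeT; destruct (Rle_dec 1 y1); lra. }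
set (Y := Rmax 1 y1).
assert (HY : 0 <= Y) by (apply Rle_trans with 1; [lra | apply Rmax_l]).
set (p2 := fun y => (1 + u) ^ 2 - 4 * u * y ^ 2).
(* By compactness p2 stays away from 0, so y = 1 is the only singularity on the segment. *)
assert (Pm : exists m, 0 < m /\ forall t, 0 <= t <= T -> m <= p2 (1 + e * t)).
{ destruct (continuity_ab_min (fun t => p2 (1 + e * t)) 0 T HT) as (t0 & Ht0 & Ht0').
  - intros c _; unfold p2; reg.
  - exists (p2 (1 + e * t0)); split; [apply S', Seg, Ht0' | exact Ht0]. }
destruct Pm as (m & Hm & Pm).
set (X := fun y => comb_X u y (H y) (A y) (E y)).
set (W := fun y => comb_T u y (H y) (A y) (E y) (K y)).
set (dX := fun y => (1 + u) * H y + (1 + u) * y * Derive H y - (1 - u) * A y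
                    - (1 - u) * y * Derive A y - 2 * Derive E y).
set (dW := fun y => - 16 * u * y * A y + 2 * p2 y * Derive A y
   - (1 + u) * (1 - 2 * u) * Derive H y
    - 8 * u * E y - 8 * u * y * Derive E y - (1 + u) * Derive K y).
set (cH := fun y => 4 * u * (1 + u) * (1 - y ^ 2) + (1 - u) / 2 - u * (1 + 2 * u)
           + (1 + u) * (1 - 2 * u) / 2 + 2 * u * (1 + u) * y ^ 2).
set (cA := fun y => - p2 y - 2 * u * (1 - u) * y ^ 2).
destruct (continuity_bounded cH Y HY) as (B1 & PB1 & HB1); [unfold cH; reg |].
destruct (continuity_bounded cA Y HY) as (B2 & PB2 & HB2); [unfold cA, p2; reg |].
set (B3 := Rabs (2 * u / (1 + u))).
assert (PB3 : 0 <= B3) by apply Rabs_pos.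
set (B := B1 + B2 + B3 + 8 * Y + 4).
set (i1 := / (1 + u)); assert (Hi1 : 0 < i1) by (apply Rinv_0_lt_compat; lra).
set (im := / m); assert (Him : 0 < im) by (now apply Rinv_0_lt_compat).
(* [B] bounds the regular coefficients, [i1] and [im] the inverses of 1 + u and p2; [C] collects the
   constants of the four estimates below. *)
set (C := B + im * (B + 1) + i1 + im * ((Y + 2) * i1)).
assert (PB : 0 <= B) by (unfold B; lra).
assert (Pu : Rabs u <= 1) by (apply Rabs_le; lra).
apply (f_equal H) in HeT; rewrite <- HeT.
apply (singular_gronwall T C (fun t => H (1 + e * t)) (fun t => A (1 + e * t))
  (fun t => X (1 + e * t)) (fun t => W (1 + e * t))
  (fun t => e * Derive H (1 + e * t)) (fun t => e * Derive A (1 + e * t))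
  (fun t => e * dX (1 + e * t)) (fun t => e * dW (1 + e * t))); trivial.
- assert (0 <= im * (B + 1)) by nra; assert (0 <= im * ((Y + 2) * i1)) by
    (repeat apply Rmult_le_pos; lra); unfold C; lra.
- intros t Ht; destruct (S' _ (proj1 (Seg t Ht))) as (_ & D1 & D2 & D3 & D4 & _).
  assert (Aff : forall f df, is_derive f (1 + e * t) df ->
    is_derive (fun t => f (1 + e * t)) t (e * df)).
  { intros f df Df; apply (is_derive_comp f (fun t => 1 + e * t)); [exact Df |].
    auto_derive; [exact I | ring]. }
  split; [| split; [| split]].
  + apply Aff, D1.
  + apply Aff, D2.
  + apply Aff; unfold X, dX, comb_X; auto_derive;
      [repeat split; eexists; eassumption |].
    change (fun x => H x) with H; change (fun x => A x) with A;
    change (fun x => E x) with E; change (fun x => K x) with K; ring.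
  + apply Aff; unfold W, dW, comb_T, p2; auto_derive;
      [repeat split; eexists; eassumption |].
    change (fun x => H x) with H; change (fun x => A x) with A;
    change (fun x => E x) with E; change (fun x => K x) with K; ring.
- now rewrite Rmult_0_r, Rplus_0_r.
- now rewrite Rmult_0_r, Rplus_0_r.
- rewrite Rmult_0_r, Rplus_0_r; unfold X, comb_X; rewrite H1, A1, E1; ring.
- rewrite Rmult_0_r, Rplus_0_r; unfold W, comb_T; rewrite H1, A1, E1, K1; ring.
- intros t [Ht0 HtT]; assert (Ht : 0 <= t <= T) by lra.
  destruct (Seg t Ht) as (Hs & Hs0); destruct (S' _ Hs) as (_ & _ & _ & _ & _ & Sy).
  set (y := 1 + e * t) in *.
  assert (HyY : 0 <= y <= Y) by (unfold Y; lra).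
  (* Indeed |1 - y^2| = t (1 + y) with y >= 0, so division by 1 - y^2 costs at most 1/t. *)
  assert (Hq : t <= Rabs (1 - y ^ 2)).
  { replace (1 - y ^ 2) with (- (e * t * (1 + y))) by (unfold y; ring).
    rewrite Rabs_Ropp, !Rabs_mult.
    replace (Rabs e) with 1 by (unfold e; destruct (Rle_dec 1 y1);
      [now rewrite Rabs_R1 | symmetry; exact Rabs_m1]).
    rewrite (Rabs_pos_eq t), (Rabs_pos_eq (1 + y)) by lra; nra. }
  assert (Hp := Pm t Ht); fold y in Hp.
  assert (Hq0 : 1 - y ^ 2 <> 0) by (intros Hq0; rewrite Hq0, Rabs_R0 in Hq; lra).
  destruct (sys_triangular u y _ _ _ _ _ _ _ _ ltac:(lra) Hq0
    ltac:(unfold p2 in Hp; lra) Sy) as (F1 & F2 & F3 & F4).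
  fold (X y) (W y) in F1, F2, F3, F4; fold (p2 y) in F2, F3, F4.
  fold (dX y) in F3; fold (dW y) in F4; fold (cH y) in F3; fold (cA y) in F3.
  set (n := Rabs (H y) + Rabs (A y) + Rabs (X y) + Rabs (W y)).
  assert (Pn : 0 <= n) by (unfold n; assert (Pa := Rabs_pos (H y));
    assert (Pb := Rabs_pos (A y)); assert (Pc := Rabs_pos (X y));
    assert (Pd := Rabs_pos (W y)); lra).
  assert (Ae : forall v, Rabs (e * v) = Rabs v).
  { intros v; unfold e; destruct (Rle_dec 1 y1); [now rewrite Rmult_1_l |].
    rewrite <- (Rabs_Ropp v); f_equal; ring. }
  rewrite !Ae, F1, F2, F3, F4; clear F1 F2 F3 F4 Sy Ae.
  assert (Iq : forall v, Rabs (v / (1 - y ^ 2)) <= Rabs v / t).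
  { intros v; unfold Rdiv; rewrite Rabs_mult, Rabs_inv.
    apply Rmult_le_compat_l; [apply Rabs_pos |].
    apply Rinv_le_contravar; lra. }
  assert (Ip : forall v, Rabs (v / p2 y) <= im * Rabs v).
  { intros v; unfold Rdiv; rewrite Rabs_mult, Rabs_inv, (Rabs_pos_eq (p2 y)) by lra.
    rewrite Rmult_comm; apply Rmult_le_compat_r; [apply Rabs_pos |].
    apply Rinv_le_contravar; lra. }
  assert (Uy : forall c, 0 <= c <= 8 -> Rabs (c * u * y) <= B).
  { intros c Hc; rewrite !Rabs_mult, (Rabs_pos_eq c), (Rabs_pos_eq y) by lra.
    assert (c * Rabs u * y <= 8 * Y); [| unfold B; lra].
    apply Rmult_le_compat; try lra; [| assert (Pu' := Rabs_pos u); nra].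
    apply Rmult_le_pos; [lra | apply Rabs_pos]. }
  assert (U1 : Rabs (1 - u) <= 2) by (apply Rabs_le; lra).
  assert (PX := Rabs_pos (X y)); assert (PW := Rabs_pos (W y)).
  assert (PXt : 0 <= Rabs (X y) / t) by (apply Rdiv_le_0_compat; lra).
  assert (PWt : 0 <= Rabs (W y) / t) by (apply Rdiv_le_0_compat; lra).
  assert (PC1 : 0 <= im * (B + 1)) by nra.
  assert (PC2 : 0 <= im * ((Y + 2) * i1)) by (repeat apply Rmult_le_pos; lra).
  split; [| split; [| split]].
  + apply Rle_trans with (B * n); [| apply Rmult_le_compat_r; unfold C; lra].
    assert (V : Rabs (4 * u * (1 + u) * y) <= B).
    { replace (4 * u * (1 + u) * y) with (4 * u * y * (1 + u)) by ring.
      rewrite Rabs_mult, (Rabs_pos_eq (1 + u)) by lra.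
      rewrite !Rabs_mult, (Rabs_pos_eq 4), (Rabs_pos_eq y) by lra.
      apply Rle_trans with (4 * Y * 2); [| unfold B; lra].
      assert (Pu' := Rabs_pos u).
      apply Rmult_le_compat; try lra; [nra |].
      apply Rmult_le_compat; lra || nra. }
    replace (- 4 * u * (1 + u) * y) with (- (4 * u * (1 + u) * y)) by ring.
    apply lin_bound; rewrite ?Rabs_Ropp; trivial.
    * rewrite Rabs_mult, (Rabs_pos_eq 4) by lra; unfold B; lra.
    * rewrite Rabs_R0; exact PB.
  + apply Rle_trans with (1 := Ip _).
    apply Rle_trans with (im * (B * (Rabs (W y) / t + n))).
    * apply Rmult_le_compat_l; [lra |].
      apply Rle_trans with (1 := Rabs_triang _ _).
      rewrite Rmult_plus_distr_l; apply Rplus_le_compat.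
      -- replace (- (1 - u) * W y / (4 * (1 - y ^ 2)))
           with (- (1 - u) / 4 * (W y / (1 - y ^ 2))) by (field; lra).
         rewrite Rabs_mult; apply Rmult_le_compat; try apply Rabs_pos; [| apply Iq].
         unfold Rdiv; rewrite Rabs_mult, Rabs_Ropp, (Rabs_pos_eq (/ 4)) by lra.
         unfold B; lra.
      -- apply lin_bound.
         ++ apply Rle_trans with (1 := HB1 y HyY); unfold B; lra.
         ++ apply Rle_trans with (1 := HB2 y HyY); unfold B; lra.
         ++ apply Uy; lra.
         ++ rewrite Rabs_pos_eq; unfold B; lra.
    * rewrite <- Rmult_assoc; apply Rmult_le_compat_r; [lra |].
      unfold C; nra.
  + replace (X y / ((1 + u) * (1 - y ^ 2))) with (i1 * (X y / (1 - y ^ 2)))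
      by (unfold i1; field; lra).
    rewrite Rabs_mult, (Rabs_pos_eq i1) by lra.
    apply Rle_trans with (i1 * (Rabs (X y) / t)).
    * apply Rmult_le_compat_l; [lra | apply Iq].
    * apply Rmult_le_compat; try lra; unfold C; lra.
  + apply Rle_trans with (1 := Ip _).
    apply Rle_trans with (im * ((Y + 2) * i1 * ((Rabs (X y) + Rabs (W y)) / t) + B * n)).
    * apply Rmult_le_compat_l; [lra |].
      apply Rle_trans with (1 := Rabs_triang _ _); apply Rplus_le_compat.
      -- replace ((y * W y / 2 + (1 - u) * X y) / ((1 + u) * (1 - y ^ 2)))
           with (i1 * (y / 2 * (W y / (1 - y ^ 2)) + (1 - u) * (X y / (1 - y ^ 2))))
           by (unfold i1; field; lra).
         rewrite Rabs_mult, (Rabs_pos_eq i1) by lra.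
         rewrite (Rmult_comm (Y + 2)), Rmult_assoc.
         apply Rmult_le_compat_l; [lra |].
         apply Rle_trans with (1 := Rabs_triang _ _); rewrite !Rabs_mult.
         assert (Q1 : Rabs (y / 2) * Rabs (W y / (1 - y ^ 2)) <= (Y + 2) * (Rabs (W y) / t)).
         { apply Rmult_le_compat; try apply Rabs_pos; [| apply Iq].
           rewrite Rabs_pos_eq; lra. }
         assert (Q2 : Rabs (1 - u) * Rabs (X y / (1 - y ^ 2)) <= (Y + 2) * (Rabs (X y) / t)).
         { apply Rmult_le_compat; try apply Rabs_pos; [lra | apply Iq]. }
         unfold Rdiv in *; lra.
      -- apply lin_bound.
         ++ replace (- 2 * u * y) with (- (2 * u * y)) by ring.
            rewrite Rabs_Ropp; apply Uy; lra.
         ++ apply Uy; lra.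
         ++ fold B3; unfold B; lra.
         ++ rewrite Rabs_R0; exact PB.
    * rewrite Rmult_plus_distr_l, Rmult_plus_distr_l.
      rewrite <- !Rmult_assoc; unfold Rdiv in PXt, PWt |- *; rewrite Rmult_plus_distr_r.
      apply Rplus_le_compat.
      -- rewrite <- Rmult_plus_distr_r, <- !Rmult_assoc.
         apply Rmult_le_compat_r; [left; now apply Rinv_0_lt_compat |].
         apply Rmult_le_compat_r; [lra |]; unfold C; nra.
      -- apply Rmult_le_compat_r; [lra |]; unfold C; nra.
- lra.
Qed.

(** * Complex functions of a real variable *)

(** The variable is real; taking components gives direct access to the real theorems on derivatives
    and parametric integrals. *)
Definition Cder (f : R -> C) (x : R) (l : C) : Prop :=
  is_derive (fun t => Re (f t)) x (Re l) /\ is_derive (fun t => Im (f t)) x (Im l).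

Lemma Cder_eq f x l l' : Cder f x l -> l = l' -> Cder f x l'.
Proof. now intros H <-. Qed.

Lemma Cder_ext f g x l : (forall t, f t = g t) -> Cder f x l -> Cder g x l.
Proof.
intros E [H1 H2]; split;
  [apply is_derive_ext with (2 := H1) | apply is_derive_ext with (2 := H2)];
  intros t; now rewrite E.
Qed.

Lemma Cder_const c x : Cder (fun _ => c) x 0%C.
Proof.
split; [exact (is_derive_const (K := R_AbsRing) (V := R_NormedModule) (Re c) x)
       | exact (is_derive_const (K := R_AbsRing) (V := R_NormedModule) (Im c) x)].
Qed.

Lemma Cder_RtoC (f : R -> R) x l : is_derive f x l -> Cder (fun t => RtoC (f t)) x (RtoC l).
Proof. intros H; split; [exact H |];
    exact (is_derive_const (K := R_AbsRing) (V := R_NormedModule) 0 x). Qed.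

Lemma Cder_plus f g x l m :
  Cder f x l -> Cder g x m -> Cder (fun t => f t + g t)%C x (l + m)%C.
Proof.
intros [F1 F2] [G1 G2]; split; simpl; unfold Re, Im in *.
- exact (is_derive_plus _ _ _ _ _ F1 G1).
- exact (is_derive_plus _ _ _ _ _ F2 G2).
Qed.

Lemma Cder_minus f g x l m :
  Cder f x l -> Cder g x m -> Cder (fun t => f t - g t)%C x (l - m)%C.
Proof.
intros [F1 F2] [G1 G2]; split.
- exact (is_derive_minus _ _ _ _ _ F1 G1).
- exact (is_derive_minus _ _ _ _ _ F2 G2).
Qed.

Lemma is_derive_Rmult (f g : R -> R) (x l m : R) :
  is_derive f x l -> is_derive g x m ->
  is_derive (fun t => f t * g t) x (l * g x + f x * m).
Proof. intros F G; exact (is_derive_mult f g x l m F G Rmult_comm). Qed.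

Lemma Cder_mult f g x l m :
  Cder f x l -> Cder g x m -> Cder (fun t => f t * g t)%C x (l * g x + f x * m)%C.
Proof.
intros [F1 F2] [G1 G2]; split.
- replace (Re (l * g x + f x * m)%C)
    with (minus (Re l * Re (g x) + Re (f x) * Re m) (Im l * Im (g x) + Im (f x) * Im m))
    by (unfold minus, plus, opp, Re, Im; simpl; ring).
  exact (is_derive_minus _ _ _ _ _
    (is_derive_Rmult _ _ _ _ _ F1 G1) (is_derive_Rmult _ _ _ _ _ F2 G2)).
- replace (Im (l * g x + f x * m)%C)
    with (plus (Re l * Im (g x) + Re (f x) * Im m) (Im l * Re (g x) + Im (f x) * Re m))
    by (unfold plus, Re, Im; simpl; ring).
  exact (is_derive_plus _ _ _ _ _
    (is_derive_Rmult _ _ _ _ _ F1 G2) (is_derive_Rmult _ _ _ _ _ F2 G1)).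
Qed.

Lemma Cder_scal c f x l : Cder f x l -> Cder (fun t => c * f t)%C x (c * l)%C.
Proof.
intros H; apply Cder_eq with (1 := Cder_mult _ _ _ _ _ (Cder_const c x) H); ring.
Qed.

Definition Cisqrt (a : C) : C := (/ Csqrt a)%C.

Lemma Re_le_Cmod a : Re a <= Cmod a.
Proof.
assert (H := Cmod_sqr_ReIm a); assert (H0 := Cmod_ge_0 a).
destruct (Rle_lt_dec (Re a) 0); [lra | nra].
Qed.

(** On the right half-plane the sign test in [Csqrt] disappears, leaving an expression in real
    functions that are smooth there. *)
Lemma Cisqrt_formula a : 0 < Re a ->
  let rho := sqrt ((Cmod a + Re a) / 2) in
  Cisqrt a = (rho / Cmod a, - (Im a / (2 * rho * Cmod a))).
Proof.
intros Ha rho.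
assert (Hm := Re_le_Cmod a); assert (Hs := Cmod_sqr_ReIm a).
assert (Hr2 : rho * rho = (Cmod a + Re a) / 2) by (apply sqrt_sqrt; lra).
assert (Hr : 0 < rho) by (apply sqrt_lt_R0; lra).
assert (E : Csqrt a = (rho, Im a / (2 * rho))).
{ apply Csqrt_unique; [exact Hr |].
  rewrite (surjective_pairing a) at 3; unfold Cmult; simpl.
  fold (Re a) (Im a); f_equal; [| field; lra].
  apply Rmult_eq_reg_r with (4 * (rho * rho)); [| nra].
  transitivity (4 * (rho * rho) * (rho * rho) - Im a * Im a); [field; lra |].
  rewrite Hr2; nra. }
unfold Cisqrt; rewrite E; unfold Cinv; simpl.
assert (D : rho * (rho * 1) + Im a / (2 * rho) * (Im a / (2 * rho) * 1) = Cmod a).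
{ apply Rmult_eq_reg_r with (4 * (rho * rho)); [| nra].
  transitivity (4 * (rho * rho) * (rho * rho) + Im a * Im a); [field; lra |].
  rewrite Hr2; nra. }
rewrite D; f_equal; field; lra.
Qed.

Lemma Cisqrt_sqr a : 0 < Re a -> (Cisqrt a * Cisqrt a * a)%C = 1%C.
Proof.
intros Ha; unfold Cisqrt.
assert (Hn : Csqrt a <> 0%C).
{ intros E; assert (S := Csqrt_sqr a); rewrite E in S.
  rewrite <- S in Ha; simpl in Ha; lra. }
rewrite <- (Csqrt_sqr a) at 3; field; exact Hn.
Qed.

Lemma locally_pos (f : R -> R) x l : is_derive f x l -> 0 < f x -> locally x (fun t => 0 < f t).
Proof.
intros D H; assert (Cf : continuous f x) by (apply (ex_derive_continuous f); now exists l).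
apply (Cf (fun v => 0 < v)); exists (mkposreal _ H); intros v Hv.
apply Rabs_lt_between' in Hv; simpl in Hv; lra.
Qed.

Lemma Cder_Cisqrt g x l : 0 < Re (g x) -> Cder g x l ->
  Cder (fun t => Cisqrt (g t)) x (RtoC (- / 2) * l
      * (Cisqrt (g x) * Cisqrt (g x) * Cisqrt (g x)))%C.
Proof.
intros Hx [D1 D2].
set (a := fun t => Re (g t)) in *; set (b := fun t => Im (g t)) in *.
change (is_derive a x (Re l)) in D1; change (is_derive b x (Im l)) in D2.
set (m := fun t => sqrt (a t * a t + b t * b t)).
set (rho := fun t => sqrt ((m t + a t) / 2)).
assert (Em : forall t, Cmod (g t) = m t).
{ intros t; unfold m; rewrite <- (sqrt_Rsqr (Cmod (g t))) by apply Cmod_ge_0.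
  f_equal; unfold Rsqr; apply Cmod_sqr_ReIm. }
assert (Pa : 0 < a x) by exact Hx.
assert (Ps : 0 < a x * a x + b x * b x) by nra.
assert (Pm : 0 < m x) by now apply sqrt_lt_R0.
assert (Mm : m x * m x = a x * a x + b x * b x) by (apply sqrt_sqrt; lra).
assert (Pr : 0 < rho x) by (apply sqrt_lt_R0; lra).
assert (Mr : rho x * rho x = (m x + a x) / 2) by (apply sqrt_sqrt; lra).
set (dm := (a x * Re l + b x * Im l) / m x).
assert (Dm : is_derive m x dm).
{ unfold m; auto_derive; [repeat split; try (eexists; eassumption); exact Ps |].
  change (fun x0 => a x0) with a; change (fun x0 => b x0) with b.
  rewrite (is_derive_unique _ _ _ D1), (is_derive_unique _ _ _ D2).
  fold (m x); unfold dm; field; lra. }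
set (dr := (dm + Re l) / (4 * rho x)).
assert (Dr : is_derive rho x dr).
{ unfold rho; auto_derive; [repeat split; try (eexists; eassumption); lra |].
  change (fun x0 => a x0) with a; change (fun x0 => m x0) with m.
  rewrite (is_derive_unique _ _ _ D1), (is_derive_unique _ _ _ Dm).
  change (sqrt ((m x + a x) * / 2)) with (rho x); unfold dr; field; lra. }
assert (L := locally_pos a x _ D1 Pa).
assert (R1 : is_derive (fun t => rho t / m t) x ((dr * m x - rho x * dm) / (m x * m x))).
{ auto_derive; [repeat split; try (eexists; eassumption); lra |].
  change (fun x0 => rho x0) with rho; change (fun x0 => m x0) with m.
  rewrite (is_derive_unique _ _ _ Dr), (is_derive_unique _ _ _ Dm); field; lra. }
assert (R2 : is_derive (fun t => - (b t / (2 * rho t * m t))) x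
  (- (Im l / (2 * rho x * m x) - b x * (dr * m x + rho x * dm)
      / (2 * (rho x * m x) * (rho x * m x))))).
{ auto_derive; [repeat split; try (eexists; eassumption);
    repeat apply Rmult_integral_contrapositive_currified; lra |].
  change (fun x0 => rho x0) with rho; change (fun x0 => m x0) with m;
  change (fun x0 => b x0) with b.
  rewrite (is_derive_unique _ _ _ Dr), (is_derive_unique _ _ _ Dm),
    (is_derive_unique _ _ _ D2); field; lra. }
(* The cube is [Cisqrt] times 1/g, and 1/g is the conjugate of g divided by the squared modulus. *)
assert (Q : (Cisqrt (g x) * Cisqrt (g x) * Cisqrt (g x))%C
   = (((a x, (- b x)%R) : C) * ((rho x / m x)%R, (- (b x / (2 * rho x * m x)))%R)
       * RtoC (/ (m x * m x))%R)%C).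
{ assert (S := Cisqrt_sqr (g x) Hx).
  assert (F := Cisqrt_formula (g x) Hx); simpl in F; rewrite Em in F; fold (a x) (b x) in F.
  fold (rho x) in F; rewrite <- F.
  assert (I : (g x * (((a x, (- b x)%R) : C) * RtoC (/ (m x * m x))%R))%C = 1%C).
  { rewrite (surjective_pairing (g x)); change (fst (g x)) with (a x);
      change (snd (g x)) with (b x).
    unfold Cmult, RtoC; simpl; f_equal; [| ring].
    rewrite Mm; field; lra. }
  set (k := (((a x, (- b x)%R) : C) * RtoC (/ (m x * m x))%R)%C) in *.
  transitivity (Cisqrt (g x) * Cisqrt (g x) * Cisqrt (g x) * (g x * k))%C;
    [rewrite I; ring |].
  transitivity ((Cisqrt (g x) * Cisqrt (g x) * g x) * (Cisqrt (g x) * k))%C; [ring |].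
  rewrite S; unfold k; ring. }
rewrite Q.
(* Expressing a and b^2 through the modulus m and rho turns both components into rational
   identities. *)
assert (Eb : b x * b x = m x * m x - a x * a x) by lra.
assert (Ea : a x = 2 * (rho x * rho x) - m x) by lra.
split.
- apply is_derive_ext_loc with (fun t => rho t / m t).
  { revert L; apply filter_imp; intros t Ht; unfold rho.
    rewrite <- Em; fold (a t); rewrite Cisqrt_formula; [reflexivity | exact Ht]. }
  replace (Re _) with ((dr * m x - rho x * dm) / (m x * m x)); [exact R1 |].
  unfold dr, dm; destruct l as [l1 l2]; simpl.
  revert Pm Pr Ea Eb; generalize (a x) (b x) (m x) (rho x); clear.
  intros a0 b0 m0 r0 Pm Pr Ea Eb; rewrite Ea in *; field [Eb]; lra.
- apply is_derive_ext_loc with (fun t => - (b t / (2 * rho t * m t))).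
  { revert L; apply filter_imp; intros t Ht; unfold rho.
    rewrite <- Em; fold (a t); rewrite Cisqrt_formula; [reflexivity | exact Ht]. }
  replace (Im _) with (- (Im l / (2 * rho x * m x)
      - b x * (dr * m x + rho x * dm) / (2 * (rho x * m x) * (rho x * m x)))); [exact R2 |].
  unfold dr, dm; destruct l as [l1 l2]; simpl.
  revert Pm Pr Ea Eb; generalize (a x) (b x) (m x) (rho x); clear.
  intros a0 b0 m0 r0 Pm Pr Ea Eb; rewrite Ea in *; field [Eb]; lra.
Qed.

(** * Continuity of complex functions of one and two real variables *)

Definition Ccont2 (F : R -> R -> C) (x y : R) : Prop :=
  continuity_2d_pt (fun a b => Re (F a b)) x y /\
  continuity_2d_pt (fun a b => Im (F a b)) x y.

Lemma Ccont2_const c x y : Ccont2 (fun _ _ => c) x y.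
Proof. split; apply continuity_2d_pt_const. Qed.

Lemma Ccont2_RtoC f x y : continuity_2d_pt f x y -> Ccont2 (fun a b => RtoC (f a b)) x y.
Proof. intros H; split; [exact H | exact (continuity_2d_pt_const x y 0)]. Qed.

Lemma Ccont2_opp F x y : Ccont2 F x y -> Ccont2 (fun a b => - F a b)%C x y.
Proof. intros [F1 F2]; split; apply continuity_2d_pt_opp; assumption. Qed.

Lemma Ccont2_minus F G x y :
  Ccont2 F x y -> Ccont2 G x y -> Ccont2 (fun a b => F a b - G a b)%C x y.
Proof. intros [F1 F2] [G1 G2]; split; apply continuity_2d_pt_minus; assumption. Qed.

Lemma Ccont2_plus F G x y :
  Ccont2 F x y -> Ccont2 G x y -> Ccont2 (fun a b => F a b + G a b)%C x y.
Proof. intros [F1 F2] [G1 G2]; split; apply continuity_2d_pt_plus; assumption. Qed.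

Lemma Ccont2_mult F G x y :
  Ccont2 F x y -> Ccont2 G x y -> Ccont2 (fun a b => F a b * G a b)%C x y.
Proof.
intros [F1 F2] [G1 G2]; split.
- apply (continuity_2d_pt_minus (fun a b => Re (F a b) * Re (G a b))
    (fun a b => Im (F a b) * Im (G a b))); apply continuity_2d_pt_mult; assumption.
- apply (continuity_2d_pt_plus (fun a b => Re (F a b) * Im (G a b))
    (fun a b => Im (F a b) * Re (G a b))); apply continuity_2d_pt_mult; assumption.
Qed.

Lemma continuity_2d_pt_sqrt f x y : 0 <= f x y ->
  continuity_2d_pt f x y -> continuity_2d_pt (fun a b => sqrt (f a b)) x y.
Proof.
intros H Hf; apply continuity_1d_2d_pt_comp with (2 := Hf).
apply continuity_pt_filterlim, continuous_sqrt.
Qed.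

Lemma locally_2d_pos f x y : continuity_2d_pt f x y -> 0 < f x y ->
  locally_2d (fun a b => 0 < f a b) x y.
Proof.
intros Hf H; destruct (Hf (mkposreal _ H)) as [d Hd]; exists d; intros a b Ha Hb.
specialize (Hd a b Ha Hb); apply Rabs_lt_between' in Hd; simpl in Hd; lra.
Qed.

Lemma Ccont2_Cisqrt F x y : 0 < Re (F x y) -> Ccont2 F x y ->
  Ccont2 (fun a b => Cisqrt (F a b)) x y.
Proof.
intros Hp [F1 F2].
assert (M : continuity_2d_pt (fun a b => Cmod (F a b)) x y).
{ apply continuity_2d_pt_sqrt;
    [apply Rplus_le_le_0_compat; apply pow2_ge_0 |].
  apply continuity_2d_pt_plus; simpl; repeat apply continuity_2d_pt_mult;
    trivial; apply continuity_2d_pt_const. }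
assert (Hm := Re_le_Cmod (F x y)); assert (L := locally_2d_pos _ x y F1 Hp).
assert (Rh : continuity_2d_pt (fun a b => sqrt ((Cmod (F a b) + Re (F a b)) / 2)) x y).
{ apply continuity_2d_pt_sqrt; [lra |].
  apply continuity_2d_pt_mult; [| apply continuity_2d_pt_const].
  now apply continuity_2d_pt_plus. }
assert (Pr : 0 < sqrt ((Cmod (F x y) + Re (F x y)) / 2)) by (apply sqrt_lt_R0; lra).
split.
- apply continuity_2d_pt_ext_loc with
    (fun a b => sqrt ((Cmod (F a b) + Re (F a b)) / 2) / Cmod (F a b)).
  { revert L; apply locally_2d_impl, locally_2d_forall; intros a b H.
    now rewrite Cisqrt_formula. }
  apply continuity_2d_pt_mult; [exact Rh |].
  apply continuity_2d_pt_inv; [exact M | lra].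
- apply continuity_2d_pt_ext_loc with (fun a b =>
    - (Im (F a b) / (2 * sqrt ((Cmod (F a b) + Re (F a b)) / 2) * Cmod (F a b)))).
  { revert L; apply locally_2d_impl, locally_2d_forall; intros a b H.
    now rewrite Cisqrt_formula. }
  apply continuity_2d_pt_opp, continuity_2d_pt_mult; [exact F2 |].
  apply continuity_2d_pt_inv.
  + repeat apply continuity_2d_pt_mult; trivial; apply continuity_2d_pt_const.
  + repeat apply Rmult_integral_contrapositive_currified; lra.
Qed.

Definition Ccont (f : R -> C) : Prop :=
  forall t, continuous (fun s => Re (f s)) t /\ continuous (fun s => Im (f s)) t.

Lemma continuity_2d_pt_slice f x y : continuity_2d_pt f x y -> continuous (f x) y.
Proof.
intros H; apply filterlim_locally; intros eps.
destruct (H eps) as [d Hd]; exists d; intros t Ht.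
apply Hd; [rewrite Rminus_eq_0, Rabs_R0; apply cond_pos | exact Ht].
Qed.

Lemma Ccont2_slice F x : (forall t, Ccont2 F x t) -> Ccont (F x).
Proof.
intros H t; destruct (H t) as [H1 H2]; split.
- exact (continuity_2d_pt_slice (fun a b => Re (F a b)) x t H1).
- exact (continuity_2d_pt_slice (fun a b => Im (F a b)) x t H2).
Qed.

Lemma Ccont_Ccont2 f x y : Ccont f -> Ccont2 (fun _ t => f t) x y.
Proof.
intros H; destruct (H y) as [H1 H2]; split.
- apply (continuity_1d_2d_pt_comp (fun s => Re (f s)) (fun _ t => t));
    [apply continuity_pt_filterlim, H1 | apply continuity_2d_pt_id2].
- apply (continuity_1d_2d_pt_comp (fun s => Im (f s)) (fun _ t => t));
    [apply continuity_pt_filterlim, H2 | apply continuity_2d_pt_id2].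
Qed.

Lemma Ccont_const c : Ccont (fun _ => c).
Proof. intros t; split; apply continuous_const. Qed.

Lemma Ccont_plus f g : Ccont f -> Ccont g -> Ccont (fun t => f t + g t)%C.
Proof.
intros F G; apply (Ccont2_slice (fun _ t => f t + g t)%C 0); intros t.
apply Ccont2_plus; now apply Ccont_Ccont2.
Qed.

Lemma Ccont_mult f g : Ccont f -> Ccont g -> Ccont (fun t => f t * g t)%C.
Proof.
intros F G; apply (Ccont2_slice (fun _ t => f t * g t)%C 0); intros t.
apply Ccont2_mult; now apply Ccont_Ccont2.
Qed.

Lemma Ccont_ex_RInt f a b : Ccont f ->
  ex_RInt (fun t => Re (f t)) a b /\ ex_RInt (fun t => Im (f t)) a b.
Proof.
intros F; split; apply (ex_RInt_continuous (V := R_CompleteNormedModule));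
  intros t _; apply F.
Qed.

(** * Complex integrals over [0, PI] and their derivatives in a parameter *)

Definition CI (f : R -> C) : C :=
  (RInt (fun t => Re (f t)) 0 PI, RInt (fun t => Im (f t)) 0 PI).

Ltac eqR := match goal with |- @eq _ ?a ?b => change (@eq R a b) end.

Lemma RInt_ext_R (f g : R -> R) a b : (forall t, f t = g t) -> RInt f a b = RInt g a b.
Proof. intros E; apply RInt_ext; intros t _; apply E. Qed.

Lemma CI_ext f g : (forall t, f t = g t) -> CI f = CI g.
Proof. intros E; unfold CI; f_equal; apply RInt_ext; intros t _; now rewrite E. Qed.

Lemma CI_plus f g : Ccont f -> Ccont g -> CI (fun t => f t + g t)%C = (CI f + CI g)%C.
Proof.
intros F G; destruct (Ccont_ex_RInt f 0 PI F), (Ccont_ex_RInt g 0 PI G).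
unfold CI, Cplus; simpl; f_equal;
  apply (RInt_plus (V := R_CompleteNormedModule)); assumption.
Qed.

Lemma RInt_lin2 (f g : R -> R) a b c d : ex_RInt f a b -> ex_RInt g a b ->
  RInt (fun t => c * f t + d * g t) a b = c * RInt f a b + d * RInt g a b.
Proof.
intros F G; apply is_RInt_unique.
apply (is_RInt_plus (V := R_NormedModule));
  apply (is_RInt_scal (V := R_NormedModule)), (RInt_correct (V := R_CompleteNormedModule));
  assumption.
Qed.

Lemma CI_scal c f : Ccont f -> CI (fun t => c * f t)%C = (c * CI f)%C.
Proof.
intros F; destruct (Ccont_ex_RInt f 0 PI F) as [F1 F2].
unfold CI, Cmult; simpl; f_equal.
- transitivity (Re c * RInt (fun t => Re (f t)) 0 PI + - Im c * RInt (fun t => Im (f t)) 0 PI).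
  + rewrite <- RInt_lin2 by assumption; apply RInt_ext_R; intros t; unfold Re, Im; simpl; ring.
  + eqR; unfold Re, Im; ring.
- transitivity (Im c * RInt (fun t => Re (f t)) 0 PI + Re c * RInt (fun t => Im (f t)) 0 PI).
  + rewrite <- RInt_lin2 by assumption; apply RInt_ext_R; intros t; unfold Re, Im; simpl; ring.
  + eqR; unfold Re, Im; ring.
Qed.

Lemma CI_const c : CI (fun _ => c) = (RtoC PI * c)%C.
Proof.
unfold CI, Cmult; simpl; rewrite !RInt_const; unfold scal; simpl; unfold mult, Re, Im; simpl.
f_equal; eqR; ring.
Qed.

Lemma CI_exact (P p : R -> C) : (forall t, Cder P t (p t)) -> Ccont p ->
  CI p = (P PI - P 0)%C.
Proof.
intros D Cp; unfold CI; rewrite (surjective_pairing (P PI - P 0)%C); f_equal.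
- apply is_RInt_unique, (is_RInt_derive (V := R_CompleteNormedModule) (fun t => Re (P t))).
  + intros t _; apply D.
  + intros t _; apply Cp.
- apply is_RInt_unique, (is_RInt_derive (V := R_CompleteNormedModule) (fun t => Im (P t))).
  + intros t _; apply D.
  + intros t _; apply Cp.
Qed.

Lemma is_derive_RInt_joint (f g : R -> R -> R) a b x :
  locally x (fun y => forall t, is_derive (fun y => f y t) y (g y t)) ->
  locally x (fun y => forall t, continuous (f y) t) ->
  (forall t, continuity_2d_pt g x t) ->
  is_derive (fun y => RInt (f y) a b) x (RInt (g x) a b).
Proof.
intros D Cf Cg.
replace (RInt (g x) a b) with (RInt (fun t => Derive (fun y => f y t) x) a b).
- apply is_derive_RInt_param.
  + revert D; apply filter_imp; intros y D t _; eexists; apply D.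
  + intros t _; apply continuity_2d_pt_ext_loc with (2 := Cg t).
    destruct D as [d D]; exists d; intros y s Hy _.
    symmetry; apply is_derive_unique, D, Hy.
  + revert Cf; apply filter_imp; intros y Cf.
    apply (ex_RInt_continuous (V := R_CompleteNormedModule)); intros t _; apply Cf.
- apply RInt_ext; intros t _; apply is_derive_unique.
  exact (locally_singleton _ _ D t).
Qed.

Lemma Cder_CI (F G : R -> R -> C) x :
  locally x (fun y => forall t, Cder (fun y => F y t) y (G y t)) ->
  locally x (fun y => Ccont (F y)) ->
  (forall t, Ccont2 G x t) ->
  Cder (fun y => CI (F y)) x (CI (G x)).
Proof.
intros D Cf Cg; split.
- apply (is_derive_RInt_joint (fun y t => Re (F y t)) (fun y t => Re (G y t))).
  + revert D; apply filter_imp; intros y D t; apply D.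
  + revert Cf; apply filter_imp; intros y Cf t; apply Cf.
  + intros t; apply Cg.
- apply (is_derive_RInt_joint (fun y t => Im (F y t)) (fun y t => Im (G y t))).
  + revert D; apply filter_imp; intros y D t; apply D.
  + revert Cf; apply filter_imp; intros y Cf t; apply Cf.
  + intros t; apply Cg.
Qed.

(** * The integrals and the system they satisfy *)

Fixpoint peval (l : list C) (v : C) : C :=
  match l with nil => 0%C | a :: l => (a + v * peval l v)%C end.

Fixpoint pderiv (l : list C) (v : C) : C :=
  match l with nil => 0%C | a :: l => (peval l v + v * pderiv l v)%C end.

(* Coefficients of the powers of v in the three parts of the certificate for the
   derivative of the companion integral, obtained by undetermined coefficients. *)
Definition cert_plus (u r : C) : list C :=
  ((- 1 - u + u ^ 2 + u ^ 3 + r * (- 1 - 2 * u - u ^ 2))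
   :: (- 3 * u - u ^ 2 + 5 * u ^ 3 + u ^ 4 - 2 * u ^ 5 + r * (1 - u ^ 2 + 2 * u ^ 3 + 2 * u ^ 4))
   :: (5 * u ^ 2 + 3 * u ^ 3 - 7 * u ^ 4 - 3 * u ^ 5 + 2 * u ^ 6
       + r * (5 * u ^ 2 + 8 * u ^ 3 + u ^ 4 - 2 * u ^ 5))
   :: (- u ^ 3 + u ^ 4 + 3 * u ^ 5 - u ^ 6 - 2 * u ^ 7
       + r * (- u ^ 2 - 6 * u ^ 3 - 9 * u ^ 4 - 4 * u ^ 5))
   :: (- 2 * u ^ 5 - 2 * u ^ 6 + 2 * u ^ 7 + 2 * u ^ 8
       + r * (2 * u ^ 4 + 4 * u ^ 5 + 2 * u ^ 6)) :: nil)%C.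

Definition cert_mid (u r : C) : list C :=
  ((2 - 16 * u + 17 * u ^ 2 - 3 * u ^ 3 + r * (2 - 14 * u + 3 * u ^ 2))
   :: (2 * u - 26 * u ^ 2 + 37 * u ^ 3 - 17 * u ^ 4 + 4 * u ^ 5
       + r * (- 2 + 14 * u - 9 * u ^ 2 + 14 * u ^ 3 - 4 * u ^ 4))
   :: (6 * u ^ 2 + 10 * u ^ 3 + 8 * u ^ 4 - 24 * u ^ 5 + r * (4 * u ^ 2 + 10 * u ^ 4))
   :: (- 2 * u ^ 3 + 6 * u ^ 4 - 24 * u ^ 5 + 20 * u ^ 6
       + r * (2 * u ^ 2 - 14 * u ^ 3 - 4 * u ^ 4 - 14 * u ^ 5))
   :: (2 * u ^ 5 - 13 * u ^ 6 + 15 * u ^ 7 - 4 * u ^ 8 + r * (- 2 * u ^ 4 + 14 * u ^ 5 - u ^ 6))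
   :: (- u ^ 7 + u ^ 8 + r * (u ^ 6)) :: nil)%C.

Definition cert_minus (u r : C) : list C :=
  ((- 1 - 3 * u + 2 * u ^ 2 + 2 * u ^ 3 + r * (- 1 - 2 * u - 2 * u ^ 2))
   :: (u - 5 * u ^ 2 + 6 * u ^ 3 - 2 * u ^ 5 + r * (1 + 2 * u + 4 * u ^ 2 + 2 * u ^ 4))
   :: (5 * u ^ 2 - 5 * u ^ 3 + 7 * u ^ 4 - 5 * u ^ 5 - 2 * u ^ 6
       + r * (- u ^ 2 + 4 * u ^ 3 - 3 * u ^ 4 + 2 * u ^ 5))
   :: (3 * u ^ 3 - 7 * u ^ 4 + 5 * u ^ 5 - 3 * u ^ 6 + 2 * u ^ 7
       + r * (- u ^ 2 - 4 * u ^ 3 + u ^ 4 - 6 * u ^ 5))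
   :: (- 4 * u ^ 5 + 3 * u ^ 6 - u ^ 7 + 2 * u ^ 8 + r * (4 * u ^ 5 - u ^ 6))
   :: (u ^ 7 - u ^ 8 + r * (u ^ 6)) :: nil)%C.

Definition av (u v : C) : C := ((1 - v) * (1 - u ^ 2 * v) * (1 + u * v) ^ 2)%C.
Definition bv (u v : C) : C := (v * (1 - u * v) ^ 2)%C.
Definition dav (u v : C) : C :=
  (- (1 - u ^ 2 * v) * (1 + u * v) ^ 2 - u ^ 2 * (1 - v) * (1 + u * v) ^ 2
   + 2 * u * (1 - v) * (1 - u ^ 2 * v) * (1 + u * v))%C.
Definition dbv (u v : C) : C := ((1 - u * v) ^ 2 - 2 * u * v * (1 - u * v))%C.
(* The variable w stands for 4ys, so that the w of the theorem is p + w.  As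
   p^2 = (1+u)^2 + w^2, the product (p + w) Gp is (1+u)^2 times the quartic under
   the root in I_+ and I_-. *)
Definition Gp (u p w v : C) : C := (av u v * (p - w) + (1 + u) ^ 2 * (bv u v * (p + w)))%C.
(** The y-derivative of [Gp] up to the factor 4s/p: from p p' = w w' and w' = 4s, the quantities p +
    w and p - w have logarithmic derivatives 4s/p and -4s/p. [Gv] is the v-derivative. *)
Definition Gd (u p w v : C) : C := ((1 + u) ^ 2 * (bv u v * (p + w)) - av u v * (p - w))%C.
Definition Gv (u p w v : C) : C := (dav u v * (p - w) + (1 + u) ^ 2 * (dbv u v * (p + w)))%C.
Definition Nh (u r v : C) : C := (1 - u * v + v * r)%C.
(** Numerator of the companion integral over Gp^(3/2): up to a factor free of v, it is what remains
    of the derivative of the first integral after subtracting a multiple of that integral and an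
    exact differential. *)
Definition Nj (u r v : C) : C :=
  (((1 - u ^ 2 * v ^ 2) ^ 2 - 4 * u * v * (1 - v) * (1 - u ^ 2 * v))
   * ((1 - u) * (1 + u * v) + r * (1 - v)))%C.
Definition ph (v : C) : C := (v * (1 - v))%C.

(** The reduction over the common denominator Gp^(3/2). The terms with [ph] are the derivative of a
    linear polynomial in v times sqrt (v (1 - v)) / sqrt Gp. The factor w^2 + 4u equals 4u (1 - y^2)
    and produces the singularity at y = 1. *)
Lemma certificate_h u r p w v :
  (r * r = 2 * u ^ 2 - 2 * u)%C -> (p * p = (1 + u) ^ 2 + w * w)%C ->
  (2 * (1 - u) * ((w ^ 2 + 4 * u) * (- / 2) * (Nh u r v * Gd u p w v)
     - / 2 * (r - w * p) * (Nh u r v * Gp u p w v)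
     + (u * u * r * ph v * Gp u p w v
        - u * (2 * (1 - u) + r * (1 - u * v))
          * (/ 2 * (1 - 2 * v) * Gp u p w v - / 2 * ph v * Gv u p w v)))
   = ((1 - u) * w - r * p) * (1 + u) * Nj u r v)%C.
Proof.
intros Hr Hp; unfold Nh, Gd, Gp, Gv, Nj, ph, av, bv, dav, dbv.
field [Hr Hp].
Qed.

Definition cert_j (u r p w v : C) : C :=
  (/ 4 * ((p + w) ^ 2 * peval (cert_plus u r) v + (p + w) * (p - w) * peval (cert_mid u r) v
          + (p - w) ^ 2 * peval (cert_minus u r) v))%C.
Definition dcert_j (u r p w v : C) : C :=
  (/ 4 * ((p + w) ^ 2 * pderiv (cert_plus u r) v + (p + w) * (p - w) * pderiv (cert_mid u r) v
          + (p - w) ^ 2 * pderiv (cert_minus u r) v))%C.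

(** The analogous reduction over Gp^(5/2), with exact differential that of [cert_j] sqrt (v (1 - v))
    / Gp^(3/2). The certificate is quadratic in p + w and p - w, in which [Gp] is linear. *)
Lemma certificate_j u r p w v :
  (r * r = 2 * u ^ 2 - 2 * u)%C -> (p * p = (1 + u) ^ 2 + w * w)%C ->
  ((w ^ 2 + 4 * u) * (/ 2 * (1 + u) ^ 2) * (- (3 / 2) * (Nj u r v * Gd u p w v))
   + dcert_j u r p w v * ph v * Gp u p w v
   + cert_j u r p w v * (/ 2 * (1 - 2 * v) * Gp u p w v - 3 / 2 * ph v * Gv u p w v)
   = / 2 * (w * p - r) * (/ 2 * (1 + u) ^ 2) * Nj u r v * Gp u p w v
     + / 4 * ((1 + 2 * u) * r * p - (1 - u) * w) * Nh u r v * (Gp u p w v * Gp u p w v))%C.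
Proof.
intros Hr Hp; unfold cert_j, dcert_j, Nh, Gd, Gp, Gv, Nj, ph, av, bv, dav, dbv.
simpl peval; simpl pderiv.
field [Hr Hp].
Qed.

Ltac cder :=
  match goal with
  | |- Cder (fun t => Cplus (@?f t) (@?g t)) _ _ => apply (Cder_plus f g); cder
  | |- Cder (fun t => Cminus (@?f t) (@?g t)) _ _ => apply (Cder_minus f g); cder
  | |- Cder (fun t => Cmult (@?f t) (@?g t)) _ _ => apply (Cder_mult f g); cder
  | |- Cder (fun _ => ?c) _ _ => apply (Cder_const c)
  | _ => eassumption
  end.

Ltac ccont2 :=
  match goal with
  | |- Ccont2 (fun a b => Cplus (@?f a b) (@?g a b)) _ _ => apply (Ccont2_plus f g); ccont2
  | |- Ccont2 (fun a b => Cminus (@?f a b) (@?g a b)) _ _ => apply (Ccont2_minus f g); ccont2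
  | |- Ccont2 (fun a b => Cmult (@?f a b) (@?g a b)) _ _ => apply (Ccont2_mult f g); ccont2
  | |- Ccont2 (fun _ _ => ?c) _ _ => apply (Ccont2_const c)
  | _ => eassumption
  end.

Lemma Cder_peval l V t dV : Cder V t dV ->
  Cder (fun t => peval l (V t)) t (pderiv l (V t) * dV)%C.
Proof.
intros H; induction l as [| a l IH]; simpl.
- eapply Cder_eq; [apply Cder_const | ring].
- eapply Cder_eq; [cder | ring].
Qed.

Lemma Ccont2_peval l V y t : Ccont2 V y t -> Ccont2 (fun a b => peval l (V a b)) y t.
Proof. intros H; induction l as [| a l IH]; simpl; ccont2. Qed.

Definition dom u y := 0 < (1 + u) ^ 2 - 4 * u * y ^ 2.
Definition pp u y := sqrt ((1 + u) ^ 2 - 4 * u * y ^ 2).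
Definition ww (s : C) (y : R) : C := (4 * y * s)%C.
(* The substitution v = (1 - cos t) / 2 turns dv / sqrt (v (1 - v)) into dt. *)
Definition vv (t : R) : C := RtoC ((1 - cos t) / 2).
Definition GG (u : R) (s : C) (y t : R) : C := Gp u (pp u y) (ww s y) (vv t).
Definition QQ u s y t := Cisqrt (GG u s y t).

Lemma pp_sqr u y : dom u y -> pp u y * pp u y = (1 + u) ^ 2 - 4 * u * y ^ 2.
Proof. intros H; apply sqrt_sqrt; unfold dom in H; lra. Qed.

Lemma pp_pos u y : dom u y -> 0 < pp u y.
Proof. intros H; now apply sqrt_lt_R0. Qed.

Definition root_u (u : R) (s : C) : Prop := (4 * s * s)%C = (- u)%C.

Lemma root_u_cases u s : root_u u s ->
  (Im s = 0 /\ 4 * (Re s * Re s) = - u) \/ (Re s = 0 /\ 4 * (Im s * Im s) = u).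
Proof.
intros H; assert (H1 := f_equal Re H); assert (H2 := f_equal Im H).
destruct s as [a b]; simpl in *.
assert (a * b = 0) as [-> | ->]%Rmult_integral by lra; [right | left]; split; lra.
Qed.

(** This puts p + 4ys and p - 4ys in the right half-plane, on which all choices of roots rest.
    Either s is real and (4ys)^2 = p^2 - (1+u)^2, or 4ys is purely imaginary. *)
Lemma root_u_Re_lt u s y : root_u u s -> -1 < u -> dom u y -> Rabs (4 * y * Re s) < pp u y.
Proof.
intros Hs Hu Hd.
assert (Hp := pp_pos u y Hd); assert (Hp2 := pp_sqr u y Hd).
rewrite <- (Rabs_pos_eq (pp u y)) by lra; apply Rsqr_lt_abs_0; unfold Rsqr.
rewrite Hp2; destruct (root_u_cases u s Hs) as [[_ H] | [H _]].
- replace (4 * y * Re s * (4 * y * Re s)) with (4 * y ^ 2 * (4 * (Re s * Re s))) by ring.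
  rewrite H; nra.
- rewrite H; unfold dom in Hd; lra.
Qed.

Lemma vv_range t : 0 <= (1 - cos t) / 2 <= 1.
Proof. assert (H := COS_bound t); lra. Qed.

(** The real part combines [av] and [bv] with positive weights; both are nonnegative on [0, 1] and
    have no common zero there. *)
Lemma GG_Re_pos u s y t : root_u u s -> -1 < u < 1 -> dom u y -> 0 < Re (GG u s y t).
Proof.
intros Hs Hu Hd; assert (B := root_u_Re_lt u s y Hs (proj1 Hu) Hd).
apply Rabs_lt_between in B; assert (Hv := vv_range t).
unfold GG, Gp, ww, vv; set (v := (1 - cos t) / 2) in *; set (p := pp u y) in *.
set (A := (1 - v) * (1 - u ^ 2 * v) * (1 + u * v) ^ 2).
set (D := v * (1 - u * v) ^ 2).
assert (EA : av u v = RtoC A).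
{ unfold av, A; rewrite !RtoC_mult, RtoC_pow, RtoC_plus, !RtoC_minus, !RtoC_mult, RtoC_pow.
  reflexivity. }
assert (ED : bv u v = RtoC D).
{ unfold bv, D; rewrite !RtoC_mult, RtoC_pow, !RtoC_minus, !RtoC_mult; reflexivity. }
rewrite EA, ED, <- RtoC_plus, <- RtoC_pow; destruct s as [a b]; simpl in *.
assert (u ^ 2 < 1) by nra.
assert (P1 : 0 < 1 + u * v) by nra.
assert (P2 : 0 < 1 - u ^ 2 * v) by nra.
assert (P3 : 0 <= A).
{ unfold A; apply Rmult_le_pos; [apply Rmult_le_pos; lra | apply pow2_ge_0]. }
assert (P4 : 0 <= D) by (unfold D; apply Rmult_le_pos; [lra | apply pow2_ge_0]).
assert (P5 : 0 < (1 + u) * (1 + u)) by nra.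
set (sg := 4 * y * a) in *.
match goal with |- 0 < ?e => replace e with (A * (p - sg)
    + (1 + u) * (1 + u) * (D * (p + sg))) by (unfold sg; ring) end.
destruct (Req_dec v 1) as [-> | Hv1].
- assert (0 < D) by (unfold D; nra).
  apply Rplus_le_lt_0_compat; repeat apply Rmult_lt_0_compat; try lra.
  apply Rmult_le_pos; lra.
- assert (0 < A) by (unfold A; repeat apply Rmult_lt_0_compat; lra).
  apply Rplus_lt_le_0_compat; [apply Rmult_lt_0_compat; lra |].
  apply Rmult_le_pos; [lra |]; apply Rmult_le_pos; lra.
Qed.

Lemma Cder_vv t : Cder vv t (RtoC (sin t / 2)).
Proof.
apply (Cder_RtoC (fun t => (1 - cos t) / 2)); auto_derive; [exact I |].
field.
Qed.

Lemma Cder_GG_t u s y t :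
  Cder (GG u s y) t (Gv u (pp u y) (ww s y) (vv t) * RtoC (sin t / 2))%C.
Proof.
assert (H := Cder_vv t); set (S := RtoC (sin t / 2)) in *.
(* Powers are expanded because [cder] handles sums, differences and products. *)
apply Cder_ext with (fun t =>
  (1 - vv t) * (1 - u * u * vv t) * ((1 + u * vv t) * (1 + u * vv t)) * (pp u y - ww s y)
  + (1 + u) * (1 + u) * (vv t * ((1 - u * vv t) * (1 - u * vv t)) * (pp u y + ww s y)))%C.
{ intros x; unfold GG, Gp, av, bv; ring. }
eapply Cder_eq; [cder |]; cbv beta; unfold Gv, dav, dbv; ring.
Qed.

Lemma is_derive_pp u y : dom u y -> is_derive (pp u) y (- 4 * u * y / pp u y).
Proof.
intros H; assert (Hp := pp_pos u y H); unfold pp in *; auto_derive.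
- unfold dom in H; simpl in H; lra.
- replace ((1 + u) * ((1 + u) * 1) + - (4 * u * (y * (y * 1))))
    with ((1 + u) ^ 2 - 4 * u * y ^ 2) by ring; field; lra.
Qed.

Lemma RtoC_neq x : x <> 0 -> RtoC x <> 0%C.
Proof. intros H E; apply H; exact (f_equal Re E). Qed.

Lemma Cder_ww s y : Cder (ww s) y (4 * s)%C.
Proof.
unfold ww; assert (H : Cder (fun y => RtoC y) y 1%C)
  by (apply (Cder_RtoC (fun y => y)); auto_derive; [exact I | ring]).
eapply Cder_eq; [cder | ring].
Qed.

Lemma Cder_GG_y u s y t : root_u u s -> dom u y ->
  Cder (fun y => GG u s y t) y (4 * s / pp u y * Gd u (pp u y) (ww s y) (vv t))%C.
Proof.
intros Hs Hd; assert (Hp := Cder_RtoC _ _ _ (is_derive_pp u y Hd)).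
assert (Hw := Cder_ww s y); unfold GG, Gp.
assert (Pp : RtoC (pp u y) <> 0%C) by (apply RtoC_neq; assert (P := pp_pos u y Hd); lra).
eapply Cder_eq; [cder |]; cbv beta.
rewrite RtoC_div, !RtoC_mult by (assert (P := pp_pos u y Hd); lra).
unfold Gd, ww; unfold root_u in Hs.
replace (RtoC u) with (- (4 * s * s))%C by (rewrite Hs; ring).
field; exact Pp.
Qed.

Lemma Ccont2_vv y t : Ccont2 (fun _ t => vv t) y t.
Proof.
apply Ccont2_RtoC, (continuity_1d_2d_pt_comp (fun t => (1 - cos t) / 2) (fun _ t => t));
  [| apply continuity_2d_pt_id2].
apply continuity_pt_filterlim, (ex_derive_continuous (fun t => (1 - cos t) / 2)).
auto_derive; exact I.
Qed.

Lemma continuity_2d_pt_pp u y t : dom u y -> continuity_2d_pt (fun y _ => pp u y) y t.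
Proof.
intros Hd; apply (continuity_1d_2d_pt_comp (pp u) (fun y _ => y));
  [| apply continuity_2d_pt_id1].
apply continuity_pt_filterlim, (ex_derive_continuous (pp u)).
eexists; now apply is_derive_pp.
Qed.

Lemma Ccont2_ww s y t : Ccont2 (fun y _ => ww s y) y t.
Proof.
assert (H : Ccont2 (fun y _ => RtoC y) y t) by apply Ccont2_RtoC, continuity_2d_pt_id1.
unfold ww; ccont2.
Qed.

Lemma Ccont2_GG u s y t : dom u y -> Ccont2 (GG u s) y t.
Proof.
intros Hd; assert (Hv := Ccont2_vv y t); assert (Hw := Ccont2_ww s y t).
assert (Hp := Ccont2_RtoC _ _ _ (continuity_2d_pt_pp u y t Hd)).
unfold GG, Gp, av, bv; simpl Cpow; ccont2.
Qed.

Lemma Ccont2_QQ u s y t : root_u u s -> -1 < u < 1 -> dom u y -> Ccont2 (QQ u s) y t.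
Proof.
intros Hs Hu Hd; apply Ccont2_Cisqrt; [now apply GG_Re_pos | now apply Ccont2_GG].
Qed.

Lemma QQ_sqr u s y t : root_u u s -> -1 < u < 1 -> dom u y ->
  (QQ u s y t * QQ u s y t * GG u s y t = 1)%C.
Proof. intros; apply Cisqrt_sqr; now apply GG_Re_pos. Qed.

Lemma Cder_QQ_y u s y t : root_u u s -> -1 < u < 1 -> dom u y ->
  Cder (fun y => QQ u s y t) y
    (RtoC (- / 2) * (4 * s / pp u y * Gd u (pp u y) (ww s y) (vv t))
     * (QQ u s y t * QQ u s y t * QQ u s y t))%C.
Proof.
intros Hs Hu Hd; apply (Cder_Cisqrt (fun y => GG u s y t));
  [now apply GG_Re_pos | now apply Cder_GG_y].
Qed.

Lemma Cder_QQ_t u s y t : root_u u s -> -1 < u < 1 -> dom u y ->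
  Cder (QQ u s y) t
    (RtoC (- / 2) * (Gv u (pp u y) (ww s y) (vv t) * RtoC (sin t / 2))
     * (QQ u s y t * QQ u s y t * QQ u s y t))%C.
Proof.
intros Hs Hu Hd; apply (Cder_Cisqrt (GG u s y)); [now apply GG_Re_pos | apply Cder_GG_t].
Qed.

Lemma locally_dom u y : dom u y -> locally y (dom u).
Proof.
intros H; apply (locally_pos (fun y => (1 + u) ^ 2 - 4 * u * y ^ 2) y (- 8 * u * y)); [| exact H].
auto_derive; [exact I | ring].
Qed.

Lemma Ccont_minus f g : Ccont f -> Ccont g -> Ccont (fun t => f t - g t)%C.
Proof.
intros F G; apply (Ccont2_slice (fun _ t => f t - g t)%C 0); intros t.
apply Ccont2_minus; now apply Ccont_Ccont2.
Qed.

Lemma Ccont_opp f : Ccont f -> Ccont (fun t => - f t)%C.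
Proof.
intros F; apply (Ccont2_slice (fun _ t => - f t)%C 0); intros t.
apply Ccont2_opp; now apply Ccont_Ccont2.
Qed.

Ltac ccont :=
  match goal with
  | |- Ccont (fun t => Cplus (@?f t) (@?g t)) => apply (Ccont_plus f g); ccont
  | |- Ccont (fun t => Cminus (@?f t) (@?g t)) => apply (Ccont_minus f g); ccont
  | |- Ccont (fun t => Cmult (@?f t) (@?g t)) => apply (Ccont_mult f g); ccont
  | |- Ccont (fun t => Copp (@?f t)) => apply (Ccont_opp f); ccont
  | |- Ccont (fun _ => ?c) => apply (Ccont_const c)
  | _ => eassumption
  end.

Lemma Ccont_vv : Ccont vv.
Proof. apply (Ccont2_slice (fun _ t => vv t) 0), Ccont2_vv. Qed.

Lemma Ccont_QQ u s y : root_u u s -> -1 < u < 1 -> dom u y -> Ccont (QQ u s y).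
Proof. intros Hs Hu Hd; apply Ccont2_slice; intros t; now apply Ccont2_QQ. Qed.

Lemma Ccont_peval l : Ccont (fun t => peval l (vv t)).
Proof. apply (Ccont2_slice (fun _ t => peval l (vv t)) 0); intros t; apply Ccont2_peval,
    Ccont2_vv. Qed.

Lemma Ccont_pderiv l : Ccont (fun t => pderiv l (vv t)).
Proof.
assert (V := Ccont_vv); induction l as [| a l IH]; simpl; [apply Ccont_const |].
assert (P := Ccont_peval l); ccont.
Qed.

Lemma CI_lin2 a b f g : Ccont f -> Ccont g ->
  CI (fun t => a * f t + b * g t)%C = (a * CI f + b * CI g)%C.
Proof.
intros F G; rewrite CI_plus by (apply Ccont_mult; trivial; apply Ccont_const).
now rewrite !CI_scal.
Qed.

Lemma sin_PI_0 : RtoC (sin PI / 2) = 0%C /\ RtoC (sin 0 / 2) = 0%C.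
Proof. rewrite sin_PI, sin_0; split; f_equal; field. Qed.

Lemma sin_half_sqr t : (RtoC (sin t / 2) * RtoC (sin t / 2) = ph (vv t))%C.
Proof.
unfold ph, vv; rewrite <- RtoC_minus, <- !RtoC_mult; f_equal.
assert (H := sin2_cos2 t); unfold Rsqr in H; nra.
Qed.

Lemma Cder_sin_half t : Cder (fun t => RtoC (sin t / 2)) t (/ 2 * (1 - 2 * vv t))%C.
Proof.
eapply Cder_eq; [apply (Cder_RtoC (fun t => sin t / 2)); auto_derive; [exact I | reflexivity] |].
unfold vv; rewrite RtoC_div, !RtoC_mult, RtoC_minus by lra.
rewrite ?RtoC_inv by lra; field.
Qed.

Definition exact_h (u : R) (s r : C) (y t : R) : C :=
  ((u * u * r * ph (vv t) * GG u s y t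
    - u * (2 * (1 - u) + r * (1 - u * vv t))
      * (/ 2 * (1 - 2 * vv t) * GG u s y t - / 2 * ph (vv t) * Gv u (pp u y) (ww s y) (vv t)))
   * (QQ u s y t * QQ u s y t * QQ u s y t))%C.

(** The antiderivative contains sin t / 2, that is sqrt (v (1 - v)), so the boundary terms vanish.
    Using Q^2 G = 1, its derivative is written over Q^3 to match [certificate_h]. *)
Lemma CI_exact_h u s r y : root_u u s -> -1 < u < 1 -> dom u y ->
  Ccont (exact_h u s r y) /\ CI (exact_h u s r y) = 0%C.
Proof.
intros Hs Hu Hd.
assert (V := Ccont_vv); assert (Q := Ccont_QQ u s y Hs Hu Hd).
assert (K : Ccont (exact_h u s r y)).
{ unfold exact_h, GG, Gv, Gp, ph, av, bv, dav, dbv; simpl Cpow; ccont. }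
split; [exact K |].
rewrite (CI_exact (fun t => - u * (2 * (1 - u) + r * (1 - u * vv t)) * RtoC (sin t / 2)
    * QQ u s y t)%C)
  with (2 := K).
- destruct sin_PI_0 as [-> ->]; ring.
- intros t; assert (DV := Cder_vv t); assert (DS := Cder_sin_half t).
  assert (DQ := Cder_QQ_t u s y t Hs Hu Hd).
  assert (Q2 := QQ_sqr u s y t Hs Hu Hd); assert (S2 := sin_half_sqr t).
  eapply Cder_eq; [cder |]; cbv beta; unfold exact_h.
  set (v := vv t) in *; set (q := QQ u s y t) in *; set (S := RtoC (sin t / 2)) in *.
  set (g := Gv u (pp u y) (ww s y) v); set (G := GG u s y t) in *.
  rewrite <- S2, RtoC_opp, RtoC_inv by lra.
  transitivity ((u * u * r * (S * S)
      - u * (2 * (1 - u) + r * (1 - u * v)) * (/ 2 * (1 - 2 * v))) * q * (q * q * G)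
    + u * (2 * (1 - u) + r * (1 - u * v)) * / 2 * (S * S) * g * (q * q * q))%C;
    [rewrite Q2 |]; field.
Qed.

Definition exact_j (u : R) (s r : C) (y t : R) : C :=
  ((dcert_j u r (pp u y) (ww s y) (vv t) * ph (vv t) * GG u s y t
    + cert_j u r (pp u y) (ww s y) (vv t)
      * (/ 2 * (1 - 2 * vv t) * GG u s y t - 3 / 2 * ph (vv t) * Gv u (pp u y) (ww s y) (vv t)))
   * (QQ u s y t * QQ u s y t * QQ u s y t * QQ u s y t * QQ u s y t))%C.

Lemma CI_exact_j u s r y : root_u u s -> -1 < u < 1 -> dom u y ->
  Ccont (exact_j u s r y) /\ CI (exact_j u s r y) = 0%C.
Proof.
intros Hs Hu Hd.
assert (V := Ccont_vv); assert (Q := Ccont_QQ u s y Hs Hu Hd).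
assert (P1 := Ccont_peval (cert_plus u r)); assert (P2 := Ccont_peval (cert_mid u r)).
assert (P3 := Ccont_peval (cert_minus u r)).
assert (P1' := Ccont_pderiv (cert_plus u r)); assert (P2' := Ccont_pderiv (cert_mid u r)).
assert (P3' := Ccont_pderiv (cert_minus u r)).
assert (K : Ccont (exact_j u s r y)).
{ unfold exact_j, cert_j, dcert_j, GG, Gv, Gp, ph, av, bv, dav, dbv; unfold Cdiv; simpl Cpow;
    ccont. }
split; [exact K |].
rewrite (CI_exact (fun t => cert_j u r (pp u y) (ww s y) (vv t) * RtoC (sin t / 2)
   * (QQ u s y t * QQ u s y t * QQ u s y t))%C) with (2 := K).
- destruct sin_PI_0 as [-> ->]; ring.
- intros t; assert (DV := Cder_vv t); assert (DS := Cder_sin_half t).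
  assert (DQ := Cder_QQ_t u s y t Hs Hu Hd).
  assert (D1 := Cder_peval (cert_plus u r) _ _ _ DV).
  assert (D2 := Cder_peval (cert_mid u r) _ _ _ DV).
  assert (D3 := Cder_peval (cert_minus u r) _ _ _ DV).
  assert (Q2 := QQ_sqr u s y t Hs Hu Hd); assert (S2 := sin_half_sqr t).
  unfold cert_j; eapply Cder_eq; [cder |]; cbv beta; unfold exact_j, cert_j, dcert_j.
  set (v := vv t) in *; set (q := QQ u s y t) in *; set (S := RtoC (sin t / 2)) in *.
  set (g := Gv u (pp u y) (ww s y) v); set (G := GG u s y t) in *.
  set (p := RtoC (pp u y)); set (w := ww s y).
  set (a1 := peval (cert_plus u r) v); set (a2 := peval (cert_mid u r) v);
  set (a3 := peval (cert_minus u r) v); set (b1 := pderiv (cert_plus u r) v);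
  set (b2 := pderiv (cert_mid u r) v); set (b3 := pderiv (cert_minus u r) v).
  rewrite <- S2, RtoC_opp, RtoC_inv by lra.
  transitivity ((/ 4 * ((p + w) ^ 2 * b1 + (p + w) * (p - w) * b2 + (p - w) ^ 2 * b3) * (S * S)
    + / 4 * ((p + w) ^ 2 * a1 + (p + w) * (p - w) * a2 + (p - w) ^ 2 * a3) * (/ 2 * (1 - 2 * v)))
      * (q * q * q) * (q * q * G)
    - / 4 * ((p + w) ^ 2 * a1 + (p + w) * (p - w) * a2 + (p - w) ^ 2 * a3) * (3 / 2) * (S * S)
        * g * (q * q * q * q * q))%C;
    [rewrite Q2 |]; field.
Qed.

Definition Fh (u : R) (s r : C) (y t : R) : C := (Nh u r (vv t) * QQ u s y t)%C.
Definition Fj (u : R) (s r : C) (y t : R) : C :=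
  (Nj u r (vv t) * (QQ u s y t * QQ u s y t * QQ u s y t))%C.

(* hh u s r is sqrt (p + w) I_+ and hh u s (- r) is sqrt (p + w) I_-. *)
Definition hh (u : R) (s r : C) (y : R) : C :=
  (RtoC ((1 + u) / PI) * CI (Fh u s r y))%C.
Definition jj (u : R) (s r : C) (y : R) : C :=
  (RtoC ((1 + u) / PI) * (/ 2 * (1 + u) ^ 2) * CI (Fj u s r y))%C.

Lemma Ccont_Fh u s r y : root_u u s -> -1 < u < 1 -> dom u y -> Ccont (Fh u s r y).
Proof.
intros Hs Hu Hd; assert (V := Ccont_vv); assert (Q := Ccont_QQ u s y Hs Hu Hd).
unfold Fh, Nh; ccont.
Qed.

Lemma Ccont_Fj u s r y : root_u u s -> -1 < u < 1 -> dom u y -> Ccont (Fj u s r y).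
Proof.
intros Hs Hu Hd; assert (V := Ccont_vv); assert (Q := Ccont_QQ u s y Hs Hu Hd).
unfold Fj, Nj; simpl Cpow; ccont.
Qed.

Lemma ww_sqr u s y : root_u u s -> dom u y ->
  (pp u y * pp u y = (1 + u) ^ 2 + ww s y * ww s y)%C.
Proof.
intros Hs Hd; rewrite <- RtoC_mult, pp_sqr by exact Hd.
rewrite RtoC_minus, RtoC_pow, RtoC_plus, !RtoC_mult, RtoC_pow.
unfold ww; replace (4 * y * s * (4 * y * s))%C with (4 * y * y * (4 * s * s))%C by ring.
rewrite Hs; ring.
Qed.

Lemma hj_derivatives u s r y : root_u u s -> -1 < u < 1 -> dom u y ->
  Cder (hh u s r) y (RtoC ((1 + u) / PI) * CI (fun t => Nh u r (vv t)
     * (RtoC (- / 2) * (4 * s / pp u y * Gd u (pp u y) (ww s y) (vv t))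
        * (QQ u s y t * QQ u s y t * QQ u s y t))))%C /\
  Cder (jj u s r) y (RtoC ((1 + u) / PI) * (/ 2 * (1 + u) ^ 2) * CI (fun t => Nj u r (vv t)
     * (3 * RtoC (- / 2) * (4 * s / pp u y * Gd u (pp u y) (ww s y) (vv t))
        * (QQ u s y t * QQ u s y t * QQ u s y t * QQ u s y t * QQ u s y t))))%C.
Proof.
intros Hs Hu Hd; assert (L := locally_dom u y Hd).
assert (Hv : forall t, Ccont2 (fun _ t => vv t) y t) by (intros t; apply Ccont2_vv).
assert (Hw : forall t, Ccont2 (fun y _ => ww s y) y t) by (intros t; apply Ccont2_ww).
assert (Hp : forall t, Ccont2 (fun y _ => RtoC (pp u y)) y t)
  by (intros t; apply Ccont2_RtoC, continuity_2d_pt_pp, Hd).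
assert (Hi : forall t, Ccont2 (fun y _ => (/ RtoC (pp u y))%C) y t).
{ intros t; assert (P := pp_pos u y Hd); assert (C := continuity_2d_pt_pp u y t Hd).
  destruct (locally_2d_pos _ _ _ C P) as [d Hdl].
  assert (C' := Ccont2_RtoC _ _ _ (continuity_2d_pt_inv _ _ _ C (Rgt_not_eq _ _ P))).
  destruct C' as [C1 C2]; split;
    [apply continuity_2d_pt_ext_loc with (2 := C1) | apply continuity_2d_pt_ext_loc with (2 :=
        C2)];
    exists d; intros a b Ha Hb; rewrite RtoC_inv; trivial;
    apply Rgt_not_eq, (Hdl a b Ha Hb). }
assert (Hq : forall t, Ccont2 (QQ u s) y t) by (intros t; now apply Ccont2_QQ).
split; apply Cder_scal.
- apply (Cder_CI (Fh u s r) (fun y t => Nh u r (vv t)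
     * (RtoC (- / 2) * (4 * s / pp u y * Gd u (pp u y) (ww s y) (vv t))
        * (QQ u s y t * QQ u s y t * QQ u s y t)))%C).
  + revert L; apply filter_imp; intros x Hx t; apply Cder_scal; now apply Cder_QQ_y.
  + revert L; apply filter_imp; intros x Hx; now apply Ccont_Fh.
  + intros t; specialize (Hv t); specialize (Hw t); specialize (Hp t);
      specialize (Hi t); specialize (Hq t).
    unfold Nh, Gd, av, bv, Cdiv; simpl Cpow; ccont2.
- apply (Cder_CI (Fj u s r) (fun y t => Nj u r (vv t)
     * (3 * RtoC (- / 2) * (4 * s / pp u y * Gd u (pp u y) (ww s y) (vv t))
        * (QQ u s y t * QQ u s y t * QQ u s y t * QQ u s y t * QQ u s y t)))%C).
  + revert L; apply filter_imp; intros x Hx t; apply Cder_scal.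
    assert (D := Cder_QQ_y u s x t Hs Hu Hx).
    eapply Cder_eq; [apply (Cder_mult (fun y => QQ u s y t * QQ u s y t)%C (fun y => QQ u s y t));
      [apply (Cder_mult (fun y => QQ u s y t) (fun y => QQ u s y t)) |]; exact D | cbv beta;
          ring].
  + revert L; apply filter_imp; intros x Hx; now apply Ccont_Fj.
  + intros t; specialize (Hv t); specialize (Hw t); specialize (Hp t);
      specialize (Hi t); specialize (Hq t).
    unfold Nj, Gd, av, bv, Cdiv; simpl Cpow; ccont2.
Qed.

(** The certificates are multiplied by Q^3 and Q^5 and integrated; the exact parts drop out, and Q^2
    G = 1 restores the integrands of [hh] and [jj]. *)
Lemma hj_system u s r y : root_u u s -> (r * r = 2 * u ^ 2 - 2 * u)%C ->
  -1 < u < 1 -> dom u y ->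
  let p := RtoC (pp u y) in
  let w := ww s y in
  exists dh dj, Cder (hh u s r) y dh /\ Cder (jj u s r) y dj /\
  ((w ^ 2 + 4 * u) * p * dh
    = 4 * s * (((1 - u) * w - r * p) / ((1 - u) * (1 + u)) * jj u s r y
               + / 2 * (r - w * p) * hh u s r y))%C /\
  ((w ^ 2 + 4 * u) * p * dj
    = 4 * s * (/ 2 * (w * p - r) * jj u s r y
               + / 4 * ((1 + 2 * u) * r * p - (1 - u) * w) * hh u s r y))%C.
Proof.
intros Hs Hr Hu Hd p w.
destruct (hj_derivatives u s r y Hs Hu Hd) as [Dh Dj].
eexists; eexists; split; [exact Dh |]; split; [exact Dj |].
assert (Ch := Ccont_Fh u s r y Hs Hu Hd); assert (Cj := Ccont_Fj u s r y Hs Hu Hd).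
destruct (CI_exact_h u s r y Hs Hu Hd) as [Xh Eh].
destruct (CI_exact_j u s r y Hs Hu Hd) as [Xj Ej].
assert (V := Ccont_vv); assert (Q := Ccont_QQ u s y Hs Hu Hd).
assert (Hp := ww_sqr u s y Hs Hd); fold p w in Hp.
assert (Pp : p <> 0%C) by (apply RtoC_neq; assert (P := pp_pos u y Hd); lra).
assert (U1 : (1 - u)%C <> 0%C) by (rewrite <- RtoC_minus; apply RtoC_neq; lra).
assert (U2 : (1 + u)%C <> 0%C) by (rewrite <- RtoC_plus; apply RtoC_neq; lra).
fold p w in Dh, Dj |- *; unfold hh, jj; set (k := RtoC ((1 + u) / PI)).
split.
- transitivity (k * CI (fun t => ((w ^ 2 + 4 * u) * p) * (Nh u r (vv t)
     * (RtoC (- / 2) * (4 * s / p * Gd u p w (vv t))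
        * (QQ u s y t * QQ u s y t * QQ u s y t)))))%C.
  { rewrite CI_scal; [ring |]; unfold Nh, Gd, av, bv, Cdiv; simpl Cpow; ccont. }
  rewrite (CI_ext _ (fun t => 1 * (4 * s * ((1 - u) * w - r * p) * (1 + u) / (2 * (1 - u))
      * Fj u s r y t
     + 4 * s * / 2 * (r - w * p) * Fh u s r y t) + - (4 * s) * exact_h u s r y t)%C).
  + rewrite (CI_lin2 1 _ (fun t => (4 * s * ((1 - u) * w - r * p) * (1 + u) / (2 * (1 - u))
      * Fj u s r y t
     + 4 * s * / 2 * (r - w * p) * Fh u s r y t)%C)) by (trivial; ccont).
    rewrite CI_lin2, Eh by assumption; field; split; assumption.
  + intros t; unfold Fj, Fh, exact_h; fold p w.
    assert (E := certificate_h u r p w (vv t) Hr Hp).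
    assert (Q2 := QQ_sqr u s y t Hs Hu Hd).
    change (GG u s y t) with (Gp u p w (vv t)) in *.
    set (v := vv t) in *; set (q := QQ u s y t) in *; set (G := Gp u p w v) in *.
    set (g := Gd u p w v) in *; set (gv := Gv u p w v) in *; set (n := Nh u r v) in *.
    set (m := Nj u r v) in *.
    transitivity (4 * s * ((((1 - u) * w - r * p) * (1 + u) * m) / (2 * (1 - u)) * (q * q * q)
      + / 2 * (r - w * p) * n * q * (q * q * G)
      - (u * u * r * ph v * G - u * (2 * (1 - u) + r * (1 - u * v))
          * (/ 2 * (1 - 2 * v) * G - / 2 * ph v * gv)) * (q * q * q)))%C;
      [rewrite <- E, RtoC_opp, RtoC_inv by lra; field; split; assumption | rewrite Q2; field;
          assumption].
- transitivity (k * (/ 2 * (1 + u) ^ 2) * CI (fun t => ((w ^ 2 + 4 * u) * p) * (Nj u r (vv t)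
     * (3 * RtoC (- / 2) * (4 * s / p * Gd u p w (vv t))
        * (QQ u s y t * QQ u s y t * QQ u s y t * QQ u s y t * QQ u s y t)))))%C.
  { rewrite CI_scal; [ring |]; unfold Nj, Gd, av, bv, Cdiv; simpl Cpow; ccont. }
  set (c := (/ 2 * (1 + u) ^ 2)%C).
  assert (Hc : c <> 0%C).
  { unfold c; apply Cmult_neq_0; [| now apply Cpow_nz].
    rewrite <- RtoC_inv by lra; apply RtoC_neq; lra. }
  rewrite (CI_ext _ (fun t => 1 * (4 * s * / 2 * (w * p - r) * Fj u s r y t
     + 4 * s * / 4 * ((1 + 2 * u) * r * p - (1 - u) * w) / c * Fh u s r y t) +
         - (4 * s) / c * exact_j u s r y t)%C).
  + rewrite (CI_lin2 1 _ (fun t => (4 * s * / 2 * (w * p - r) * Fj u s r y t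
     + 4 * s * / 4 * ((1 + 2 * u) * r * p - (1 - u) * w) / c * Fh u s r y t)%C)) by (trivial;
         ccont).
    rewrite CI_lin2, Ej by assumption; field; assumption.
  + intros t; unfold Fj, Fh, exact_j; fold p w.
    assert (E := certificate_j u r p w (vv t) Hr Hp); fold c in E.
    assert (Q2 := QQ_sqr u s y t Hs Hu Hd).
    change (GG u s y t) with (Gp u p w (vv t)) in *.
    set (v := vv t) in *; set (q := QQ u s y t) in *; set (G := Gp u p w v) in *.
    set (g := Gd u p w v) in *; set (gv := Gv u p w v) in *; set (n := Nh u r v) in *.
    set (m := Nj u r v) in *.
    set (X := (dcert_j u r p w v * ph v * G
        + cert_j u r p w v * (/ 2 * (1 - 2 * v) * G - 3 / 2 * ph v * gv))%C) in *.
    assert (E' : ((w ^ 2 + 4 * u) * c * (- (3 / 2) * (m * g))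
      = / 2 * (w * p - r) * c * m * G
          + / 4 * ((1 + 2 * u) * r * p - (1 - u) * w) * n * (G * G) - X)%C).
    { rewrite <- E; unfold X; ring. }
    transitivity (4 * s / c * ((/ 2 * (w * p - r) * c * m) * (q * q * q) * (q * q * G)
      + / 4 * ((1 + 2 * u) * r * p - (1 - u) * w) * n * q * ((q * q * G) * (q * q * G))
      - X * (q * q * q * q * q)))%C; [| rewrite Q2; field; assumption].
    transitivity (4 * s / c * (((w ^ 2 + 4 * u) * c * (- (3 / 2) * (m * g)))
        * (q * q * q * q * q)))%C;
      [rewrite RtoC_opp, RtoC_inv by lra; field; split; assumption |].
    rewrite E'; field; assumption.
Qed.

(** The symmetric combination of the mixed products is divided by p, the antisymmetric one by s r.
    This clears s, r and odd powers of p from the coefficients, leaving those of [sys]. *)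
Lemma product_system (u s r p y h1 j1 h2 j2 dh1 dj1 dh2 dj2 : C) :
  (u = - (4 * s * s))%C -> (r * r = 2 * u ^ 2 - 2 * u)%C ->
  (p * p = (1 + u) ^ 2 + (4 * y * s) * (4 * y * s))%C ->
  s <> 0%C -> r <> 0%C -> p <> 0%C -> (1 - u)%C <> 0%C -> (1 + u)%C <> 0%C ->
  (- 4 * s * (1 - y ^ 2) * p * dh1
    = ((1 - u) * (4 * y * s) - r * p) / ((1 - u) * (1 + u)) * j1
      + / 2 * (r - 4 * y * s * p) * h1)%C ->
  (- 4 * s * (1 - y ^ 2) * p * dj1
    = / 2 * (4 * y * s * p - r) * j1
      + / 4 * ((1 + 2 * u) * r * p - (1 - u) * (4 * y * s)) * h1)%C ->
  (- 4 * s * (1 - y ^ 2) * p * dh2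
    = ((1 - u) * (4 * y * s) + r * p) / ((1 - u) * (1 + u)) * j2
      + / 2 * (- r - 4 * y * s * p) * h2)%C ->
  (- 4 * s * (1 - y ^ 2) * p * dj2
    = / 2 * (4 * y * s * p + r) * j2
      + / 4 * (- (1 + 2 * u) * r * p - (1 - u) * (4 * y * s)) * h2)%C ->
  let H := (h1 * h2)%C in
  let A := ((j1 * h2 + h1 * j2) / (p * (1 - u)))%C in
  let E := (u * (j1 * h2 - h1 * j2) / (4 * s * r))%C in
  let K := (4 * (j1 * j2) / ((1 - u) * (1 + u)))%C in
  let dH := (dh1 * h2 + h1 * dh2)%C in
  let dA := ((dj1 * h2 + j1 * dh2 + dh1 * j2 + h1 * dj2) / (p * (1 - u))
             + (j1 * h2 + h1 * j2) * (4 * u * y / (p * p * p * (1 - u))))%C in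
  let dE := (u * (dj1 * h2 + j1 * dh2 - dh1 * j2 - h1 * dj2) / (4 * s * r))%C in
  let dK := (4 * (dj1 * j2 + j1 * dj2) / ((1 - u) * (1 + u)))%C in
  ((1 + u) * (1 - y ^ 2) * dH = (1 + u) * y * H - (1 - u) * y * A - 2 * E)%C /\
  ((1 - y ^ 2) * (p * p * dA - 4 * u * y * A) = - 2 * E + y * (H - K) / 2)%C /\
  (8 * (1 - y ^ 2) * dE = - 2 * (1 - u) * A + (1 + 2 * u) * H + K)%C /\
  ((1 + u) * (1 - y ^ 2) * dK
    = - (1 + u) * y * K + (1 - u) * y * A - 2 * (1 + 2 * u) * E)%C.
Proof.
intros -> Hr Hp Hs Hr0 Hp0 U1 U2 E1 E2 E3 E4; cbv zeta.
set (u := (- (4 * s * s))%C) in *.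
(* Each equation is multiplied by - 4 s p so that the derivatives occur exactly as in the four
   hypotheses. *)
assert (M : forall a b, (- 4 * s * p * a = - 4 * s * p * b)%C -> a = b).
{ intros a b H.
  transitivity ((- 4 * s * p * a) / (- 4 * s * p))%C; [field; tauto |].
  rewrite H; field; tauto. }
set (q := (1 - y ^ 2)%C) in *.
split; [| split; [| split]]; apply M.
- transitivity ((1 + u) * ((- 4 * s * q * p * dh1) * h2 + h1 * (- 4 * s * q * p * dh2)))%C;
    [ring | rewrite E1, E3].
  unfold u, q in *; field [Hp Hr]; tauto.
- transitivity (p * / (1 - u) * ((- 4 * s * q * p * dj1) * h2 + j1 * (- 4 * s * q * p * dh2)
     + (- 4 * s * q * p * dh1) * j2 + h1 * (- 4 * s * q * p * dj2)))%C;
    [field; tauto | rewrite E1, E2, E3, E4].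
  unfold u, q in *; field [Hp Hr]; tauto.
- transitivity (8 * u / (4 * s * r) * ((- 4 * s * q * p * dj1) * h2 + j1 * (- 4 * s * q * p * dh2)
     - (- 4 * s * q * p * dh1) * j2 - h1 * (- 4 * s * q * p * dj2)))%C;
    [field; tauto | rewrite E1, E2, E3, E4].
  unfold u, q in *; field [Hp Hr]; tauto.
- transitivity (4 / (1 - u) * ((- 4 * s * q * p * dj1) * j2 + j1 * (- 4 * s * q * p * dj2)))%C;
    [field; tauto | rewrite E2, E4].
  unfold u, q in *; field [Hp Hr]; tauto.
Qed.

(** * The system for the products of the integrals *)

Definition RH u s r y : C := (hh u s r y * hh u s (- r) y)%C.
Definition RA u s r y : C :=
  ((jj u s r y * hh u s (- r) y + hh u s r y * jj u s (- r) y)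
   * RtoC (/ (pp u y * (1 - u))))%C.
Definition RE (u : R) (s r : C) (y : R) : C :=
  (u / (4 * s * r) * (jj u s r y * hh u s (- r) y - hh u s r y * jj u s (- r) y))%C.
Definition RK (u : R) (s r : C) (y : R) : C :=
  (4 / ((1 - u) * (1 + u)) * (jj u s r y * jj u s (- r) y))%C.

Definition csys (u y : R) (H A E K dH dA dE dK : C) : Prop :=
  ((1 + u) * (1 - y ^ 2) * dH = (1 + u) * y * H - (1 - u) * y * A - 2 * E)%C /\
  ((1 - y ^ 2) * (RtoC ((1 + u) ^ 2 - 4 * u * y ^ 2) * dA - 4 * u * y * A)
     = - 2 * E + y * (H - K) / 2)%C /\
  (8 * (1 - y ^ 2) * dE = - 2 * (1 - u) * A + (1 + 2 * u) * H + K)%C /\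
  ((1 + u) * (1 - y ^ 2) * dK
    = - (1 + u) * y * K + (1 - u) * y * A - 2 * (1 + 2 * u) * E)%C.

(** Since the coefficients are real, the real uniqueness theorem applies to the two parts
    separately. *)
Lemma csys_Re_Im u y H A E K dH dA dE dK : csys u y H A E K dH dA dE dK ->
  sys u y (Re H) (Re A) (Re E) (Re K) (Re dH) (Re dA) (Re dE) (Re dK) /\
  sys u y (Im H) (Im A) (Im E) (Im K) (Im dH) (Im dA) (Im dE) (Im dK).
Proof.
intros (E1 & E2 & E3 & E4).
destruct H as [H1 H2], A as [A1 A2], E as [e1 e2], K as [K1 K2].
destruct dH as [dH1 dH2], dA as [dA1 dA2], dE as [de1 de2], dK as [dK1 dK2].
split; (split; [| split; [| split]]).
- apply (f_equal Re) in E1; simpl in *.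
  match type of E1 with ?x = _ => transitivity x; [ring | rewrite E1; ring] end.
- apply (f_equal Re) in E2; simpl in *.
  match type of E2 with ?x = _ => transitivity x; [ring | rewrite E2; field] end.
- apply (f_equal Re) in E3; simpl in *.
  match type of E3 with ?x = _ => transitivity x; [ring | rewrite E3; ring] end.
- apply (f_equal Re) in E4; simpl in *.
  match type of E4 with ?x = _ => transitivity x; [ring | rewrite E4; ring] end.
- apply (f_equal Im) in E1; simpl in *.
  match type of E1 with ?x = _ => transitivity x; [ring | rewrite E1; ring] end.
- apply (f_equal Im) in E2; simpl in *.
  match type of E2 with ?x = _ => transitivity x; [ring | rewrite E2; field] end.
- apply (f_equal Im) in E3; simpl in *.
  match type of E3 with ?x = _ => transitivity x; [ring | rewrite E3; ring] end.
- apply (f_equal Im) in E4; simpl in *.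
  match type of E4 with ?x = _ => transitivity x; [ring | rewrite E4; ring] end.
Qed.

Lemma Ceq_0_sqr_neq (a : C) : (a * a)%C <> 0%C -> a <> 0%C.
Proof. intros H E; apply H; rewrite E; ring. Qed.

Lemma root_u_neq u s : root_u u s -> u <> 0 -> s <> 0%C.
Proof.
intros Hs Hu E; unfold root_u in Hs; rewrite E in Hs; apply Hu.
apply (f_equal Re) in Hs; simpl in Hs; lra.
Qed.

Lemma root_r_neq (u : R) (r : C) : (r * r = 2 * u ^ 2 - 2 * u)%C -> -1 < u < 1 -> u <> 0
    -> r <> 0%C.
Proof.
intros Hr Hu Hu0; apply Ceq_0_sqr_neq; rewrite Hr.
rewrite <- RtoC_pow, <- !RtoC_mult, <- RtoC_minus; apply RtoC_neq.
replace (2 * u ^ 2 - 2 * u) with (2 * u * (u - 1)) by ring.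
repeat apply Rmult_integral_contrapositive_currified; lra.
Qed.

Lemma R_system u s r y : root_u u s -> (r * r = 2 * u ^ 2 - 2 * u)%C ->
  -1 < u < 1 -> u <> 0 -> dom u y ->
  exists dH dA dE dK,
    Cder (RH u s r) y dH /\ Cder (RA u s r) y dA /\
    Cder (RE u s r) y dE /\ Cder (RK u s r) y dK /\
    csys u y (RH u s r y) (RA u s r y) (RE u s r y) (RK u s r y) dH dA dE dK.
Proof.
intros Hs Hr Hu Hu0 Hd.
assert (Hr' : (- r * - r = 2 * u ^ 2 - 2 * u)%C) by (rewrite <- Hr; ring).
destruct (hj_system u s r y Hs Hr Hu Hd) as (dh1 & dj1 & D1 & D2 & Q1 & Q2).
destruct (hj_system u s (- r)%C y Hs Hr' Hu Hd) as (dh2 & dj2 & D3 & D4 & Q3 & Q4).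
assert (Hp := pp_pos u y Hd).
assert (DP : is_derive (fun y => / (pp u y * (1 - u))) y
  (4 * u * y / (pp u y * pp u y * pp u y * (1 - u)))).
{ assert (Dp := is_derive_pp u y Hd); auto_derive.
  - split; [eexists; exact Dp |].
    split; [apply Rmult_integral_contrapositive_currified; lra | exact I].
  - change (fun x => pp u x) with (pp u); rewrite (is_derive_unique _ _ _ Dp).
    field; lra. }
apply Cder_RtoC in DP.
assert (Ns := root_u_neq u s Hs Hu0); assert (Nr := root_r_neq u r Hr Hu Hu0).
assert (Np : RtoC (pp u y) <> 0%C) by (apply RtoC_neq; lra).
assert (U1 : (1 - u)%C <> 0%C) by (rewrite <- RtoC_minus; apply RtoC_neq; lra).
assert (U2 : (1 + u)%C <> 0%C) by (rewrite <- RtoC_plus; apply RtoC_neq; lra).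
assert (Eu : RtoC u = (- (4 * s * s))%C) by (rewrite Hs; ring).
assert (Hpw := ww_sqr u s y Hs Hd); unfold ww in *.
(* With u = - 4 s^2 the left factor is - 16 s^2 (1 - y^2), so 4 s cancels; this uses s <> 0, hence u
   <> 0. *)
assert (Cut : forall d X : C, (((4 * y * s) ^ 2 + 4 * u) * pp u y * d = 4 * s * X)%C ->
  (- 4 * s * (1 - y ^ 2) * pp u y * d = X)%C).
{ intros d X HX.
  transitivity ((((4 * y * s) ^ 2 + 4 * u) * pp u y * d) / (4 * s))%C;
    [rewrite Eu; field; exact Ns | rewrite HX; field; exact Ns]. }
apply Cut in Q1; apply Cut in Q2; apply Cut in Q3; apply Cut in Q4.
do 4 eexists.
split; [exact (Cder_mult _ _ _ _ _ D1 D3) |].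
split; [exact (Cder_mult _ _ _ _ _
  (Cder_plus _ _ _ _ _ (Cder_mult _ _ _ _ _ D2 D3) (Cder_mult _ _ _ _ _ D1 D4)) DP) |].
split; [exact (Cder_scal _ _ _ _ (Cder_minus _ _ _ _ _
  (Cder_mult _ _ _ _ _ D2 D3) (Cder_mult _ _ _ _ _ D1 D4))) |].
split; [exact (Cder_scal _ _ _ _ (Cder_mult _ _ _ _ _ D2 D4)) |].
assert (Q3' : (- 4 * s * (1 - y ^ 2) * pp u y * dh2
    = ((1 - u) * (4 * y * s) + r * pp u y) / ((1 - u) * (1 + u)) * jj u s (- r) y
      + / 2 * (- r - 4 * y * s * pp u y) * hh u s (- r) y)%C)
  by (rewrite Q3; field; tauto).
assert (Q4' : (- 4 * s * (1 - y ^ 2) * pp u y * dj2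
    = / 2 * (4 * y * s * pp u y + r) * jj u s (- r) y
      + / 4 * (- (1 + 2 * u) * r * pp u y - (1 - u) * (4 * y * s)) * hh u s (- r) y)%C)
  by (rewrite Q4; field).
destruct (product_system u s r (pp u y) y _ _ _ _ _ _ _ _ Eu Hr Hpw Ns Nr Np U1 U2 Q1 Q2
  Q3' Q4') as (P1 & P2 & P3 & P4).
unfold RH, RA, RE, RK.
set (h1 := hh u s r y) in *; set (h2 := hh u s (- r) y) in *.
set (j1 := jj u s r y) in *; set (j2 := jj u s (- r) y) in *.
assert (Ei : RtoC (/ (pp u y * (1 - u))) = (/ (pp u y * (1 - u)))%C).
{ rewrite RtoC_inv, RtoC_mult, RtoC_minus; [reflexivity |].
  apply Rmult_integral_contrapositive_currified; lra. }
assert (Ej : RtoC (4 * u * y / (pp u y * pp u y * pp u y * (1 - u)))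
  = (4 * u * y / (pp u y * pp u y * pp u y * (1 - u)))%C).
{ rewrite RtoC_div, !RtoC_mult, RtoC_minus; [reflexivity |].
  repeat apply Rmult_integral_contrapositive_currified; lra. }
assert (E2 : RtoC ((1 + u) ^ 2 - 4 * u * y ^ 2) = (pp u y * pp u y)%C).
{ now rewrite <- RtoC_mult, pp_sqr. }
rewrite Ei, Ej; unfold csys; rewrite E2.
split; [| split; [| split]].
- etransitivity; [exact P1 | field; tauto].
- etransitivity; [| etransitivity; [exact P2 |]]; field; tauto.
- etransitivity; [| etransitivity; [exact P3 |]]; field; tauto.
- etransitivity; [| etransitivity; [exact P4 |]]; field; tauto.
Qed.

(** * The integrals at [y = 1] *)

Lemma Cneq_0_norm (a : C) : a <> 0%C -> 0 < Re a * Re a + Im a * Im a.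
Proof.
intros H; rewrite <- Cmod_sqr_ReIm; assert (P := proj1 (Cmod_gt_0 a) H); nra.
Qed.

Lemma Cder_inv (g : R -> C) (x : R) (l : C) : g x <> 0%C -> Cder g x l ->
  Cder (fun t => / g t)%C x (- l * (/ g x * / g x))%C.
Proof.
intros Hx [D1 D2]; assert (N := Cneq_0_norm _ Hx).
set (a := fun t => Re (g t)) in *; set (b := fun t => Im (g t)) in *.
change (is_derive a x (Re l)) in D1; change (is_derive b x (Im l)) in D2.
change (0 < a x * a x + b x * b x) in N.
assert (E : forall t, (/ g t)%C = (a t / (a t * a t + b t * b t),
    - b t / (a t * a t + b t * b t))).
{ intros t; unfold Cinv, a, b, Re, Im; simpl; now rewrite !Rmult_1_r. }
rewrite !E; split.
- apply is_derive_ext with (fun t => a t / (a t * a t + b t * b t)).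
  { intros t; now rewrite E. }
  auto_derive; [repeat split; try (eexists; eassumption); lra |].
  change (fun x0 => a x0) with a; change (fun x0 => b x0) with b.
  rewrite (is_derive_unique _ _ _ D1), (is_derive_unique _ _ _ D2).
  destruct l; simpl; field; lra.
- apply is_derive_ext with (fun t => - b t / (a t * a t + b t * b t)).
  { intros t; now rewrite E. }
  auto_derive; [repeat split; try (eexists; eassumption); lra |].
  change (fun x0 => a x0) with a; change (fun x0 => b x0) with b.
  rewrite (is_derive_unique _ _ _ D1), (is_derive_unique _ _ _ D2).
  destruct l; simpl; field; lra.
Qed.

Lemma Ccont2_inv (F : R -> R -> C) (x y : R) : F x y <> 0%C -> Ccont2 F x y
    -> Ccont2 (fun a b => / F a b)%C x y.
Proof.
intros H [F1 F2]; assert (N := Cneq_0_norm _ H).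
assert (M : continuity_2d_pt (fun a b =>
    / (Re (F a b) * Re (F a b) + Im (F a b) * Im (F a b))) x y).
{ apply continuity_2d_pt_inv; [| lra].
  apply continuity_2d_pt_plus; apply continuity_2d_pt_mult; assumption. }
split.
- apply continuity_2d_pt_ext with
    (fun a b => Re (F a b) * / (Re (F a b) * Re (F a b) + Im (F a b) * Im (F a b))).
  { intros a b; unfold Cinv, Re, Im; simpl; now rewrite !Rmult_1_r. }
  now apply continuity_2d_pt_mult.
- apply continuity_2d_pt_ext with
    (fun a b => - Im (F a b) * / (Re (F a b) * Re (F a b) + Im (F a b) * Im (F a b))).
  { intros a b; unfold Cinv, Re, Im; simpl; now rewrite !Rmult_1_r. }
  apply continuity_2d_pt_mult; [now apply continuity_2d_pt_opp | exact M].
Qed.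

Lemma Cder_zero_const (f : R -> C) a b : a < b -> (forall t, Cder f t 0%C) -> f a = f b.
Proof.
intros Hab D; rewrite (surjective_pairing (f a)), (surjective_pairing (f b)); f_equal.
- apply (eq_is_derive (fun t => Re (f t))); [intros t _; apply D | exact Hab].
- apply (eq_is_derive (fun t => Im (f t))); [intros t _; apply D | exact Hab].
Qed.

Lemma vv_0 : vv 0 = 0%C.
Proof. unfold vv; rewrite cos_0; f_equal; field. Qed.

Lemma vv_PI : vv PI = 1%C.
Proof. unfold vv; rewrite cos_PI; f_equal; field. Qed.

(* The complete integral [1/pi int_0^1 dv / (sqrt (v (1 - v)) (1 + c x v))],
   with [x = vv tau] running over [0, 1]. *)
Definition psi (c : C) (tau : R) : C :=
  (RtoC (/ PI) * CI (fun t => / (1 + c * vv tau * vv t)))%C.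

Lemma psi_0 c : psi c 0 = 1%C.
Proof.
unfold psi; rewrite (CI_ext _ (fun _ => 1%C)).
- rewrite CI_const, Cmult_1_r, <- RtoC_mult, Rinv_l; [reflexivity |].
  apply Rgt_not_eq, PI_RGT_0.
- intros t; rewrite vv_0; replace (1 + c * 0 * vv t)%C with (RtoC 1) by ring.
  rewrite <- RtoC_inv, Rinv_1 by lra; reflexivity.
Qed.

(** The differential equation of (1 + c x)^(-1/2) along x = vv tau. It evaluates the integral by a
    path from x = 0, without complex logarithms. *)
Lemma Cder_psi c : (forall tau t, (1 + c * vv tau * vv t)%C <> 0%C) ->
  forall tau, exists d, Cder (psi c) tau d /\
    ((1 + c * vv tau) * d = - (c * RtoC (sin tau / 2) * / 2) * psi c tau)%C.
Proof.
intros Hc tau; set (x := vv tau); set (s := RtoC (sin tau / 2)).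
set (G := fun tau t => (- (c * RtoC (sin tau / 2) * vv t)
  * (/ (1 + c * vv tau * vv t) * / (1 + c * vv tau * vv t)))%C).
exists (RtoC (/ PI) * CI (G tau))%C.
assert (V := Ccont_vv).
assert (K : forall tau, Ccont (fun t => / (1 + c * vv tau * vv t))%C).
{ intros r; apply (Ccont2_slice (fun r t => / (1 + c * vv r * vv t))%C r); intros t.
  apply Ccont2_inv; [apply Hc |].
  assert (V1 : Ccont2 (fun r _ => vv r) r t).
  { apply Ccont2_RtoC, (continuity_1d_2d_pt_comp (fun t => (1 - cos t) / 2) (fun r _ => r));
      [| apply continuity_2d_pt_id1].
    apply continuity_pt_filterlim, (ex_derive_continuous (fun t => (1 - cos t) / 2)).
    auto_derive; exact I. }
  assert (V2 := Ccont2_vv r t); ccont2. }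
split.
- unfold psi; apply Cder_scal.
  apply (Cder_CI (fun tau t => / (1 + c * vv tau * vv t))%C G).
  + apply filter_forall; intros r t; assert (D := Cder_vv r).
    eapply Cder_eq.
    * apply (Cder_inv (fun r => 1 + c * vv r * vv t)%C); [apply Hc | cder].
    * cbv beta; unfold G; ring.
  + apply filter_forall; intros r; apply K.
  + intros t.
    assert (V1 : Ccont2 (fun r _ => vv r) tau t).
    { apply Ccont2_RtoC, (continuity_1d_2d_pt_comp (fun t => (1 - cos t) / 2) (fun r _ => r));
        [| apply continuity_2d_pt_id1].
      apply continuity_pt_filterlim, (ex_derive_continuous (fun t => (1 - cos t) / 2)).
      auto_derive; exact I. }
    assert (V2 := Ccont2_vv tau t).
    assert (V3 : Ccont2 (fun r _ => RtoC (sin r / 2)) tau t).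
    { apply Ccont2_RtoC, (continuity_1d_2d_pt_comp (fun t => sin t / 2) (fun r _ => r));
        [| apply continuity_2d_pt_id1].
      apply continuity_pt_filterlim, (ex_derive_continuous (fun t => sin t / 2)).
      auto_derive; exact I. }
    assert (V4 : Ccont2 (fun r t => / (1 + c * vv r * vv t))%C tau t).
    { apply Ccont2_inv; [apply Hc | ccont2]. }
    unfold G; apply (Ccont2_mult (fun r t => - (c * RtoC (sin r / 2) * vv t))%C);
      [apply Ccont2_opp; ccont2 | ccont2].
(* [X] is the t-derivative of (sin t / 2) / (1 + c x v), hence integrates to 0; it carries the
   reduction of the differentiated integral to the original one. *)
- set (X := fun t => ((/ 2 - vv t - c * x * vv t * / 2)
    * (/ (1 + c * x * vv t) * / (1 + c * x * vv t)))%C).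
  assert (Kt := K tau); fold x in Kt.
  assert (CX : Ccont X) by (unfold X; ccont).
  assert (EX : CI X = 0%C).
  { rewrite (CI_exact (fun t => RtoC (sin t / 2) * / (1 + c * x * vv t))%C) with (2 := CX).
    - destruct sin_PI_0 as [-> ->]; ring.
    - intros t; assert (DV := Cder_vv t); assert (DS := Cder_sin_half t).
      assert (S2 := sin_half_sqr t); assert (N := Hc tau t); fold x in N.
      assert (DI : Cder (fun t => / (1 + c * x * vv t))%C t
        (- (c * x * RtoC (sin t / 2)) * (/ (1 + c * x * vv t) * / (1 + c * x * vv t)))%C).
      { eapply Cder_eq; [apply (Cder_inv (fun t => 1 + c * x * vv t)%C); [exact N | cder] |].
        cbv beta; ring. }
      eapply Cder_eq; [cder |]; cbv beta; unfold X.
      set (S := RtoC (sin t / 2)) in *.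
      transitivity (/ 2 * (1 - 2 * vv t) * / (1 + c * x * vv t)
        - c * x * (S * S) * (/ (1 + c * x * vv t) * / (1 + c * x * vv t)))%C; [ring |].
      rewrite S2; unfold ph; field; exact N. }
  assert (CG : Ccont (G tau)) by (unfold G; fold x; fold s; ccont).
  assert (L : CI (fun t => (1 + c * x) * G tau t + c * s * / 2 * / (1 + c * x * vv t))%C
    = (c * s * CI X)%C).
  { rewrite <- CI_scal by exact CX; apply CI_ext; intros t; unfold G, X; fold x; fold s.
    field; exact (Hc tau t). }
  rewrite CI_lin2, EX in L by assumption.
  assert (L' : (RtoC (/ PI) * ((1 + c * x) * CI (G tau)
      + c * s * / 2 * CI (fun t => / (1 + c * x * vv t))) = 0)%C)
    by (rewrite L; ring).
  change (psi c tau) with (RtoC (/ PI) * CI (fun t => / (1 + c * x * vv t)))%C.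
  set (I1 := CI (G tau)) in *; set (I2 := CI (fun t => / (1 + c * x * vv t))%C) in *.
  transitivity (RtoC (/ PI) * ((1 + c * x) * I1 + c * s * / 2 * I2)
    - c * s * / 2 * (RtoC (/ PI) * I2))%C; [ring | rewrite L'; ring].
Qed.

Lemma psi_sqr c : (forall tau t, (1 + c * vv tau * vv t)%C <> 0%C) ->
  (psi c PI * psi c PI * (1 + c) = 1)%C.
Proof.
intros Hc.
assert (E : (psi c 0 * psi c 0 * (1 + c * vv 0) = psi c PI * psi c PI * (1 + c * vv PI))%C).
{ apply (Cder_zero_const (fun tau => psi c tau * psi c tau * (1 + c * vv tau))%C);
    [apply PI_RGT_0 |].
  intros tau; destruct (Cder_psi c Hc tau) as (d & D & Ed); assert (V := Cder_vv tau).
  eapply Cder_eq; [cder |]; cbv beta.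
  set (p := psi c tau) in *; set (s := RtoC (sin tau / 2)) in *.
  transitivity (2 * p * ((1 + c * vv tau) * d) + p * p * (c * s))%C; [ring |].
  rewrite Ed; field. }
rewrite psi_0, vv_0, vv_PI in E.
transitivity (psi c PI * psi c PI * (1 + c * 1))%C; [ring | rewrite <- E; ring].
Qed.

Lemma Cisqrt_1 : Cisqrt 1 = 1%C.
Proof.
unfold Cisqrt; rewrite (Csqrt_unique 1 1); [field | simpl; lra | ring].
Qed.

(** [psi_sqr] leaves a sign open for each factor. The product is determined, by following it from
    tau = 0 while its radicand stays in the right half-plane. *)
Lemma psi_mult c1 c2 :
  (forall tau t, (1 + c1 * vv tau * vv t)%C <> 0%C) ->
  (forall tau t, (1 + c2 * vv tau * vv t)%C <> 0%C) ->
  (forall tau, 0 < Re ((1 + c1 * vv tau) * (1 + c2 * vv tau))%C) ->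
  (psi c1 PI * psi c2 PI = Cisqrt ((1 + c1) * (1 + c2)))%C.
Proof.
intros H1 H2 Hre.
set (Y := fun tau => Cisqrt ((1 + c1 * vv tau) * (1 + c2 * vv tau))%C).
(* [Y] times the radicand is the square root of the radicand, so F has derivative 0. *)
set (F := fun tau => (psi c1 tau * psi c2 tau
    * (Y tau * ((1 + c1 * vv tau) * (1 + c2 * vv tau))))%C).
assert (S2 : forall tau, (Y tau * Y tau * ((1 + c1 * vv tau) * (1 + c2 * vv tau)) = 1)%C)
  by (intros tau; apply Cisqrt_sqr, Hre).
assert (E : F 0 = F PI).
{ apply Cder_zero_const; [apply PI_RGT_0 |].
  intros tau; destruct (Cder_psi c1 H1 tau) as (d1 & D1 & E1).
  destruct (Cder_psi c2 H2 tau) as (d2 & D2 & E2); assert (V := Cder_vv tau).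
  set (s := RtoC (sin tau / 2)) in *.
  assert (DQ : Cder (fun tau => (1 + c1 * vv tau) * (1 + c2 * vv tau))%C tau
    (c1 * s * (1 + c2 * vv tau) + (1 + c1 * vv tau) * (c2 * s))%C)
    by (eapply Cder_eq; [cder | cbv beta; ring]).
  assert (DY := Cder_Cisqrt _ _ _ (Hre tau) DQ).
  eapply Cder_eq;
    [exact (Cder_mult _ _ _ _ _ (Cder_mult _ _ _ _ _ D1 D2) (Cder_mult _ _ _ _ _ DY DQ)) |].
  cbv beta; change (Cisqrt ((1 + c1 * vv tau) * (1 + c2 * vv tau))) with (Y tau).
  specialize (S2 tau).
  set (y := Y tau) in *; set (p1 := psi c1 tau) in *; set (p2 := psi c2 tau) in *.
  set (f1 := (1 + c1 * vv tau)%C) in *; set (f2 := (1 + c2 * vv tau)%C) in *.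
  rewrite RtoC_opp, RtoC_inv by lra.
  transitivity ((f1 * d1) * p2 * y * f2 + p1 * (f2 * d2) * y * f1
    + p1 * p2 * s * (c1 * f2 + c2 * f1) * y * (1 - / 2 * (y * y * (f1 * f2))))%C; [field |].
  rewrite E1, E2, S2; field. }
unfold F in E; rewrite !psi_0, vv_0 in E.
assert (Y0 : Y 0 = 1%C).
{ unfold Y; rewrite vv_0.
  replace ((1 + c1 * 0) * (1 + c2 * 0))%C with (RtoC 1) by ring; exact Cisqrt_1. }
rewrite Y0 in E.
assert (SP := S2 PI).
assert (YP : Y PI = Cisqrt ((1 + c1) * (1 + c2))%C).
{ unfold Y; rewrite vv_PI; f_equal; ring. }
rewrite <- YP.
transitivity (psi c1 PI * psi c2 PI * (Y PI * Y PI * ((1 + c1 * vv PI) * (1 + c2 * vv PI))))%C;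
  [rewrite SP; ring |].
transitivity (Y PI * (psi c1 PI * psi c2 PI * (Y PI * ((1 + c1 * vv PI) * (1 + c2 * vv PI)))))%C;
  [ring |].
rewrite <- E; ring.
Qed.

Lemma pp_1 u : -1 < u < 1 -> dom u 1 /\ pp u 1 = 1 - u.
Proof.
intros Hu; unfold dom, pp; replace ((1 + u) ^ 2 - 4 * u * 1 ^ 2) with (Rsqr (1 - u))
  by (unfold Rsqr; ring).
split; [apply Rlt_0_sqr; lra | apply sqrt_Rsqr; lra].
Qed.

Lemma root_u_Re_zeta u s : root_u u s -> -1 < u < 1 -> Rabs (2 * Re s) < 1.
Proof.
intros Hs Hu; destruct (root_u_cases u s Hs) as [[_ H] | [H _]].
- apply Rabs_lt_between; split; nra.
- rewrite H, Rmult_0_r, Rabs_R0; lra.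
Qed.

(* At y = 1 the quartic under the root is the square of this quadratic (up to
   a constant). *)
Definition Qd (u : R) (s v : C) : C :=
  ((1 - v) * (1 - u ^ 2 * v) + v * ((1 + 2 * s) ^ 2 * (1 - u)))%C.

Lemma Re_real_combination a b (z1 z2 : C) :
  Re (RtoC a * z1 + RtoC b * z2)%C = a * Re z1 + b * Re z2.
Proof. unfold Re; simpl; ring. Qed.

(** At y = 1, G is the square of (1 - 2s) Qd, and the second inequality selects (1 - 2s) Qd as the
    principal root. The first gives the nonvanishing of Qd and the branch required by [psi_mult]. *)
Lemma Qd_Re_pos u s x : root_u u s -> -1 < u < 1 -> 0 <= x <= 1 ->
  0 < Re (Qd u s x) /\ 0 < Re ((1 - 2 * s) * Qd u s x)%C.
Proof.
intros Hs Hu Hx.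
assert (B := root_u_Re_zeta u s Hs Hu); apply Rabs_lt_between in B.
set (a := (1 - x) * (1 - u ^ 2 * x)).
assert (Pu : u ^ 2 < 1) by nra.
assert (P2 : 0 < 1 - u ^ 2 * x) by nra.
assert (Pa : 0 <= a) by (unfold a; apply Rmult_le_pos; lra).
assert (Pab : 0 < a \/ 0 < x).
{ destruct (Req_dec x 0) as [-> | ]; [left; unfold a; lra | right; lra]. }
assert (E1 : Qd u s x = (RtoC a * 1 + RtoC (x * (1 - u)) * ((1 + 2 * s) * (1 + 2 * s)))%C).
{ unfold Qd, a; rewrite !RtoC_mult, !RtoC_minus, RtoC_mult, RtoC_pow; ring. }
(* Since (1 - 2s)(1 + 2s) = 1 + u is real, this too is a nonnegative real combination of numbers
   with positive real part. *)
assert (E2 : ((1 - 2 * s) * Qd u s x = RtoC a * (1 - 2 * s)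
    + RtoC (x * (1 - u) * (1 + u)) * (1 + 2 * s))%C).
{ unfold Qd, a; rewrite !RtoC_mult, !RtoC_minus, RtoC_plus, RtoC_mult, RtoC_pow.
  replace (RtoC u) with (- (4 * s * s))%C by (rewrite Hs; ring); ring. }
rewrite E2, E1, !Re_real_combination.
assert (S : 0 < Re ((1 + 2 * s) * (1 + 2 * s))%C).
{ destruct (root_u_cases u s Hs) as [[H _] | [H H']]; destruct s as [p q]; simpl in *; subst.
  - assert (0 < (1 + 2 * p) * (1 + 2 * p)) by nra; lra.
  - lra. }
assert (T1 : 0 < Re (1 - 2 * s)%C) by (destruct s; simpl in *; lra).
assert (T2 : 0 < Re (1 + 2 * s)%C) by (destruct s; simpl in *; lra).
assert (W : forall c d : R, 0 < c -> 0 < d -> 0 < a * c + x * d).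
{ intros c d Hc Hd; destruct Pab as [P | P].
  - apply Rplus_lt_le_0_compat; [now apply Rmult_lt_0_compat | apply Rmult_le_pos; lra].
  - apply Rplus_le_lt_0_compat; [apply Rmult_le_pos; lra | now apply Rmult_lt_0_compat]. }
split.
- rewrite Rmult_assoc; apply W; [simpl; lra | apply Rmult_lt_0_compat; lra].
- rewrite !Rmult_assoc; apply W; [exact T1 |].
  repeat apply Rmult_lt_0_compat; lra.
Qed.

Lemma vv_mult tau t : exists x, 0 <= x <= 1 /\ (vv tau * vv t)%C = RtoC x.
Proof.
exists ((1 - cos tau) / 2 * ((1 - cos t) / 2)).
assert (H1 := vv_range tau); assert (H2 := vv_range t).
split; [nra | unfold vv; now rewrite RtoC_mult].
Qed.

Lemma hh_1 u s r : root_u u s -> -1 < u < 1 ->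
  hh u s r 1 = ((1 + 2 * s) * (RtoC (/ PI) * CI (fun t => Nh u r (vv t) * / Qd u s (vv t))))%C.
Proof.
intros Hs Hu; destruct (pp_1 u Hu) as [Hd Hp].
assert (B := root_u_Re_zeta u s Hs Hu); apply Rabs_lt_between in B.
assert (N1 : (1 - 2 * s)%C <> 0%C).
{ intros E; apply (f_equal Re) in E; destruct s; simpl in *; lra. }
assert (Eu : RtoC u = (- (4 * s * s))%C) by (rewrite Hs; ring).
assert (V := Ccont_vv).
assert (NQ : forall t, Qd u s (vv t) <> 0%C).
{ intros t E; destruct (Qd_Re_pos u s _ Hs Hu (vv_range t)) as [P _].
  unfold vv in E; rewrite E in P; simpl in P; lra. }
assert (K : Ccont (fun t => / Qd u s (vv t))%C).
{ apply (Ccont2_slice (fun _ t => / Qd u s (vv t))%C 0); intros t.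
  apply Ccont2_inv; [apply NQ |]; assert (V2 := Ccont2_vv 0 t).
  unfold Qd; simpl Cpow; ccont2. }
assert (Q : forall t, QQ u s 1 t = (/ (1 - 2 * s) * / Qd u s (vv t))%C).
{ intros t; destruct (Qd_Re_pos u s _ Hs Hu (vv_range t)) as [_ P].
  fold (vv t) in P; unfold QQ, Cisqrt; rewrite (Csqrt_unique _ ((1 - 2 * s) * Qd u s (vv t))%C).
  - field; split; [apply NQ | exact N1].
  - exact P.
  - unfold GG, Gp, ww, av, bv, Qd; rewrite Hp, RtoC_minus, Eu; ring. }
unfold hh; rewrite (CI_ext _ (fun t => / (1 - 2 * s) * (Nh u r (vv t) * / Qd u s (vv t)))%C).
- rewrite CI_scal by (unfold Nh; ccont).
  unfold Rdiv; rewrite RtoC_mult, RtoC_plus, Eu; field; exact N1.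
- intros t; unfold Fh; rewrite Q; ring.
Qed.

Lemma CI_partial_fractions (c1 c2 n : C) :
  (forall tau t, (1 + c1 * vv tau * vv t)%C <> 0%C) ->
  (forall tau t, (1 + c2 * vv tau * vv t)%C <> 0%C) ->
  (c1 - c2)%C <> 0%C ->
  (RtoC (/ PI) * CI (fun t => (1 + n * vv t) * / ((1 + c1 * vv t) * (1 + c2 * vv t)))
   = ((c1 - n) * psi c1 PI + (n - c2) * psi c2 PI) / (c1 - c2))%C.
Proof.
intros H1 H2 Hc; assert (V := Ccont_vv).
assert (H : forall c, (forall tau t, (1 + c * vv tau * vv t)%C <> 0%C) ->
  forall t, (1 + c * vv t)%C <> 0%C).
{ intros c Hc' t; specialize (Hc' PI t); rewrite vv_PI in Hc'.
  intros E; apply Hc'; rewrite <- E; ring. }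
assert (N1 := H c1 H1); assert (N2 := H c2 H2).
assert (K : forall c, (forall t, (1 + c * vv t)%C <> 0%C) -> Ccont (fun t => / (1 + c * vv t))%C).
{ intros c Hc'; apply (Ccont2_slice (fun _ t => / (1 + c * vv t))%C 0); intros t.
  apply Ccont2_inv; [apply Hc' |]; assert (V2 := Ccont2_vv 0 t); ccont2. }
assert (P : forall c, psi c PI = (RtoC (/ PI) * CI (fun t => / (1 + c * vv t)))%C).
{ intros c; unfold psi; f_equal; apply CI_ext; intros t; rewrite vv_PI; f_equal; ring. }
rewrite !P.
rewrite (CI_ext _ (fun t => (c1 - n) / (c1 - c2) * / (1 + c1 * vv t)
   + (n - c2) / (c1 - c2) * / (1 + c2 * vv t))%C).
- rewrite (CI_lin2 _ _ (fun t => / (1 + c1 * vv t))%C (fun t => / (1 + c2 * vv t))%C)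
    by (apply K; assumption).
  field; exact Hc.
- intros t; field; auto.
Qed.

(** Factoring Qd as (1 + c1 v)(1 + c2 v) makes each integral a combination of psi c1 and psi c2 by
    partial fractions. In the product of the two integrals the squares cancel, leaving psi c1 psi
    c2, whose branch is known. *)
Lemma RH_1 u s r : root_u u s -> (r * r = 2 * u ^ 2 - 2 * u)%C -> -1 < u < 1 -> u <> 0 ->
  RH u s r 1 = RtoC (/ sqrt (1 - u)).
Proof.
intros Hs Hr Hu Hu0.
assert (Ns := root_u_neq u s Hs Hu0); assert (Nr := root_r_neq u r Hr Hu Hu0).
assert (B := root_u_Re_zeta u s Hs Hu); apply Rabs_lt_between in B.
assert (Eu : RtoC u = (- (4 * s * s))%C) by (rewrite Hs; ring).
set (z := (2 * s)%C).
assert (Rz : 0 < Re (1 + z)%C) by (unfold z; destruct s; simpl in *; lra).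
assert (N1 : (1 + z)%C <> 0%C) by (intros E; rewrite E in Rz; simpl in Rz; lra).
assert (N2 : (1 + z * z)%C <> 0%C).
{ replace (1 + z * z)%C with (RtoC (1 - u)) by (rewrite RtoC_minus, Eu; unfold z; ring).
  apply RtoC_neq; lra. }
assert (Nz : z <> 0%C).
{ unfold z; apply Cmult_neq_0; [apply RtoC_neq; lra | exact Ns]. }
set (k := RtoC (sqrt (/ 2))).
assert (Hk : (k * k = / 2)%C).
{ unfold k; rewrite <- RtoC_mult, sqrt_sqrt by lra; apply RtoC_inv; lra. }
assert (Hrz : (r * r = 2 * (z * z) * (z * z) + 2 * (z * z))%C).
{ rewrite Hr, Eu; unfold z; ring. }
(* With u = - z^2 one has r^2 = 2 z^2 (1 + z^2), so d is a square root of the discriminant of Qd (up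
   to a factor 4), and c1, c2 = m + d, m - d. *)
set (d := (k * r * (1 + z))%C).
assert (Hd : (d * d = (z * z) * (1 + z * z) * ((1 + z) * (1 + z)))%C).
{ transitivity ((k * k) * (r * r) * ((1 + z) * (1 + z)))%C; [unfold d; ring |].
  rewrite Hk, Hrz; field. }
set (m := (z * (1 + z + z * z))%C).
set (c1 := (m + d)%C); set (c2 := (m - d)%C).
assert (EQ : forall x, ((1 + c1 * x) * (1 + c2 * x) = Qd u s x)%C).
{ intros x; transitivity (1 + 2 * m * x + (m * m - d * d) * (x * x))%C;
    [unfold c1, c2; ring |].
  rewrite Hd; unfold Qd, m; rewrite Eu; unfold z; ring. }
assert (Nx : forall x, 0 <= x <= 1 -> (1 + c1 * x)%C <> 0%C /\ (1 + c2 * x)%C <> 0%C).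
{ intros x Hx; destruct (Qd_Re_pos u s x Hs Hu Hx) as [P _]; rewrite <- EQ in P.
  split; intros E; rewrite E in P; simpl in P; lra. }
assert (H1 : forall tau t, (1 + c1 * vv tau * vv t)%C <> 0%C).
{ intros tau t; destruct (vv_mult tau t) as (x & Hx & E).
  rewrite <- Cmult_assoc, E; apply Nx, Hx. }
assert (H2 : forall tau t, (1 + c2 * vv tau * vv t)%C <> 0%C).
{ intros tau t; destruct (vv_mult tau t) as (x & Hx & E).
  rewrite <- Cmult_assoc, E; apply Nx, Hx. }
assert (H3 : forall tau, 0 < Re ((1 + c1 * vv tau) * (1 + c2 * vv tau))%C).
{ intros tau; rewrite EQ; apply (Qd_Re_pos u s _ Hs Hu (vv_range tau)). }
assert (Nc : (c1 - c2)%C <> 0%C).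
{ replace (c1 - c2)%C with (2 * d)%C by (unfold c1, c2; ring).
  apply Cmult_neq_0; [apply RtoC_neq; lra |]; apply Ceq_0_sqr_neq; rewrite Hd.
  exact (Cmult_neq_0 _ _ (Cmult_neq_0 _ _ (Cmult_neq_0 _ _ Nz Nz) N2) (Cmult_neq_0 _ _ N1 N1)). }
assert (J : forall n, (RtoC (/ PI) * CI (fun t => (1 + n * vv t) * / Qd u s (vv t))
   = ((c1 - n) * psi c1 PI + (n - c2) * psi c2 PI) / (c1 - c2))%C).
{ intros n; rewrite <- CI_partial_fractions by assumption.
  f_equal; apply CI_ext; intros t; now rewrite EQ. }
assert (hJ : forall r, hh u s r 1 = ((1 + z) * (((c1 - (z * z + r)) * psi c1 PI
    + (z * z + r - c2) * psi c2 PI) / (c1 - c2)))%C).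
{ intros r0; rewrite hh_1, <- J by assumption; unfold z; do 2 f_equal.
  apply CI_ext; intros t; unfold Nh; rewrite Eu; ring. }
assert (S1 := psi_sqr c1 H1); assert (S2 := psi_sqr c2 H2).
assert (S3 := psi_mult c1 c2 H1 H2 H3).
set (q := sqrt (1 - u)) in *.
assert (Pq : 0 < q) by (apply sqrt_lt_R0; lra).
assert (Qq : (RtoC q * RtoC q = 1 + z * z)%C).
{ unfold q; rewrite <- RtoC_mult, sqrt_sqrt, RtoC_minus, Eu by lra; unfold z; ring. }
assert (Nq : RtoC q <> 0%C) by (apply RtoC_neq; lra).
assert (E12 : ((1 + c1) * (1 + c2) = (1 + z) * (1 + z) * (1 + z * z))%C).
{ transitivity (Qd u s 1); [rewrite <- EQ; ring |]; unfold Qd; rewrite Eu; unfold z; ring. }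
(* (1 + z) q squares to (1 + c1)(1 + c2) and has positive real part, so it is the principal root. *)
assert (S3' : (psi c1 PI * psi c2 PI = / ((1 + z) * q))%C).
{ rewrite S3, E12; unfold Cisqrt; f_equal; apply Csqrt_unique.
  - replace (Re ((1 + z) * q)%C) with (Re (1 + z)%C * q) by (unfold Re; simpl; ring).
    now apply Rmult_lt_0_compat.
  - rewrite <- Qq; ring. }
unfold RH; rewrite !hJ, RtoC_inv by lra.
set (e1 := psi c1 PI) in *; set (e2 := psi c2 PI) in *.
set (P := ((1 + z) * (1 + z) * (1 + z * z))%C) in *.
assert (NP : P <> 0%C) by exact (Cmult_neq_0 _ _ (Cmult_neq_0 _ _ N1 N1) N2).
assert (E1' : (e1 * e1 = (1 + c2) / P)%C).
{ transitivity (e1 * e1 * (1 + c1) * (1 + c2) / P)%C;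
    [rewrite <- Cmult_assoc, E12; field; exact NP | rewrite S1; field; exact NP]. }
assert (E2' : (e2 * e2 = (1 + c1) / P)%C).
{ transitivity (e2 * e2 * (1 + c2) * (1 + c1) / P)%C;
    [rewrite <- Cmult_assoc, (Cmult_comm (1 + c2)), E12; field; exact NP
    | rewrite S2; field; exact NP]. }
set (n1 := (z * z + r)%C); set (n2 := (z * z + - r)%C).
transitivity ((1 + z) * (1 + z) / ((c1 - c2) * (c1 - c2))
  * ((c1 - n1) * (c1 - n2) * (e1 * e1) + (n1 - c2) * (n2 - c2) * (e2 * e2)
     + ((c1 - n1) * (n2 - c2) + (n1 - c2) * (c1 - n2)) * (e1 * e2)))%C;
  [field; exact Nc |].
rewrite E1', E2', S3'.
assert (Hdd : ((c1 - c2) * (c1 - c2) = 4 * (z * z * (1 + z * z) * ((1 + z) * (1 + z))))%C).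
{ rewrite <- Hd; unfold c1, c2; ring. }
(* The contributions of the squares cancel, so the undetermined signs of psi c1 and psi c2 do not
   enter. *)
assert (X1 : ((c1 - n1) * (c1 - n2) * (1 + c2) + (n1 - c2) * (n2 - c2) * (1 + c1) = 0)%C).
{ unfold c1, c2, n1, n2, m; ring [Hd Hrz]. }
assert (X2 : ((c1 - n1) * (n2 - c2) + (n1 - c2) * (c1 - n2)
   = 4 * (z * z) * (1 + z) * (1 + z * z))%C).
{ unfold c1, c2, n1, n2, m; ring [Hd Hrz]. }
rewrite X2, Hdd.
transitivity ((1 + z) * (1 + z) / (4 * (z * z * (1 + z * z) * ((1 + z) * (1 + z))))
  * (((c1 - n1) * (c1 - n2) * (1 + c2) + (n1 - c2) * (n2 - c2) * (1 + c1)) / P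
     + 4 * (z * z) * (1 + z) * (1 + z * z) * / ((1 + z) * q)))%C;
  [field; tauto | rewrite X1; field; tauto].
Qed.

(** * The improper integrals *)

(** Inverse on [0, 1] of the substitution v = (1 - cos t) / 2. *)
Definition theta (v : R) : R := acos (1 - 2 * v).

Lemma theta_range v : 0 <= theta v <= PI.
Proof. apply acos_bound. Qed.

Lemma cos_theta v : 0 <= v <= 1 -> cos (theta v) = 1 - 2 * v.
Proof. intros H; apply cos_acos; lra. Qed.

Lemma vv_theta v : 0 <= v <= 1 -> vv (theta v) = RtoC v.
Proof. intros H; unfold vv; rewrite cos_theta by exact H; f_equal; field. Qed.

Lemma is_derive_theta v : 0 < v < 1 -> is_derive theta v (/ sqrt (v * (1 - v))).
Proof.
intros H.
assert (Hr : -1 < 1 - 2 * v < 1) by lra.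
assert (D : is_derive acos (1 - 2 * v) (-1 / sqrt (1 - (1 - 2 * v)²))).
{ apply is_derive_Reals, (derive_pt_eq_1 _ _ _ (derivable_pt_acos _ Hr)), derive_pt_acos. }
assert (P : 0 < v * (1 - v)) by nra.
replace (/ sqrt (v * (1 - v))) with (scal (- 2) (-1 / sqrt (1 - (1 - 2 * v)²))).
- apply (is_derive_comp acos (fun v => 1 - 2 * v)); [exact D |].
  auto_derive; [exact I | ring].
- replace (1 - (1 - 2 * v)²) with ((2 * 2) * (v * (1 - v))) by (unfold Rsqr; ring).
  rewrite sqrt_mult, sqrt_square by lra.
  unfold scal; simpl; unfold mult; simpl; field.
  apply Rgt_not_eq, sqrt_lt_R0, P.
Qed.

Lemma filterlim_theta_0 : filterlim theta (at_right 0) (locally 0).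
Proof.
apply filterlim_locally; intros eps.
(* The cap at 1 keeps e inside [0, PI], where cos is decreasing. *)
set (e := Rmin eps 1); assert (He : 0 < e <= 1).
{ unfold e; split; [apply Rmin_pos; [apply cond_pos | lra] | apply Rmin_r]. }
assert (Hpi := PI2_1).
assert (Hc : cos e < 1).
{ rewrite <- cos_0; apply cos_decreasing_1; lra. }
assert (Hd : 0 < Rmin ((1 - cos e) / 2) 1) by (apply Rmin_pos; lra).
exists (mkposreal _ Hd); intros v Hv Hv0; unfold ball, Hierarchy.ball in *; simpl in *.
unfold AbsRing_ball, abs, minus, plus, opp in *; simpl in *.
rewrite Ropp_0, Rplus_0_r in Hv; rewrite Rabs_pos_eq in Hv by lra.
assert (Hv1 := Rlt_le_trans _ _ _ Hv (Rmin_l _ _)).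
assert (Hv2 := Rlt_le_trans _ _ _ Hv (Rmin_r _ _)).
assert (T := theta_range v).
rewrite Ropp_0, Rplus_0_r, Rabs_pos_eq by lra.
apply Rlt_le_trans with e; [| apply Rmin_l].
apply cos_decreasing_0; try lra; rewrite cos_theta; lra.
Qed.

Lemma filterlim_theta_1 : filterlim theta (at_left 1) (locally PI).
Proof.
apply filterlim_locally; intros eps.
set (e := Rmin eps 1); assert (He : 0 < e <= 1).
{ unfold e; split; [apply Rmin_pos; [apply cond_pos | lra] | apply Rmin_r]. }
assert (Hpi := PI2_1).
assert (Hc : cos e < 1).
{ rewrite <- cos_0; apply cos_decreasing_1; lra. }
assert (Hc' : cos (PI - e) = - cos e) by (rewrite cos_minus, cos_PI, sin_PI; ring).
assert (Hd : 0 < Rmin ((1 - cos e) / 2) 1) by (apply Rmin_pos; lra).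
exists (mkposreal _ Hd); intros v Hv Hv0; unfold ball, Hierarchy.ball in *; simpl in *.
unfold AbsRing_ball, abs, minus, plus, opp in *; simpl in *.
rewrite Rabs_left in Hv by lra.
assert (Hv1 := Rlt_le_trans _ _ _ Hv (Rmin_l _ _)).
assert (Hv2 := Rlt_le_trans _ _ _ Hv (Rmin_r _ _)).
assert (T := theta_range v).
rewrite Rabs_left1 by lra.
apply Rlt_le_trans with e; [| apply Rmin_l].
assert (PI - e < theta v); [| lra].
apply cos_decreasing_0; try lra; rewrite cos_theta; lra.
Qed.

Lemma filterlim_RInt_theta (f : R -> R) : (forall t, continuous f t) ->
  filterlim (fun ab => RInt f (theta (fst ab)) (theta (snd ab)))
    (filter_prod (at_right 0) (at_left 1)) (locally (RInt f 0 PI)).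
Proof.
intros Cf.
assert (Ex : forall a b, ex_RInt f a b)
  by (intros a b; apply (ex_RInt_continuous (V := R_CompleteNormedModule)); intros t _; apply Cf).
assert (CF : forall x, continuous (RInt f 0) x).
{ intros x; apply (ex_derive_continuous (RInt f 0)); exists (f x).
  apply (is_derive_RInt f (RInt f 0) 0 x); [| apply Cf].
  apply filter_forall; intros t; apply (RInt_correct (V := R_CompleteNormedModule)), Ex. }
apply filterlim_ext with (fun ab => minus (RInt f 0 (theta (snd ab))) (RInt f 0 (theta (fst
    ab)))).
{ intros [a b]; simpl; rewrite <- (RInt_Chasles f 0 (theta a) (theta b)) by apply Ex.
  unfold minus, plus, opp; simpl; ring. }
replace (RInt f 0 PI) with (minus (RInt f 0 PI) (RInt f 0 0))
  by (rewrite RInt_point; unfold minus, plus, opp, zero; simpl; ring).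
assert (N := filterlim_opp (V := R_NormedModule) (RInt f 0 0)).
unfold minus.
refine (filterlim_comp_2 _ _ plus (G := locally (RInt f 0 PI)) (H := locally (opp (RInt f 0 0)))
    _ _ _).
- apply (filterlim_comp _ _ _ (fun ab : R * R => theta (snd ab)) (RInt f 0) _ (locally PI));
    [| exact (CF PI)].
  apply (filterlim_comp _ _ _ snd theta _ (at_left 1));
      [apply filterlim_snd | apply filterlim_theta_1].
- apply (filterlim_comp _ _ _ (fun ab : R
    * R => RInt f 0 (theta (fst ab))) opp _ (locally (RInt f 0 0)));
    [| exact N].
  apply (filterlim_comp _ _ _ (fun ab : R * R => theta (fst ab)) (RInt f 0) _ (locally 0));
      [| exact (CF 0)].
  apply (filterlim_comp _ _ _ fst theta _ (at_right 0));
      [apply filterlim_fst | apply filterlim_theta_0].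
- apply (filterlim_plus (V := R_NormedModule)).
Qed.

Lemma is_RInt_theta (f : R -> R) a b : (forall t, continuous f t) ->
  0 < a < 1 -> 0 < b < 1 ->
  is_RInt (fun v => / sqrt (v * (1 - v)) * f (theta v)) a b (RInt f (theta a) (theta b)).
Proof.
intros Cf Ha Hb.
apply (is_RInt_comp f theta (fun v => / sqrt (v * (1 - v)))).
- intros x _; apply Cf.
- intros x Hx.
  assert (Hx' : 0 < x < 1).
  { revert Hx; unfold Rmin, Rmax; destruct (Rle_dec a b); lra. }
  split; [now apply is_derive_theta |].
  assert (P : 0 < x * (1 - x)) by nra.
  apply (ex_derive_continuous (fun v => / sqrt (v * (1 - v)))); auto_derive.
  assert (S := sqrt_lt_R0 _ P).
  replace (1 + - x) with (1 - x) by ring; split; [lra | split; [lra | exact I]].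
Qed.

(** Convergence and value come together: on compact subintervals the substitution gives an integral
    of the continuous F between theta a and theta b, and these tend to 0 and PI. *)
Lemma is_RInt_gen_theta (F f : R -> C) : Ccont F ->
  (forall v, 0 < v < 1 -> f v = (RtoC (/ sqrt (v * (1 - v))) * F (theta v))%C) ->
  is_RInt_gen (V := C_R_NormedModule) f (at_right 0) (at_left 1) (CI F).
Proof.
intros CF E P HP.
set (Y := fun ab : R * R => (RInt (fun t => Re (F t)) (theta (fst ab)) (theta (snd ab)),
   RInt (fun t => Im (F t)) (theta (fst ab)) (theta (snd ab))) : C).
assert (L1 := filterlim_RInt_theta (fun t => Re (F t)) (fun t => proj1 (CF t))).
assert (L2 := filterlim_RInt_theta (fun t => Im (F t)) (fun t => proj2 (CF t))).
assert (HPY : filter_prod (at_right 0) (at_left 1) (fun ab => P (Y ab))).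
{ destruct HP as [eps HP].
  assert (M1 := proj1 (filterlim_locally _ _) L1 eps).
  assert (M2 := proj1 (filterlim_locally _ _) L2 eps).
  generalize (filter_and _ _ M1 M2); apply filter_imp; intros ab [B1 B2].
  apply HP; split; assumption. }
assert (R01 : filter_prod (at_right 0) (at_left 1)
  (fun ab : R * R => 0 < fst ab < 1 /\ 0 < snd ab < 1)).
{ apply Filter_prod with (fun a => 0 < a < 1) (fun b => 0 < b < 1).
  - exists (mkposreal 1 Rlt_0_1); intros a Ha Ha0; split; [exact Ha0 |].
    apply Rabs_lt_between' in Ha; simpl in Ha; lra.
  - exists (mkposreal 1 Rlt_0_1); intros a Ha Ha0; split; [| exact Ha0].
    apply Rabs_lt_between' in Ha; simpl in Ha; lra.
  - intros a b Ha Hb; split; assumption. }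
unfold filtermapi; generalize (filter_and _ _ HPY R01); apply filter_imp;
    intros [a b] [HY [Ha Hb]].
exists (Y (a, b)); split; [| exact HY]; simpl in *.
assert (In : forall v, Rmin a b < v < Rmax a b -> 0 < v < 1).
{ intros v; unfold Rmin, Rmax; destruct (Rle_dec a b); lra. }
apply (is_RInt_fct_extend_pair (U := R_NormedModule) (V := R_NormedModule)).
- apply is_RInt_ext with (2 := is_RInt_theta (fun t => Re (F t)) a b (fun t => proj1 (CF t)) Ha
    Hb).
  intros v Hv; rewrite E by now apply In.
  symmetry; apply re_scal_l.
- apply is_RInt_ext with (2 := is_RInt_theta (fun t => Im (F t)) a b (fun t => proj2 (CF t)) Ha
    Hb).
  intros v Hv; rewrite E by now apply In.
  symmetry; apply im_scal_l.
Qed.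

(** * Comparison of the two solutions *)

(** Differentiability at the singular point supplies the second initial value: for y = 1 the factor
    w^2 + 4u vanishes, and the equation for h' becomes a linear relation between j and h. *)
Lemma RA_1 u s r : root_u u s -> (r * r = 2 * u ^ 2 - 2 * u)%C -> -1 < u < 1 -> u <> 0 ->
  ((1 - u) * RA u s r 1 = RH u s r 1)%C.
Proof.
intros Hs Hr Hu Hu0; destruct (pp_1 u Hu) as [Hd Hp].
assert (Hr' : (- r * - r = 2 * u ^ 2 - 2 * u)%C) by (rewrite <- Hr; ring).
destruct (hj_system u s r 1 Hs Hr Hu Hd) as (d1 & _ & _ & _ & Q1 & _).
destruct (hj_system u s (- r)%C 1 Hs Hr' Hu Hd) as (d2 & _ & _ & _ & Q2 & _).
assert (Ns := root_u_neq u s Hs Hu0).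
assert (Eu : RtoC u = (- (4 * s * s))%C) by (rewrite Hs; ring).
assert (U1 : (1 - u)%C <> 0%C) by (rewrite <- RtoC_minus; apply RtoC_neq; lra).
assert (U2 : (1 + u)%C <> 0%C) by (rewrite <- RtoC_plus; apply RtoC_neq; lra).
unfold RA, RH; rewrite Hp in *; unfold ww in *.
rewrite RtoC_inv, RtoC_mult, RtoC_minus by nra.
rewrite RtoC_minus in Q1, Q2.
set (h1 := hh u s r 1) in *; set (h2 := hh u s (- r) 1) in *.
set (j1 := jj u s r 1) in *; set (j2 := jj u s (- r) 1) in *.
set (w := (4 * 1 * s)%C) in *.
assert (Hw : (w ^ 2 + 4 * u = 0)%C) by (unfold w; rewrite Eu; ring).
rewrite Hw in Q1, Q2.
assert (K : forall d X : C, (0 * (1 - u) * d = 4 * s * X)%C -> (X = 0)%C).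
{ intros d X HX; transitivity (4 * s * X / (4 * s))%C; [field; exact Ns |].
  rewrite <- HX; field; exact Ns. }
apply K in Q1; apply K in Q2.
assert (R1 : ((w - r) * j1 = / 2 * (1 + u) * (w * (1 - u) - r) * h1)%C).
{ transitivity ((w - r) * j1 - (1 + u) * 0)%C; [ring | rewrite <- Q1; field; tauto]. }
assert (R2 : ((w + r) * j2 = / 2 * (1 + u) * (w * (1 - u) + r) * h2)%C).
{ transitivity ((w + r) * j2 - (1 + u) * 0)%C; [ring | rewrite <- Q2; field; tauto]. }
assert (Hw' : (w * w = - (4 * u))%C).
{ transitivity (w ^ 2 + 4 * u - 4 * u)%C; [simpl; ring | rewrite Hw; ring]. }
assert (Hn : ((w - r) * (w + r) = - (2 * u * (1 + u)))%C) by ring [Hw' Hr].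
(* Hence the two relations can be solved for j1 and j2. *)
assert (Nn : ((w - r) * (w + r))%C <> 0%C).
{ rewrite Hn, <- RtoC_plus, <- !RtoC_mult, <- RtoC_opp; apply RtoC_neq.
  apply Ropp_neq_0_compat; repeat apply Rmult_integral_contrapositive_currified; lra. }
transitivity (((w + r) * ((w - r) * j1) * h2 + (w - r) * ((w + r) * j2) * h1)
  / ((1 - u) * ((w - r) * (w + r))))%C.
{ assert (N1 : (w - r)%C <> 0%C) by (intros E; apply Nn; rewrite E; ring).
  assert (N2 : (w + r)%C <> 0%C) by (intros E; apply Nn; rewrite E; ring).
  field; tauto. }
rewrite R1, R2, Hn.
assert (Nu : RtoC u <> 0%C) by now apply RtoC_neq.
transitivity ((1 + u) * (w * w * (1 - u) - r * r) * (h1 * h2)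
    / ((1 - u) * (- (2 * u * (1 + u)))))%C;
  [field; tauto |].
rewrite Hw', Hr; field; tauto.
Qed.

Lemma sys_minus u y H A E K dH dA dE dK H' A' E' K' dH' dA' dE' dK' :
  sys u y H A E K dH dA dE dK -> sys u y H' A' E' K' dH' dA' dE' dK' ->
  sys u y (H - H') (A - A') (E - E') (K - K') (dH - dH') (dA - dA') (dE - dE') (dK - dK').
Proof.
intros (S1 & S2 & S3 & S4) (T1 & T2 & T3 & T4); unfold sys.
repeat split.
- rewrite Rmult_minus_distr_l, S1, T1; ring.
- transitivity ((1 - y ^ 2) * (((1 + u) ^ 2 - 4 * u * y ^ 2) * dA - 4 * u * y * A)
    - (1 - y ^ 2) * (((1 + u) ^ 2 - 4 * u * y ^ 2) * dA' - 4 * u * y * A')); [ring |].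
  rewrite S2, T2; field.
- rewrite Rmult_minus_distr_l, S3, T3; ring.
- rewrite Rmult_minus_distr_l, S4, T4; ring.
Qed.

(** For z > 0 the worst case is |y| = (rho + 1/rho)/2, where the expression factors as (1 - u
    rho^2)(1 - u / rho^2) with u = 4z. *)
Lemma in_range_dom z rho y : in_range z rho y -> dom (4 * z) y.
Proof.
intros (H1 & H2 & H3); unfold dom.
assert (Hi : 0 < / rho <= 1).
{ split; [apply Rinv_0_lt_compat; lra |].
  rewrite <- Rinv_1; apply Rinv_le_contravar; lra. }
assert (E : rho * / rho = 1) by (field; lra).
assert (Hy : y ^ 2 <= ((rho + / rho) / 2) ^ 2) by now apply pow_maj_Rabs.
assert (Hz := Rle_abs z); set (q := / rho) in *.
assert (Hq : q ^ 2 <= 1) by nra.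
destruct (Rle_lt_dec z 0) as [Z | Z].
- assert (Hz' := Rle_abs (- z)); rewrite Rabs_Ropp in Hz'.
  assert (0 <= y ^ 2) by apply pow2_ge_0.
  assert (0 < (1 + 4 * z) ^ 2) by (apply pow_lt; nra); nra.
- rewrite Rabs_pos_eq in H3 by lra.
  assert (Hr : 1 <= rho ^ 2) by nra.
  assert (P : 0 < (1 - 4 * z * rho ^ 2) * (1 - 4 * z * q ^ 2)).
  { apply Rmult_lt_0_compat; [lra |].
    assert (z * q ^ 2 <= z * rho ^ 2) by (apply Rmult_le_compat_l; lra); lra. }
  assert (Q : rho ^ 2 * q ^ 2 = 1) by (rewrite <- Rpow_mult_distr, E; ring).
  assert (P2 : (1 - 4 * z * rho ^ 2) * (1 - 4 * z * q ^ 2)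
     = (1 + 4 * z) ^ 2 - 4 * (4 * z) * ((rho + q) / 2) ^ 2).
  { transitivity (1 - 4 * z * rho ^ 2 - 4 * z * q ^ 2 + 16 * z ^ 2 * (rho ^ 2 * q ^ 2)); [ring |].
    rewrite Q; transitivity ((1 + 4 * z) ^ 2 - 4 * z * (rho ^ 2 + q ^ 2 + 2 * 1)); [ring |].
    rewrite <- E; field. }
  nra.
Qed.

Lemma in_range_abs z rho y : in_range z rho y -> 4 * Rabs z < 1.
Proof.
intros (H1 & _ & H3); assert (H0 := Rabs_pos z); nra.
Qed.

(** The series are differentiated only at interior points, and the path must include y = 1 even when
    rho = 1; the strict bound on z leaves room for a larger rho. *)
Lemma in_range_enlarge z rho y : in_range z rho y ->
  exists rho', in_range z rho' y /\ Rabs y < (rho' + / rho') / 2 /\ 1 < (rho' + / rho') / 2.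
Proof.
intros (H1 & H2 & H3); assert (H0 := Rabs_pos z).
set (d := 1 - 4 * Rabs z * rho ^ 2) in *.
assert (D : 0 < d <= 1) by (unfold d; nra).
(* The new product is (1 - d)(1 + d/4)^2, which is below 1 for 0 < d <= 1. *)
exists (rho * (1 + d / 4)).
assert (R1 : rho < rho * (1 + d / 4)) by nra.
assert (M : rho + / rho < rho * (1 + d / 4) + / (rho * (1 + d / 4))).
{ set (r := rho * (1 + d / 4)) in *.
  apply Rmult_lt_reg_r with (rho * r); [nra |].
  replace ((rho + / rho) * (rho * r)) with (rho * rho * r + r) by (field; lra).
  replace ((r + / r) * (rho * r)) with (rho * r * r + rho) by (field; lra).
  assert (0 < (r - rho) * (rho * r - 1)) by (apply Rmult_lt_0_compat; nra).
  nra. }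
assert (N : 2 <= rho + / rho).
{ apply Rmult_le_reg_r with rho; [lra |].
  replace ((rho + / rho) * rho) with (rho * rho + 1) by (field; lra).
  assert (0 <= (rho - 1) ^ 2) by apply pow2_ge_0; nra. }
split; [| lra].
unfold in_range; split; [lra | split; [lra |]].
replace (4 * Rabs z * (rho * (1 + d / 4)) ^ 2) with ((1 - d) * (1 + d / 4) ^ 2)
  by (unfold d; ring).
nra.
Qed.

Lemma in_range_le z rho y y' : in_range z rho y -> Rabs y' <= (rho + / rho) / 2
    -> in_range z rho y'.
Proof. intros (H1 & _ & H3) H; repeat split; assumption. Qed.

(** With y >= 0 the segment from 1 to y avoids the other singular point -1. Real and imaginary parts
    are compared separately: the difference with the series, and the imaginary part itself, both
    start from zero data. *)
Lemma al_RH z rho y s r : in_range z rho y -> z <> 0 -> 0 <= y ->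
  root_u (4 * z) s -> (r * r = 2 * (4 * z)%R ^ 2 - 2 * (4 * z)%R)%C ->
  RtoC (al z 0 y) = RH (4 * z) s r y.
Proof.
intros Hy Hz Hy0 Hs Hr.
destruct (in_range_enlarge z rho y Hy) as (rho' & Hr' & L1 & L2).
assert (Hz4 := in_range_abs z rho y Hy).
assert (Hu : -1 < 4 * z < 1).
{ apply Rabs_lt_between; rewrite Rabs_mult, (Rabs_pos_eq 4); lra. }
set (u := 4 * z) in *.
assert (Hu0 : u <> 0) by (unfold u; lra).
rewrite Rabs_pos_eq in L1 by exact Hy0.
assert (In : forall t, Rmin 1 y <= t <= Rmax 1 y ->
  in_range z rho' t /\ Rabs t < (rho' + / rho') / 2 /\ dom u t).
{ intros t Ht.
  assert (0 <= t < (rho' + / rho') / 2).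
  { revert Ht; unfold Rmin, Rmax; destruct (Rle_dec 1 y); lra. }
  assert (It : in_range z rho' t) by (apply (in_range_le z rho' y t Hr'); rewrite Rabs_pos_eq;
      lra).
  split; [exact It |]; split; [rewrite Rabs_pos_eq; lra | exact (in_range_dom _ _ _ It)]. }
assert (A1 := al_0_1 z Hz4); assert (F1 := FA_1 z Hz4); fold u in A1, F1.
assert (R1 := RH_1 u s r Hs Hr Hu Hu0); assert (RA1 := RA_1 u s r Hs Hr Hu Hu0).
assert (Sq : 0 < sqrt (1 - u)) by (apply sqrt_lt_R0; lra).
assert (Ea : al z 0 1 = / sqrt (1 - u)).
{ apply Rmult_eq_reg_r with (sqrt (1 - u)); [rewrite A1; field |]; lra. }
rewrite <- Ea in R1; rewrite R1 in RA1; clear A1 Ea Sq.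
assert (FA1 : RA u s r 1 = RtoC (FA z 1)).
{ assert (U1 : (1 - u)%C <> 0%C) by (rewrite <- RtoC_minus; apply RtoC_neq; lra).
  transitivity ((1 - u) * RA u s r 1 / (1 - u))%C; [field; exact U1 |].
  rewrite RA1, <- F1, RtoC_mult, RtoC_minus; field; exact U1. }
assert (Sys : forall t, Rmin 1 y <= t <= Rmax 1 y -> dom u t /\
  exists dH dA dE dK dH' dA' dE' dK',
    (is_derive (al z 0) t dH /\ is_derive (FA z) t dA /\ is_derive (FE z) t dE /\
     is_derive (FK z) t dK /\ sys u t (al z 0 t) (FA z t) (FE z t) (FK z t) dH dA dE dK) /\
    (Cder (RH u s r) t dH' /\ Cder (RA u s r) t dA' /\ Cder (RE u s r) t dE' /\
     Cder (RK u s r) t dK' /\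
     csys u t (RH u s r t) (RA u s r t) (RE u s r t) (RK u s r t) dH' dA' dE' dK')).
{ intros t Ht; destruct (In t Ht) as (I1 & I2 & I3); split; [exact I3 |].
  destruct (F_system z rho' t I1 I2) as (dH & dA & dE & dK & S); [fold u; lra |].
  destruct (R_system u s r t Hs Hr Hu Hu0 I3) as (dH' & dA' & dE' & dK' & S').
  exists dH, dA, dE, dK, dH', dA', dE', dK'; split; assumption. }
assert (Re0 : al z 0 y - Re (RH u s r y) = 0).
{ apply (sys_unique u y (fun t => al z 0 t - Re (RH u s r t)) (fun t => FA z t - Re (RA u s r t))
    (fun t => FE z t - Re (RE u s r t)) (fun t => FK z t - Re (RK u s r t)) Hu Hy0).
  - intros t Ht; destruct (Sys t Ht) as (I3 & dH & dA & dE & dK & dH' & dA' & dE' & dK' &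
      (D1 & D2 & D3 & D4 & S) & (D1' & D2' & D3' & D4' & S')).
    split; [exact I3 |].
    exists (dH - Re dH'), (dA - Re dA'), (dE - Re dE'), (dK - Re dK').
    split; [exact (is_derive_minus _ _ _ _ _ D1 (proj1 D1')) |].
    split; [exact (is_derive_minus _ _ _ _ _ D2 (proj1 D2')) |].
    split; [exact (is_derive_minus _ _ _ _ _ D3 (proj1 D3')) |].
    split; [exact (is_derive_minus _ _ _ _ _ D4 (proj1 D4')) |].
    apply sys_minus; [exact S |]; exact (proj1 (csys_Re_Im _ _ _ _ _ _ _ _ _ _ S')).
  - rewrite R1; simpl; ring.
  - rewrite FA1; simpl; ring. }
assert (Im0 : Im (RH u s r y) = 0).
{ apply (sys_unique u y (fun t => Im (RH u s r t)) (fun t => Im (RA u s r t))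
    (fun t => Im (RE u s r t)) (fun t => Im (RK u s r t)) Hu Hy0).
  - intros t Ht; destruct (Sys t Ht) as (I3 & dH & dA & dE & dK & dH' & dA' & dE' & dK' &
      _ & (D1' & D2' & D3' & D4' & S')).
    split; [exact I3 |].
    exists (Im dH'), (Im dA'), (Im dE'), (Im dK').
    split; [exact (proj2 D1') |]; split; [exact (proj2 D2') |].
    split; [exact (proj2 D3') |]; split; [exact (proj2 D4') |].
    exact (proj2 (csys_Re_Im _ _ _ _ _ _ _ _ _ _ S')).
  - rewrite R1; reflexivity.
  - rewrite FA1; reflexivity. }
rewrite (surjective_pairing (RH u s r y)); fold (Re (RH u s r y)) (Im (RH u s r y)).
rewrite Im0; apply (f_equal RtoC); lra.
Qed.

(** The two moduli in [Ry] have product 1; rho is the larger one, so that R_y = 1/(4 rho^2). *)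
Lemma Ry_in_range z y : Rabs z < Ry y -> exists rho, in_range z rho y.
Proof.
unfold Ry; set (S := Csqrt (y ^ 2 - 1)); intros H.
assert (P : Cmod (y + S) * Cmod (y - S) = 1).
{ rewrite <- Cmod_mult, <- Cmod_1; f_equal.
  transitivity (y ^ 2 - S * S)%C; [ring | unfold S; rewrite Csqrt_sqr; ring]. }
(* The triangle inequality gives |y| <= (rho + 1/rho)/2 without separating |y| <= 1 from |y| > 1. *)
assert (T : 2 * Rabs y <= Cmod (y + S) + Cmod (y - S)).
{ apply Rle_trans with (2 := Cmod_triangle _ _).
  replace (y + S + (y - S))%C with (RtoC (2 * y)) by (rewrite RtoC_mult; ring).
  rewrite Cmod_R, Rabs_mult, (Rabs_pos_eq 2); lra. }
assert (A := Cmod_ge_0 (y + S)); assert (B := Cmod_ge_0 (y - S)).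
set (a := Cmod (y + S)) in *; set (b := Cmod (y - S)) in *.
assert (G : exists m n, m * n = 1 /\ 0 < m <= n /\ a + b = m + n /\ Rabs z < / 4 * m ^ 2).
{ unfold Rmin in H; destruct (Rle_dec a b); [exists a, b | exists b, a]; repeat split; nra. }
destruct G as (m & n & E & Hm & Eab & Hz).
assert (Hn : 1 <= n) by nra.
assert (Em : / n = m) by (apply Rmult_eq_reg_r with n; [rewrite E; field |]; lra).
exists n; unfold in_range; rewrite Em; split; [exact Hn | split; [lra |]].
assert (E2 : m ^ 2 * n ^ 2 = 1) by (rewrite <- Rpow_mult_distr, E; ring).
rewrite <- E2; apply Rmult_lt_compat_r; [apply pow_lt |]; lra.
Qed.

(** Each root has argument strictly between -PI/4 and PI/4. *)
Lemma Csqrt_mult_Re_pos a b : 0 < Re a -> 0 < Re b -> 0 < Re (Csqrt a * Csqrt b)%C.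
Proof.
intros Ha Hb.
assert (K : forall c, 0 < Re c -> Rabs (Im (Csqrt c)) < Re (Csqrt c)).
{ intros c Hc; assert (S := f_equal Re (Csqrt_sqr c)).
  assert (P : 0 <= Re (Csqrt c)) by apply sqrt_pos.
  destruct (Csqrt c) as [p q]; simpl in *.
  apply Rabs_lt_between; split; nra. }
apply K in Ha; apply K in Hb; apply Rabs_lt_between in Ha; apply Rabs_lt_between in Hb.
destruct (Csqrt a) as [p q], (Csqrt b) as [p' q']; simpl in *.
destruct (Rle_lt_dec 0 (q * q')); nra.
Qed.

Lemma pp_ww_Re_pos u s y : root_u u s -> -1 < u < 1 -> dom u y -> 0 < Re (pp u y + ww s y)%C.
Proof.
intros Hs Hu Hd; assert (B := root_u_Re_lt u s y Hs (proj1 Hu) Hd).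
apply Rabs_lt_between in B; unfold ww; destruct s; simpl in *; lra.
Qed.

(** Identifies the branch of the theorem: the principal root of the whole radicand is sqrt (v (1 -
    v)) / (1 + u) times the principal roots of w and G, because this product has positive real
    part. *)
Lemma Ipm_hh u s r y : root_u u s -> -1 < u < 1 -> dom u y ->
  let w := (pp u y + ww s y)%C in
  Ipm_cv r u (w ^ 2)%C /\ Ipm r u (w ^ 2)%C = (Cisqrt w * hh u s r y)%C.
Proof.
intros Hs Hu Hd w; assert (Hw : 0 < Re w) by now apply pp_ww_Re_pos.
assert (CF := Ccont_Fh u s r y Hs Hu Hd).
set (F := fun t => ((1 + u) * Cisqrt w * Fh u s r y t)%C).
assert (CFF : Ccont F) by (unfold F; ccont).
assert (EF : CI F = ((1 + u) * Cisqrt w * CI (Fh u s r y))%C) by now apply CI_scal.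
assert (U2 : (1 + u)%C <> 0%C) by (rewrite <- RtoC_plus; apply RtoC_neq; lra).
assert (E : forall v, 0 < v < 1 ->
  Ipm_integrand r u (w ^ 2) v = (RtoC (/ sqrt (v * (1 - v))) * F (theta v))%C).
{ intros v Hv; assert (P : 0 < v * (1 - v)) by nra; assert (SP := sqrt_lt_R0 _ P).
  assert (HG := GG_Re_pos u s y (theta v) Hs Hu Hd).
  unfold Ipm_integrand, F, Fh, QQ, Nh, Cisqrt; set (G := GG u s y (theta v)) in *.
  rewrite vv_theta by lra.
  assert (CR := Csqrt_mult_Re_pos w G Hw HG).
  rewrite (Csqrt_unique _ (RtoC (sqrt (v * (1 - v)) / (1 + u)) * (Csqrt w * Csqrt G))%C).
  - assert (NN : (Csqrt w * Csqrt G)%C <> 0%C).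
    { intros Z; rewrite Z in CR; simpl in CR; lra. }
    assert (N1 : Csqrt w <> 0%C) by (intros Z; apply NN; rewrite Z; ring).
    assert (N2 : Csqrt G <> 0%C) by (intros Z; apply NN; rewrite Z; ring).
    assert (N3 : RtoC (sqrt (v * (1 - v))) <> 0%C) by (apply RtoC_neq; lra).
    rewrite RtoC_inv, RtoC_div, RtoC_plus by lra; field; tauto.
  - rewrite re_scal_l; apply Rmult_lt_0_compat; [| exact CR].
    apply Rdiv_lt_0_compat; lra.
  - transitivity (RtoC (sqrt (v * (1 - v)) / (1 + u) * (sqrt (v * (1 - v)) / (1 + u)))
      * ((Csqrt w * Csqrt w) * (Csqrt G * Csqrt G)))%C; [rewrite RtoC_mult; ring |].
    rewrite !Csqrt_sqr.
    replace (sqrt (v * (1 - v)) / (1 + u) * (sqrt (v * (1 - v)) / (1 + u)))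
      with ((sqrt (v * (1 - v)) * sqrt (v * (1 - v))) / ((1 + u) * (1 + u))) by (field; lra).
    rewrite sqrt_sqrt, RtoC_div, !RtoC_mult, RtoC_plus, RtoC_minus by nra.
    unfold G, GG, Gp, av, bv; rewrite vv_theta by lra; unfold w.
    assert (Hp := ww_sqr u s y Hs Hd).
    simpl Cpow; field [Hp]; exact U2. }
assert (I := is_RInt_gen_theta F _ CFF E).
split; [now exists (CI F) |].
unfold Ipm; rewrite (is_RInt_gen_unique (V := C_R_CompleteNormedModule) _ _ I), EF.
unfold hh; rewrite RtoC_div, RtoC_plus by apply PI_neq0.
field; apply RtoC_neq, PI_neq0.
Qed.

Lemma wval_pp y z s : dom (4 * z) y -> wval y z s = (pp (4 * z) y + ww s y)%C.
Proof.
intros Hd; unfold wval, ww; f_equal.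
apply Csqrt_unique; [simpl; now apply pp_pos |].
rewrite <- RtoC_mult, pp_sqr by exact Hd.
rewrite RtoC_minus, RtoC_pow, RtoC_plus, !RtoC_mult, RtoC_pow; ring.
Qed.

Lemma RH_opp u s r y : RH u s r (- y) = RH u (- s) r y.
Proof.
assert (Ep : pp u (- y) = pp u y) by (unfold pp; do 2 f_equal; ring).
assert (Ew : ww s (- y) = ww (- s) y) by (unfold ww; rewrite RtoC_opp; ring).
assert (EF : forall r0, CI (Fh u s r0 (- y)) = CI (Fh u (- s) r0 y)).
{ intros r0; apply CI_ext; intros t; unfold Fh, QQ, GG; now rewrite Ep, Ew. }
unfold RH, hh; now rewrite !EF.
Qed.

Lemma al_opp z k y : al z k (- y) = al z k y.
Proof.
apply Series_ext; intros n; destruct (leg_opp n y) as [E _]; rewrite E.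
rewrite Rpow_mult_distr, <- pow_mult, Nat.mul_comm, pow_1_even; ring.
Qed.

Lemma RH_0 y : RH 0 0 0 y = 1%C.
Proof.
assert (E : hh 0 0 0 y = 1%C).
{ unfold hh; rewrite (CI_ext _ (fun _ => 1%C)).
  - unfold CI; simpl; rewrite !RInt_const; unfold scal; simpl; unfold mult; simpl.
    unfold RtoC, Cmult; simpl; f_equal; field; apply PI_neq0.
  - intros t; unfold Fh, QQ.
    replace (GG 0 0 y t) with (RtoC 1); [rewrite Cisqrt_1; unfold Nh; ring |].
    unfold GG, Gp, pp, ww, av, bv.
    replace ((1 + 0) ^ 2 - 4 * 0 * y ^ 2) with 1 by ring; rewrite sqrt_1; ring. }
unfold RH; replace (- 0)%C with (RtoC 0) by ring; rewrite E; ring.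
Qed.

Lemma Ftilde_RH z rho y s r : in_range z rho y ->
  root_u (4 * z) s -> (r * r = 2 * (4 * z)%R ^ 2 - 2 * (4 * z)%R)%C ->
  RtoC (Ftilde y z) = RH (4 * z) s r y.
Proof.
intros Hy Hs Hr.
destruct (Req_dec z 0) as [-> | Hz].
- assert (Z : forall c : C, (c * c = 0)%C -> c = 0%C).
  { intros c E; apply Cmod_eq_0; apply (f_equal Cmod) in E.
    rewrite Cmod_mult, Cmod_0 in E; nra. }
  rewrite Rmult_0_r in *; unfold root_u in Hs.
  rewrite (Z s), (Z r), RH_0.
  + unfold Ftilde; rewrite PSeries_0; unfold Ftilde_coef; rewrite legendre_leg.
    f_equal; unfold Binomial.C, leg; simpl. field.
  + rewrite Hr; ring.
  + transitivity (4 * s * s / 4)%C; [field | rewrite Hs; field].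
- rewrite Ftilde_al; destruct (Rle_lt_dec 0 y) as [H | H].
  + now apply al_RH with rho.
  + rewrite <- al_opp, <- (Ropp_involutive y), RH_opp, Ropp_involutive.
    apply al_RH with rho; try assumption; [| lra |].
    * apply (in_range_le _ _ _ _ Hy); rewrite Rabs_Ropp; exact (proj1 (proj2 Hy)).
    * unfold root_u in *; rewrite <- Hs; ring.
Qed.

Theorem theorem1 :
  forall (y z : R) (s r : C),
    Rabs z < Ry y ->
    (s ^ 2 = - z)%C ->
    (r ^ 2 = 2 * (4 * z) ^ 2 - 2 * (4 * z))%C ->
    let w := wval y z s in
    ex_pseries (Ftilde_coef y) z /\
    Ipm_cv r (4 * z)%C (w ^ 2)%C /\
    Ipm_cv (- r)%C (4 * z)%C (w ^ 2)%C /\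
    RtoC (Ftilde y z)
      = (w * Ipm r (4 * z) (w ^ 2) * Ipm (- r) (4 * z) (w ^ 2))%C.
Proof.
intros y z s r Hz Hs Hr w.
destruct (Ry_in_range z y Hz) as [rho Hy].
assert (Hd := in_range_dom z rho y Hy); assert (Hz4 := in_range_abs z rho y Hy).
assert (Hu : -1 < 4 * z < 1) by (apply Rabs_lt_between; rewrite Rabs_mult, (Rabs_pos_eq 4); lra).
assert (Hs' : root_u (4 * z) s).
{ unfold root_u; transitivity (4 * s ^ 2)%C; [simpl; ring | rewrite Hs, RtoC_mult; ring]. }
rewrite <- RtoC_mult in *.
assert (Hr' : (r * r = 2 * (4 * z)%R ^ 2 - 2 * (4 * z)%R)%C) by (rewrite <- Hr; simpl; ring).
assert (Ew : w = (pp (4 * z) y + ww s y)%C) by now apply wval_pp.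
destruct (Ipm_hh _ s r y Hs' Hu Hd) as [C1 E1].
destruct (Ipm_hh _ s (- r)%C y Hs' Hu Hd) as [C2 E2].
rewrite Ew; split; [now apply ex_pseries_Ftilde with rho |].
split; [exact C1 |]; split; [exact C2 |].
rewrite E1, E2, (Ftilde_RH z rho y s r Hy Hs' Hr'); unfold RH.
(* The prefactor w of the theorem absorbs the two factors 1 / sqrt w coming from [Ipm_hh]. *)
assert (Q := Cisqrt_sqr _ (pp_ww_Re_pos _ s y Hs' Hu Hd)).
set (W := (pp (4 * z) y + ww s y)%C) in *.
transitivity (Cisqrt W * Cisqrt W * W * (hh (4 * z) s r y * hh (4 * z) s (- r) y))%C;
  [rewrite Q; ring | ring].
Qed.
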